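(* Let $d\ge 1$ be an integer, let $1<p,q<\infty$ and $0<\theta,\phi<\infty$. Then there exists a constant $C>0$ (independent of $f$) such that $$\big\||x|^\theta f\big\|_p\cdot\big\||\xi|^\phi\hat f\big\|_q\ \ge\ C\,\|f\|_2^2\qquad\text{for all } f\in\mathcal{S}(\mathbb{R}^d)$$ if and only if $$\frac{\theta}{d}>\frac12-\frac1p,\qquad \frac{\phi}{d}>\frac12-\frac1q,\qquad\text{and}\qquad \frac1q+\frac{\phi}{d}=\frac1p+\frac{\theta}{d}.$$
   Context: $\mathcal{S}(\mathbb{R}^d)$ is the Schwartz class of complex-valued functions on $\mathbb{R}^d$. The Fourier transform is normalized as $\hat f(\xi)=\int_{\mathbb{R}^d}f(x)e^{-2\pi i x\cdot\xi}\,dx$. $|x|$ is the Euclidean norm and $\|\cdot\|_p$ is the $L^p(\mathbb{R}^d)$ norm; $|x|^\theta f$ denotes the function $x\mapsto |x|^\theta f(x)$ and $|\xi|^\phi\hat f$ the function $\xi\mapsto|\xi|^\phi\hat f(\xi)$. *)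

(* Defs.v *)
From HB Require Import structures.
From mathcomp Require Import all_boot all_order all_algebra.
From mathcomp Require Import complex.
From mathcomp Require Import all_classical all_reals all_analysis.

Set Implicit Arguments.
Unset Strict Implicit.
Unset Printing Implicit Defensive.
Import Order.TTheory GRing.Theory Num.Theory.
Import numFieldNormedType.Exports.

Local Open Scope classical_set_scope.
Local Open Scope ring_scope.
Local Open Scope complex_scope.

(* Row vectors carry the product sigma-algebra, as n.-tuple T does in the
   library; for T = R it is the Borel sigma-algebra of R^n. *)
Definition measure_rV_display : measure_display -> measure_display.
Proof. exact. Qed.

Section measurable_rV.
Context {d} {T : sigmaRingType d}.
Variable n : nat.

Let coors : 'I_n -> 'rV[T]_n -> T := fun i x => x ord0 i.

Let rV_set0 : g_sigma_preimage coors set0.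
Proof. exact: sigma_algebra0. Qed.

Let rV_setC A : g_sigma_preimage coors A -> g_sigma_preimage coors (~` A).
Proof. exact: sigma_algebraC. Qed.

Let rV_bigcup (F : _^nat) : (forall i, g_sigma_preimage coors (F i)) ->
  g_sigma_preimage coors (\bigcup_i (F i)).
Proof. exact: sigma_algebra_bigcup. Qed.

HB.instance Definition _ := @isMeasurable.Build (measure_rV_display d)
  'rV[T]_n (g_sigma_preimage coors) rV_set0 rV_setC rV_bigcup.

End measurable_rV.

Lemma measurable_coord d (T : sigmaRingType d) n (i : 'I_n) :
  measurable_fun [set: 'rV[T]_n] (fun x : 'rV[T]_n => x ord0 i).
Proof.
move=> _ Y mY; rewrite setTI; apply: sub_sigma_algebra => /=.
rewrite -bigcup_seq/=; exists i => /=; first by rewrite mem_index_enum.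
by exists Y => //; rewrite setTI.
Qed.

Lemma measurable_fun_rVP d1 d2 (T1 : measurableType d1)
    (T2 : measurableType d2) n (f : T1 -> 'rV[T2]_n) :
  measurable_fun [set: T1] f <->
  forall i, measurable_fun [set: T1] (fun x => f x ord0 i).
Proof.
split=> [mf i|mf].
  exact: (measurableT_comp (measurable_coord i) mf).
rewrite /measurable_fun => _.
suff : measurable `<=` [set A | measurable (f @^-1` A)].
  by move=> H A mA; rewrite setTI; exact: H.
apply: smallest_sub.
  split=> [|A/= mA|F/= mF].
  - by rewrite /= preimage_set0.
  - by rewrite setTD preimage_setC; exact: measurableC.
  - by rewrite preimage_bigcup; exact: bigcup_measurable.
rewrite -bigcup_seq => A [i _] [B mB <-] /=; rewrite setTI.
by have := mf i measurableT B mB; rewrite setTI.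
Qed.

Section lebesgue_measure_rV.
Context {R : realType}.

Definition cons_rV n (u : R * 'rV[R]_n) : 'rV[R]_n.+1 :=
  \row_i oapp (u.2 ord0) u.1 (unlift ord0 i).

Definition uncons_rV n (v : 'rV[R]_n.+1) : R * 'rV[R]_n :=
  (v ord0 ord0, \row_j v ord0 (lift ord0 j)).

Lemma cons_rV0 n (u : R * 'rV[R]_n) : cons_rV u ord0 ord0 = u.1.
Proof. by rewrite mxE unlift_none. Qed.

Lemma cons_rVS n (u : R * 'rV[R]_n) j : cons_rV u ord0 (lift ord0 j) = u.2 ord0 j.
Proof. by rewrite mxE liftK. Qed.

Lemma cons_rVK n : cancel (@cons_rV n) (@uncons_rV n).
Proof.
case=> t x; rewrite /uncons_rV cons_rV0; congr pair.
by apply/rowP => j; rewrite mxE cons_rVS.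
Qed.

Lemma measurable_cons_rV n :
  measurable_fun [set: R * 'rV[R]_n] (@cons_rV n).
Proof.
apply/measurable_fun_rVP => i; case: (unliftP ord0 i) => [j|] ->.
  under eq_fun do rewrite cons_rVS.
  exact: (measurableT_comp (measurable_coord j) measurable_snd).
under eq_fun do rewrite cons_rV0.
exact: measurable_fst.
Qed.

Lemma measurable_uncons_rV n :
  measurable_fun [set: 'rV[R]_n.+1] (@uncons_rV n).
Proof.
apply: measurable_fun_pair; first exact: measurable_coord.
apply/measurable_fun_rVP => j; rewrite /comp /=.
under eq_fun do rewrite mxE.
exact: measurable_coord.
Qed.

Section lebesgue_cons.
Context {n : nat} (mu : {sigma_finite_measure set 'rV[R]_n -> \bar R}).

Definition lebesgue_cons : set 'rV[R]_n.+1 -> \bar R :=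
  pushforward (lebesgue_measure \x mu)%E (@cons_rV n).

Let lebesgue_cons0 : lebesgue_cons set0 = 0%E.
Proof. by rewrite /lebesgue_cons /pushforward preimage_set0 measure0. Qed.

Let lebesgue_cons_ge0 A : (0 <= lebesgue_cons A)%E.
Proof. exact: (@measure_ge0 _ _ _ (lebesgue_measure \x mu)%E). Qed.

Let lebesgue_cons_sigma_additive : semi_sigma_additive lebesgue_cons.
Proof.
have mc A : measurable A -> measurable (@cons_rV n @^-1` A).
  by move=> mA; rewrite -[X in measurable X]setTI; exact: measurable_cons_rV.
move=> F mF tF mUF; rewrite /lebesgue_cons /pushforward preimage_bigcup.
apply: (@measure_semi_sigma_additive _ _ _ (lebesgue_measure \x mu)%E).
- by move=> k; exact: mc.
- apply/trivIsetP => /= i j _ _ ij; rewrite -preimage_setI.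
  by move/trivIsetP : tF => /(_ _ _ _ _ ij) ->//; rewrite preimage_set0.
- by rewrite -preimage_bigcup; exact: mc.
Qed.

HB.instance Definition _ := isMeasure.Build _ _ _ lebesgue_cons
  lebesgue_cons0 lebesgue_cons_ge0 lebesgue_cons_sigma_additive.

Let lebesgue_cons_sigma_finite : sigma_finite setT lebesgue_cons.
Proof.
have /sigma_finiteP[F [FT ndF Foo]] := sigma_finiteT (@lebesgue_measure R).
have /sigma_finiteP[G [GT ndG Goo]] := sigma_finiteT mu.
exists (fun k => @uncons_rV n @^-1` (F k `*` G k)).
  rewrite -preimage_bigcup (_ : \bigcup_k _ = setT) ?preimage_setT//.
  apply/seteqP; split => // -[x y] _.
  have [i _ Fx] : (\bigcup_k F k) x by rewrite -FT.
  have [j _ Gy] : (\bigcup_k G k) y by rewrite -GT.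
  exists (maxn i j) => //; split => /=.
    by move: x Fx; exact/subsetPset/ndF/leq_maxl.
  by move: y Gy; exact/subsetPset/ndG/leq_maxr.
move=> k; have [mF Fk] := Foo k; have [mG Gk] := Goo k; split.
  rewrite -[X in measurable X]setTI; apply: measurable_uncons_rV => //.
  exact: measurableX.
rewrite /lebesgue_cons /pushforward -comp_preimage.
have -> : @uncons_rV n \o @cons_rV n = id by exact/funext/cons_rVK.
rewrite [ltLHS](product_measure1E lebesgue_measure mu)//.
by rewrite lte_mul_pinfty// ge0_fin_numE.
Qed.

HB.instance Definition _ := Measure_isSigmaFinite.Build _ _ _ lebesgue_cons
  lebesgue_cons_sigma_finite.

End lebesgue_cons.

(* n-dimensional Lebesgue measure, on Borel sets: the n-fold product of
   lebesgue_measure, transported along R x R^n ~ R^(n+1); see lebesgue_rV_box. *)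
Fixpoint lebesgue_rV n : {sigma_finite_measure set 'rV[R]_n -> \bar R} :=
  if n is n'.+1 then lebesgue_cons (lebesgue_rV n')
  else \d_(0 : 'rV[R]_0).

Lemma lebesgue_rV_box n (A : 'I_n -> set R) :
  (forall i, measurable (A i)) ->
  lebesgue_rV n [set x | forall i, A i (x ord0 i)] =
  (\prod_(i < n) lebesgue_measure (A i))%E.
Proof.
elim: n A => [|n IHn] A mA.
  rewrite big_ord0 /= diracE mem_set//= => i; by case: i.
have mB : measurable [set x : 'rV[R]_n | forall i, A (lift ord0 i) (x ord0 i)].
  have -> : [set x : 'rV[R]_n | forall i, A (lift ord0 i) (x ord0 i)] =
      \bigcap_(i in [set: 'I_n])
        ((fun x : 'rV[R]_n => x ord0 i) @^-1` A (lift ord0 i)).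
    by apply/seteqP; split => x /= Ax i; [move=> _|]; exact: Ax.
  apply: fin_bigcap_measurable => // i _.
  by rewrite -[X in measurable X]setTI; exact: measurable_coord.
rewrite big_ord_recl -IHn//= /lebesgue_cons /pushforward.
rewrite -[RHS](product_measure1E lebesgue_measure (lebesgue_rV n))//; last exact: mA.
congr (_ _); apply/seteqP; split => -[t x] /=.
  move=> Ax; split=> [|i] /=; first by have := Ax ord0; rewrite cons_rV0.
  by have := Ax (lift ord0 i); rewrite cons_rVS.
move=> [/= At Ax] i; case: (unliftP ord0 i) => [j|] ->.
  by rewrite cons_rVS; exact: Ax.
by rewrite cons_rV0.
Qed.

End lebesgue_measure_rV.

Section schwartz.
Context {R : realType} {n : nat}.
Implicit Types (f : 'rV[R]_n -> R[i]) (s : seq 'I_n).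

(* The library's derivative needs a normed R-module as codomain, which R[i] is
   not: complex-valued functions are differentiated componentwise. *)
Definition partial (i : 'I_n) f : 'rV[R]_n -> R[i] := fun x =>
  'D_(delta_mx ord0 i) (@complex.Re R \o f) x
  +i* 'D_(delta_mx ord0 i) (@complex.Im R \o f) x.

(* A multi-index derivative is given by the list of the coordinates along which
   one differentiates, so that partials [::] f is f. *)
Definition partials s f : 'rV[R]_n -> R[i] := foldr partial f s.

Definition smooth f : Prop := forall s,
  [/\ continuous (@complex.Re R \o partials s f : 'rV[R]_n -> R),
      continuous (@complex.Im R \o partials s f : 'rV[R]_n -> R) &
      forall (i : 'I_n) (x : 'rV[R]_n),
        derivable (@complex.Re R \o partials s f : 'rV[R]_n -> R)
          x (delta_mx ord0 i) /\
        derivable (@complex.Im R \o partials s f : 'rV[R]_n -> R)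
          x (delta_mx ord0 i)].

Definition schwartz f : Prop := smooth f /\
  forall (a : 'I_n -> nat) s, exists M : R, forall x : 'rV[R]_n,
    `|\prod_(i < n) x ord0 i ^+ a i| * Normc.normc (partials s f x) <= M.

End schwartz.

Section fourier.
Context {R : realType} {n : nat}.
Implicit Types (f : 'rV[R]_n -> R[i]) (x xi : 'rV[R]_n).

Definition dotprod x xi : R := \sum_(i < n) x ord0 i * xi ord0 i.

(* The norm `|x| of the library on row vectors is the sup norm. *)
Definition euclid_norm x : R := Num.sqrt (\sum_(i < n) x ord0 i ^+ 2).

Definition cexpi (t : R) : R[i] := cos t +i* sin t.

Definition cintegral f : R[i] :=
  (\int[lebesgue_rV n]_x complex.Re (f x))
  +i* (\int[lebesgue_rV n]_x complex.Im (f x)).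

Definition fourier f : 'rV[R]_n -> R[i] := fun xi =>
  cintegral (fun x => f x * cexpi (- (2 * pi * dotprod x xi))).

Definition Lp_norm (p : R) f : \bar R :=
  ('N[lebesgue_rV n]_p%:E [EFin \o (@Normc.normc R \o f)])%E.

Definition weighted (theta : R) f : 'rV[R]_n -> R[i] :=
  fun x => (euclid_norm x `^ theta)%:C * f x.

End fourier.

(* Main.v *)
(* Put s = 1/p + theta/d.

   Sufficiency (s = 1/q + phi/d > 1/2).  Choose r with 1 < r < min(p,q,2) and
   1/r < s.  Split f at |x| = T and fhat at |xi| = S.  By Hoelder the outer part
   of f is O(A T^(-d(s-1/r))) in L^r and its inner part is O(m T^(d(1/r-1/2))),
   where A = || |x|^theta f ||_p and m = ||f||_2; likewise for fhat, with B and S.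
   The inner part of f has an L^1 norm at most m (2T)^(d/2), so it contributes to
   the mass of fhat in |xi| <= S at most m (4TS)^(d/2) in L^2; every other
   interaction is bounded by Hoelder and Hausdorff-Young L^r -> L^r'.  With TS a
   small constant and T equalizing A T^(-d(s-1/2)) and B T^(d(s-1/2)), this gives
   m^2 <= m^2/2 + K (m (AB)^(1/2) + AB), hence m^2 <= K' AB.
   Hausdorff-Young (with a constant, for bounded integrable functions) is a
   layer-cake argument: at height lambda truncate f so that the transform of the
   large part is <= lambda/2, and apply Bessel's inequality to the small part.
   Bessel and Plancherel come from Gaussian summability.

   Necessity.  Gaussians exp(-a|x|^2), a > 0 arbitrary, force the equality.  If
   s <= 1/2, so that p, q > 2, let f be the sum over j < J of
   2^(-jd/2) exp((-4^(-j) + i)|x|^2).  The factor exp(i|x|^2) makes |fhat|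
   comparable to |f| at every scale, so that both weighted norms are
   O(J^(1/p)) and O(J^(1/q)), whereas ||f||_2^2 >= c J; since 1/p + 1/q < 1 this
   fails for J large. *)
Require Import Defs.
From HB Require Import structures.
From mathcomp Require Import all_boot all_order all_algebra.
From mathcomp Require Import complex.
From mathcomp Require Import all_classical all_reals all_analysis.
From mathcomp Require Import measurable_realfun.
From mathcomp Require Import ring lra.
Set Implicit Arguments.
Unset Strict Implicit.
Unset Printing Implicit Defensive.
Import Order.TTheory GRing.Theory Num.Theory.
Import numFieldNormedType.Exports.
Local Open Scope classical_set_scope.
Local Open Scope ring_scope.

(** * Borel measurability and integration on R^n *)

(** Hoelder's inequality only lowers an exponent: a weighted L^p bound controls a tail of f in L^r
    with r < p, and says nothing about it in L^2 when p <= 2. Hence the integral of |fhat|^2 is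
    treated as a pairing of an L^r factor (one copy of fhat, cut at radius S) with an L^r' factor
    (the transform of a piece of f), and Hausdorff-Young supplies the second one. The auxiliary r
    leaves no trace in the balance of the mixed terms, because d(s - 1/r) + d(1/r - 1/2) = d(s -
    1/2), which is positive exactly above the threshold. In the counterexample unmodulated Gaussians
    would not do: the transform sends the scale 2^j to 2^(-j), and there the weighted norm of fhat
    grows with j as soon as s < 1/2. The chirp keeps the scale. Since all the terms share one phase,
    |f| is the plain sum of the Gaussians, without cancellation, while |fhat| is bounded by the
    triangle inequality. *)

Lemma eqW d (T : porderType d) (x y : T) : x = y -> (x <= y)%O.
Proof. by move=> ->. Qed.

Section euclidean_measurability.
Context {R : realType}.

(** Balls of the sup norm are boxes, hence measurable for the product structure, and an open set is
    the union of the countably many balls with rational centre and radius 1/(m+1) that it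
    contains. *)
Lemma open_measurable_rV n (U : set 'rV[R]_n) : open U -> measurable U.
Proof.
move=> oU.
pose c (q : 'rV[rat]_n) : 'rV[R]_n := \row_i ratr (q ord0 i).
pose B (km : 'rV[rat]_n * nat) : set 'rV[R]_n := ball (c km.1) km.2.+1%:R^-1.
have mB km : measurable (B km).
  have -> : B km = \bigcap_(i in [set: 'I_n])
      ((fun x : 'rV[R]_n => x ord0 i) @^-1` ball (c km.1 ord0 i) km.2.+1%:R^-1).
    apply/seteqP; split=> [x [_ Bx] i _|x Bx]; first exact: Bx.
    by split=> [|i j]; rewrite ?invr_gt0 ?ltr0n// ord1; exact: Bx.
  apply: fin_bigcap_measurable => // i _.
  rewrite -[X in measurable X]setTI; apply: measurable_coord => //.
  exact: measurable_ball.
have -> : U = \bigcup_km (if `[< B km `<=` U >] then B km else set0).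
  apply/seteqP; split=> [x Ux|x [km _]]; last by case: asboolP => // + /=; exact.
  have /nbhs_ballP[e /= e0 xeU] := open_nbhs_nbhs (conj oU Ux).
  have [m _ me] := near_infty_natSinv_lt (PosNum (divr_gt0 e0 (ltr0n R 2))).
  have /= {}me := me _ (leqnn m).
  have m0 : 0 < m.+1%:R^-1 :> R by rewrite invr_gt0 ltr0n.
  have /choice[q xq] : forall i, exists q : rat,
      ball (x ord0 i) m.+1%:R^-1 (ratr q).
    move=> i; have xx : x ord0 i < x ord0 i + m.+1%:R^-1 by rewrite ltrDl.
    have [q] := rat_in_itvoo xx; rewrite in_itv/= => /andP[xq qx].
    by exists q; rewrite -ball_normE/= ltr_norml ltrBrDl ltrBlDr qx ltrBlDr (lt_trans xq)// ltrDr.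
  have xc : ball x m.+1%:R^-1 (c (\row_i q i)).
    by split=> // i j; rewrite !mxE ord1; exact: xq.
  exists (\row_i q i, m) => //; case: asboolP => [_|[]]; first exact: ball_sym.
  move=> y cy; apply: xeU; apply: le_ball (ball_triangle xc cy).
  by rewrite (splitr e) lerD// ltW.
apply: countable_bigcupT_measurable => [|km]; first exact: countableP.
by case: ifPn.
Qed.

Lemma continuous_measurable_rV n (f : 'rV[R]_n -> R) :
  continuous f -> measurable_fun setT f.
Proof.
move=> /continuousP cf; apply: (measurability _ (RGenOpens.measurableE R)).
move=> _ [_ [a [b ->] <-]]; rewrite setTI.
by apply: open_measurable_rV; apply: cf; exact: interval_open.
Qed.

End euclidean_measurability.

Section euclidean_integral.
Context {R : realType}.
Local Notation mu := (@lebesgue_measure R).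

Lemma ge0_integral_rVS n (F : 'rV[R]_n.+1 -> \bar R) :
  measurable_fun setT F -> (forall x, (0 <= F x)%E) ->
  (\int[lebesgue_rV n.+1]_x F x =
   \int[mu]_t \int[lebesgue_rV n]_x F (cons_rV (t, x)))%E.
Proof.
move=> mF F0.
(* By conversion: in positive dimension the measure unfolds to the pushforward of a product
   measure. *)
rewrite -[LHS]/(\int[pushforward (mu \x lebesgue_rV n) (@cons_rV R n)]_x F x)%E.
rewrite ge0_integral_pushforward//; last exact: measurable_cons_rV.
rewrite preimage_setT fubini_tonelli1//=.
apply: measurableT_comp => //; exact: measurable_cons_rV.
Qed.

Lemma ge0_integral_rV_pair n (F : 'rV[R]_n.+1 -> \bar R) :
  measurable_fun setT F -> (forall x, (0 <= F x)%E) ->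
  (\int[lebesgue_rV n.+1]_x F x =
   \int[mu \x lebesgue_rV n]_z F (cons_rV z))%E.
Proof.
move=> mF F0.
rewrite -[LHS]/(\int[pushforward (mu \x lebesgue_rV n) (@cons_rV R n)]_x F x)%E.
by rewrite ge0_integral_pushforward//; exact: measurable_cons_rV.
Qed.

Lemma integral_rVS n (F : 'rV[R]_n.+1 -> \bar R) :
  (lebesgue_rV n.+1).-integrable setT F ->
  (\int[lebesgue_rV n.+1]_x F x =
   \int[mu \x lebesgue_rV n]_z F (cons_rV z))%E.
Proof.
move=> /integrableP[mF iF].
rewrite -[LHS]/(\int[pushforward (mu \x lebesgue_rV n) (@cons_rV R n)]_x F x)%E.
rewrite integral_pushforward//; first exact: measurable_cons_rV.
apply/integrableP; split.
  by apply: measurableT_comp => //; exact: measurable_cons_rV.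
by rewrite preimage_setT -(@ge0_integral_rV_pair n (fun x => `|F x|%E))//; exact: measurableT_comp.
Qed.

Lemma ge0_integral_prod n (g : 'I_n -> R -> R) :
  (forall i, measurable_fun setT (g i)) -> (forall i t, 0 <= g i t) ->
  (\int[lebesgue_rV n]_x (\prod_i g i (x ord0 i))%:E =
   \prod_i \int[mu]_t (g i t)%:E)%E.
Proof.
elim: n g => [|n IHn] g mg g0.
  under eq_integral do rewrite big_ord0.
  by rewrite big_ord0 integral_cst//= diracE in_setT mul1e.
have mp m (h : 'I_m -> R -> R) : (forall i, measurable_fun setT (h i)) ->
    measurable_fun setT (fun x : 'rV[R]_m => \prod_i h i (x ord0 i)).
  move=> mh; apply: measurable_prod => i _.
  by apply: measurableT_comp => //; exact: measurable_coord.
rewrite ge0_integral_rVS//; [|by apply/measurable_EFinP; exact: (mp _ g)|by move=> x; rewrite lee_fin prodr_ge0].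
rewrite big_ord_recl -IHn//.
under eq_integral => t _.
  under eq_integral => x _.
    rewrite big_ord_recl cons_rV0/=.
    under eq_bigr do rewrite cons_rVS/=.
    rewrite EFinM; over.
  rewrite ge0_integralZl//; last 3 first.
  - by apply/measurable_EFinP; exact: (mp _ (fun i => g (lift ord0 i))).
  - by move=> x _; rewrite lee_fin prodr_ge0.
  - by rewrite lee_fin.
  over.
rewrite ge0_integralZr//.
- by apply/measurable_EFinP; exact: mg.
- by move=> x _; rewrite lee_fin.
- by apply: integral_ge0 => x _; rewrite lee_fin prodr_ge0.
Qed.

End euclidean_integral.

(** * Fubini's theorem for dominated and for product integrands *)

Section real_fubini.
Context {R : realType} d1 d2 (T1 : measurableType d1) (T2 : measurableType d2).
Variable m1 : {sigma_finite_measure set T1 -> \bar R}.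
Variable m2 : {sigma_finite_measure set T2 -> \bar R}.

Lemma integrable_le (f g : T1 -> R) : measurable_fun setT f ->
  (forall x, `|f x| <= g x) -> m1.-integrable setT (EFin \o g) ->
  m1.-integrable setT (EFin \o f).
Proof.
move=> mf fg; apply: le_integrable => //; first exact/measurable_EFinP.
by move=> x _ /=; rewrite lee_fin (le_trans (fg x))// ler_norm.
Qed.

Lemma integrable_mulfst (u : T1 -> R) (v : T2 -> R) :
  m1.-integrable setT (EFin \o u) -> m2.-integrable setT (EFin \o v) ->
  (m1 \x m2)%E.-integrable setT (EFin \o (fun z : T1 * T2 => u z.1 * v z.2)).
Proof.
move=> iu iv.
have [mu mv] : measurable_fun setT u /\ measurable_fun setT v.
  by split; apply/measurable_EFinP; [exact: measurable_int iu|exact: measurable_int iv].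
have mF : measurable_fun setT (fun z : T1 * T2 => (u z.1 * v z.2)%:E).
  by apply/measurable_EFinP; apply: measurable_funM; apply: measurableT_comp.
apply/integrable12ltyP => //=.
have /integrableP[_ iu'] := iu; have /integrableP[_ iv'] := iv.
under eq_integral => x _.
  under eq_integral => y _ do rewrite normrM EFinM.
  rewrite ge0_integralZl//; last by apply/measurable_EFinP; exact: measurableT_comp.
  over.
rewrite ge0_integralZr//; last 2 first.
- by apply/measurable_EFinP; exact: measurableT_comp.
- exact: integral_ge0.
by rewrite lte_mul_pinfty// ?ge0_fin_numE//; exact: integral_ge0.
Qed.

Lemma Rintegral_mulfst (u : T1 -> R) (v : T2 -> R) :
  m1.-integrable setT (EFin \o u) -> m2.-integrable setT (EFin \o v) ->
  \int[(m1 \x m2)%E]_z (u z.1 * v z.2) = (\int[m1]_x u x) * (\int[m2]_y v y).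
Proof.
move=> iu iv; rewrite /Rintegral -integral12_prod_meas1; last exact: integrable_mulfst.
rewrite /fubini_F/=.
have vf : (\int[m2]_y (v y)%:E)%E \is a fin_num by exact: integrable_fin_num iv.
have uf : (\int[m1]_x (u x)%:E)%E \is a fin_num by exact: integrable_fin_num iu.
under eq_integral => x _.
  under eq_integral => y _ do rewrite EFinM.
  rewrite integralZl// -(fineK vf).
  over.
by rewrite integralZr// -(fineK uf).
Qed.

Variable F : T1 * T2 -> R.
Hypothesis mF : measurable_fun setT F.
Variables (u : T1 -> R) (v : T2 -> R).
Hypotheses (iu : m1.-integrable setT (EFin \o u))
  (iv : m2.-integrable setT (EFin \o v)).
Hypothesis Fuv : forall x y, `|F (x, y)| <= u x * v y.

Lemma integrable_section2 x : m2.-integrable setT (EFin \o (fun y => F (x, y))).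
Proof.
have mFx : measurable_fun setT (fun y => F (x, y)) by exact: measurableT_comp.
apply: (@le_integrable _ _ _ _ _ _ _ (EFin \o (fun y => u x * v y))) => //.
- exact/measurable_EFinP.
- by move=> y _ /=; rewrite lee_fin (le_trans (Fuv x y))// ler_norm.
by rewrite /comp/=; under eq_fun do rewrite EFinM; apply: integrableZl.
Qed.

Lemma integrable_section1 y : m1.-integrable setT (EFin \o (fun x => F (x, y))).
Proof.
have mFy : measurable_fun setT (fun x => F (x, y)) by exact: measurableT_comp.
apply: (@le_integrable _ _ _ _ _ _ _ (EFin \o (fun x => u x * v y))) => //.
- exact/measurable_EFinP.
- by move=> x _ /=; rewrite lee_fin (le_trans (Fuv x y))// ler_norm.
by rewrite /comp/=; under eq_fun do rewrite EFinM; apply: integrableZr.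
Qed.

Lemma integrable_dominated_product : (m1 \x m2)%E.-integrable setT (EFin \o F).
Proof.
apply: (@le_integrable _ _ _ _ _ _ _ (EFin \o (fun z : T1 * T2 => u z.1 * v z.2))) => //.
- exact/measurable_EFinP.
- by move=> [x y] _ /=; rewrite lee_fin (le_trans (Fuv x y))// ler_norm.
exact: integrable_mulfst.
Qed.

(** Domination by a product at every point makes every section integrable, not just almost every
    one, so that [fine] can be removed from the inner real integrals everywhere. *)
Lemma dominated_Fubini :
  \int[m1]_x \int[m2]_y F (x, y) = \int[m2]_y \int[m1]_x F (x, y).
Proof.
have := Fubini integrable_dominated_product.
rewrite /Rintegral => FF.
under eq_integral => x _ do rewrite fineK ?(integrable_fin_num _ (integrable_section2 x))//.
under [in RHS]eq_integral => y _ do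
  rewrite fineK ?(integrable_fin_num _ (integrable_section1 y))//.
by rewrite FF.
Qed.

Lemma integrable_dominated_integral2 :
  m1.-integrable setT (EFin \o (fun x => \int[m2]_y F (x, y))).
Proof.
rewrite (_ : EFin \o _ = fubini_F m2 (EFin \o F)).
  exact: integrable_fubini_F integrable_dominated_product.
apply/funext => x /=; rewrite /Rintegral fineK//.
exact: integrable_fin_num (integrable_section2 x).
Qed.

End real_fubini.

(** * Complex integrals of products of one-variable functions *)

Section complex_integral.
Context {R : realType} d (T : measurableType d).
Variable m : {measure set T -> \bar R}.

Definition cintegrable (f : T -> R[i]) :=
  m.-integrable setT (EFin \o (fun x => complex.Re (f x))) /\
  m.-integrable setT (EFin \o (fun x => complex.Im (f x))).

Definition cint (f : T -> R[i]) : R[i] :=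
  ((\int[m]_x complex.Re (f x)) +i* (\int[m]_x complex.Im (f x)))%C.

End complex_integral.

Section complex_product_integral.
Context {R : realType}.
Local Notation mu := (@lebesgue_measure R).

Lemma integrable_rVS n (F : 'rV[R]_n.+1 -> R) :
  measurable_fun setT F ->
  (mu \x lebesgue_rV n)%E.-integrable setT (EFin \o (F \o @cons_rV R n)) ->
  (lebesgue_rV n.+1).-integrable setT (EFin \o F).
Proof.
move=> mF /integrableP[_ iF]; apply/integrableP; split; first exact/measurable_EFinP.
rewrite ge0_integral_rV_pair//.
by apply: measurableT_comp => //; exact/measurable_EFinP.
Qed.

(** One coordinate is split off at a time; the complex product then expands into four real products,
    each integrated by [Rintegral_mulfst]. This reduces Gaussian and chirp transforms to dimension
    one. *)
Lemma cintegral_prod n (g : 'I_n -> R -> R[i]) :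
  (forall i, cintegrable mu (g i)) ->
  cintegrable (lebesgue_rV n) (fun x => \prod_i g i (x ord0 i)) /\
  cintegral (fun x : 'rV[R]_n => \prod_i g i (x ord0 i)) = \prod_i cint mu (g i).
Proof.
elim: n g => [|n IHn] g ig.
  have i1 (c : R) : (lebesgue_rV 0).-integrable setT (EFin \o (cst c : 'rV[R]_0 -> R)).
    apply/integrableP; split; first exact/measurable_EFinP.
    by rewrite /= integral_cst//= diracE in_setT mule1 ltry.
  have e : (fun x : 'rV[R]_0 => \prod_i g i (x ord0 i)) = cst 1.
    by apply/funext => x; rewrite big_ord0.
  rewrite e big_ord0; split; first by split; exact: i1.
  rewrite /cintegral/= !Rintegral_cst//= indicT mulr1 mul0r.
  by [].
have [[iRe iIm] IH] := IHn (fun i => g (lift ord0 i)) (fun i => ig _).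
set G := fun x : 'rV[R]_n => _ in iRe iIm IH.
have [iRe0 iIm0] := ig ord0.
have E (z : R * 'rV[R]_n) : \prod_i g i (cons_rV z ord0 i) = g ord0 z.1 * G z.2.
  rewrite big_ord_recl cons_rV0; congr (_ * _).
  by apply: eq_bigr => i _; rewrite cons_rVS.
have E' (x : 'rV[R]_n.+1) : \prod_i g i (x ord0 i) =
    g ord0 (uncons_rV x).1 * G (uncons_rV x).2.
  rewrite big_ord_recl /=; congr (_ * _).
  by apply: eq_bigr => i _; rewrite mxE.
have ReM (a b : R[i]) : complex.Re (a * b) =
    complex.Re a * complex.Re b - complex.Im a * complex.Im b by case: a b => ? ? [].
have ImM (a b : R[i]) : complex.Im (a * b) =
    complex.Re a * complex.Im b + complex.Im a * complex.Re b by case: a b => ? ? [].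
have pint (u : R -> R) (U : 'rV[R]_n -> R) : mu.-integrable setT (EFin \o u) ->
    (lebesgue_rV n).-integrable setT (EFin \o U) ->
    (lebesgue_rV n.+1).-integrable setT (EFin \o (fun x => u (uncons_rV x).1 * U (uncons_rV x).2))
    /\ \int[lebesgue_rV n.+1]_x (u (uncons_rV x).1 * U (uncons_rV x).2) =
      (\int[mu]_t u t) * (\int[lebesgue_rV n]_x U x).
  move=> iu iU.
  have i1 : (lebesgue_rV n.+1).-integrable setT
      (EFin \o (fun x => u (uncons_rV x).1 * U (uncons_rV x).2)).
    apply: integrable_rVS.
      have mu' : measurable_fun setT u by apply/measurable_EFinP; exact: measurable_int iu.
      have mU : measurable_fun setT U by apply/measurable_EFinP; exact: measurable_int iU.
      apply: measurable_funM; apply: measurableT_comp => //.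
        by apply: measurableT_comp measurable_fst _; exact: measurable_uncons_rV.
      by apply: measurableT_comp measurable_snd _; exact: measurable_uncons_rV.
    rewrite /comp; under eq_fun do rewrite cons_rVK.
    exact: integrable_mulfst.
  split=> //; rewrite /Rintegral integral_rVS//.
  rewrite -[RHS]/((\int[mu]_t u t) * (\int[lebesgue_rV n]_x U x)) -Rintegral_mulfst//.
  by rewrite /Rintegral; congr fine; apply: eq_integral => z _; rewrite cons_rVK.
have [rr rrE] := pint _ _ iRe0 iRe; have [ii iiE] := pint _ _ iIm0 iIm.
have [ri riE] := pint _ _ iRe0 iIm; have [ir irE] := pint _ _ iIm0 iRe.
have -> : (fun x : 'rV[R]_n.+1 => \prod_i g i (x ord0 i)) =
   (fun x => g ord0 (uncons_rV x).1 * G (uncons_rV x).2) by apply/funext.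
split.
  split; rewrite /comp/=.
    under eq_fun do rewrite ReM EFinB.
    exact: integrableB.
  under eq_fun do rewrite ImM EFinD.
  exact: integrableD.
rewrite big_ord_recl -IH /cintegral.
under eq_Rintegral do rewrite ReM.
under [in X in (_ +i* X)%C]eq_Rintegral do rewrite ImM.
by rewrite RintegralB// RintegralD// rrE iiE riE irE.
Qed.

End complex_product_integral.

(** * Gaussian integrals *)

Section gaussian_integral.
Context {R : realType}.
Local Notation mu := (@lebesgue_measure R).
Implicit Types a b w t : R.

Definition gauss a t : R := expR (- (a * t ^+ 2)).

Lemma gauss_ge0 a t : 0 <= gauss a t. Proof. exact: expR_ge0. Qed.

Lemma measurable_gauss a : measurable_fun setT (gauss a).
Proof.
apply: measurableT_comp => //; apply: measurableT_comp => //.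
by apply: measurable_funM => //; exact: measurable_funX.
Qed.

(** The total mass of the normal density whose standard deviation s satisfies 1 / (2 s^2) = a. *)
Lemma integral_gauss_center a m : 0 < a ->
  (\int[mu]_t (gauss a (t - m))%:E)%E = (Num.sqrt (pi / a))%:E.
Proof.
move=> a0; set s : R := (Num.sqrt (a *+ 2))^-1.
have s0 : s != 0 by rewrite invr_eq0 gt_eqF// sqrtr_gt0 mulrn_wgt0.
have s2 : s ^+ 2 = (a *+ 2)^-1 by rewrite exprVn sqr_sqrtr// mulrn_wge0// ltW.
have a2 : a *+ 2 != 0 by rewrite mulrn_eq0/= gt_eqF.
have := integral_normal_pdf m s; rewrite normal_pdfE//.
have -> : normal_peak s = (Num.sqrt (pi / a))^-1.
  rewrite /normal_peak s2; congr (Num.sqrt _)^-1.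
  by rewrite -[_ *+ 2 in LHS]mulr_natr -[a *+ 2]mulr_natr; field; rewrite gt_eqF.
have -> : normal_fun m s = (fun t => gauss a (t - m)).
  apply/funext => t; rewrite /normal_fun /gauss s2; congr expR.
  by rewrite -[X in _ / X]mulr_natr -[a *+ 2]mulr_natr; field; rewrite gt_eqF.
have p0 : 0 < Num.sqrt (pi / a) by rewrite sqrtr_gt0 divr_gt0// pi_gt0.
under eq_integral do rewrite EFinM.
rewrite ge0_integralZl//; last 2 first.
- apply/measurable_EFinP; apply: (measurableT_comp (measurable_gauss a)).
  exact: measurable_funB.
- by move=> x _; rewrite lee_fin gauss_ge0.
move=> /(congr1 (fun x => (Num.sqrt (pi / a))%:E * x)%E).
by rewrite muleA -EFinM divff ?gt_eqF// mul1e mule1.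
Qed.

Lemma integral_gauss a : 0 < a ->
  (\int[mu]_t (gauss a t)%:E)%E = (Num.sqrt (pi / a))%:E.
Proof.
by move=> a0; rewrite -(integral_gauss_center 0 a0); under [RHS]eq_integral do rewrite subr0.
Qed.

Lemma integrable_gauss a : 0 < a -> mu.-integrable setT (EFin \o gauss a).
Proof.
move=> a0; apply/integrableP; split.
  by apply/measurable_EFinP; exact: measurable_gauss.
rewrite /comp/=; under eq_integral do rewrite ger0_norm ?gauss_ge0//.
by rewrite integral_gauss// ltry.
Qed.

(** Half of the exponent pays for the factor |t|: exp(a t^2 / 2) >= 1 + a t^2 / 2, and after
    multiplication by 1 + 1/a this exceeds 1 + t^2 / 2 >= |t|. *)
Lemma norm_mul_gauss a t : 0 < a ->
  `|t| * gauss a t <= (1 + a^-1) * gauss (a / 2) t.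
Proof.
move=> a0; have -> : gauss a t = gauss (a / 2) t * gauss (a / 2) t.
  by rewrite -expRD; congr expR; field.
rewrite mulrA ler_wpM2r ?gauss_ge0//.
have aV0 : 0 < a^-1 by rewrite invr_gt0.
have e1 : 1 + a / 2 * t ^+ 2 <= expR (a / 2 * t ^+ 2) by exact: expR_ge1Dx.
rewrite {1}/gauss expRN ler_pdivrMr ?expR_gt0//.
apply: le_trans (ler_wpM2l _ e1); last by rewrite addr_ge0// ltW.
have -> : (1 + a^-1) * (1 + a / 2 * t ^+ 2) =
    1 + a^-1 + a / 2 * t ^+ 2 + t ^+ 2 / 2 by field; rewrite gt_eqF.
have : 0 <= a / 2 * t ^+ 2 by rewrite mulr_ge0 ?sqr_ge0// divr_ge0// ltW.
have : 0 <= (`|t| - 1) ^+ 2 by exact: sqr_ge0.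
by rewrite sqrrB1 real_normK ?num_real//; lra.
Qed.

Lemma integrable_mul_gauss a : 0 < a ->
  mu.-integrable setT (EFin \o (fun t => `|t| * gauss a t)).
Proof.
move=> a0; apply: (@integrable_le _ _ _ mu _ (fun t => (1 + a^-1) * gauss (a / 2) t)).
- by apply: measurable_funM => //; exact: measurable_gauss.
- by move=> t; rewrite ger0_norm ?norm_mul_gauss// mulr_ge0// gauss_ge0.
rewrite /comp; under eq_fun do rewrite EFinM.
by apply: integrableZl => //; apply: integrable_gauss; rewrite divr_gt0.
Qed.

End gaussian_integral.

(** * Vanishing integrals of derivatives and a Gaussian differential equation *)

Section whole_line_ftc.
Context {R : realType}.
Local Notation mu := (@lebesgue_measure R).

(** The boundary-free form of integration by parts: apply the fundamental theorem on [-n, n] and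
    pass to the limit by dominated convergence. *)
Lemma Rintegral_deriv_eq0 (F f : R -> R) :
  (forall x : R, is_derive x 1 F (f x)) -> continuous f ->
  mu.-integrable setT (EFin \o f) ->
  F n%:R @[n --> \oo] --> 0 -> F (- n%:R) @[n --> \oo] --> 0 ->
  \int[mu]_x f x = 0.
Proof.
move=> dF cf fint Fy FNy.
pose fn (n : nat) x := (f \_ `[- n%:R, n%:R]) x.
have mf : measurable_fun setT f by apply/measurable_EFinP; exact: measurable_int fint.
have fnf : (\int[mu]_x (fn n x)%:E)%E @[n --> \oo] --> (\int[mu]_x (f x)%:E)%E.
  apply: (@dominated_cvg _ _ _ mu setT measurableT
    (fun n => EFin \o fn n) (EFin \o f) (EFin \o (Num.norm \o f))).
  - move=> n; apply/measurable_EFinP.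
    by apply/(measurable_restrictT _ _).1 => //; exact: measurable_funTS.
  - move=> x _; apply/cvg_EFin; first exact: nearW.
    apply: cvg_near_cst; near=> n.
    rewrite /= /fn patchE mem_set//= in_itv/= -ler_norml.
    by near: n; exact: nbhs_infty_ger.
  - by [].
  - rewrite (_ : EFin \o _ = abse \o (EFin \o f)); last exact/funext.
    exact: integrable_abse.
  - move=> n x _ /=; rewrite lee_fin /fn patchE.
    by case: ifPn => // _; rewrite normr0.
have fnE : \forall n \near \oo, (\int[mu]_x (fn n x)%:E)%E = (F n%:R - F (- n%:R))%:E.
  near=> n.
  have n0 : - n%:R < n%:R :> R.
    by rewrite gtrN// ltr0n; near: n; exact: nbhs_infty_gt.
  rewrite -[LHS]/(\int[mu]_x (EFin \o (f \_ `[- n%:R, n%:R])%R) x)%E.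
  rewrite -restrict_EFin -integral_mkcond.
  apply: continuous_FTC2 => //.
  - exact: continuous_subspaceT.
  - have dF' x : derivable F x 1 by have := dF x; case.
    have cF x : {for x, continuous F} by apply: differentiable_continuous; exact/derivable1_diffP.
    split => [x _ //||]; [apply: cvg_at_right_filter|apply: cvg_at_left_filter]; exact: cF.
  - by move=> x _; rewrite derive1E; have := dF x; case.
have F0 : (F n%:R - F (- n%:R))%:E @[n --> \oo] --> 0%E.
  apply: cvg_EFin; first exact: nearW.
  by rewrite -[X in _ --> X](subr0 0); exact: cvgB.
rewrite /Rintegral.
have fn0 : (\int[mu]_x (fn n x)%:E)%E @[n --> \oo] --> 0%E.
  by apply: cvg_trans F0; apply: near_eq_cvg; near=> n; near: n; exact: filterS fnE.
by rewrite -(cvg_unique (@ereal_hausdorff R) fn0 fnf).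
Unshelve. all: by end_near. Qed.

(** The product of f with exp(c x^2 / 2) has derivative zero. *)
Lemma ode_gauss (c : R) (f : R -> R) :
  (forall x : R, is_derive x 1 f (- (c * x) * f x)) ->
  forall x, f x = f 0 * expR (- (c / 2 * x ^+ 2)).
Proof.
move=> df x.
pose h (z : R) : R := c / 2 * z ^+ 2.
have dh (y : R) : is_derive y 1 h (c * y).
  by apply: is_derive_eq; rewrite /GRing.scale/=; field.
pose g : R -> R := f * (expR \o h).
have dg (y : R) : is_derive y 1 g 0.
  rewrite /g; apply: is_derive_eq; rewrite /GRing.scale/= /h; ring.
have /(congr1 (fun z => z * expR (- (c / 2 * x ^+ 2)))) := @is_derive_0_is_cst _ g x 0 dg.
rewrite /g !fctE /= /h expr0n/= mulr0 expR0 mulr1 => <-.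
by rewrite expRN mulfK// gt_eqF// expR_gt0.
Qed.

End whole_line_ftc.

(** * The Fourier transform of a chirp *)

Section chirp_fourier.
Context {R : realType}.
Local Notation mu := (@lebesgue_measure R).
Variables a b : R.
Hypothesis a0 : 0 < a.
Implicit Types w e t : R.

(* A shift of [e] by pi / 2 exchanges cosine and sine, so that the real and
   imaginary parts of the transform are treated as one family. *)
Let phase w e t : R := b * t ^+ 2 - w * t + e.

Let gph t : R := - (a * t ^+ 2).

Let dphase w e t : is_derive t 1 (phase w e) (2 * b * t - w).
Proof. by apply: is_derive_eq; rewrite /GRing.scale/=; ring. Qed.

Let dphasew e t w : is_derive w 1 (fun w' => phase w' e t) (- t).
Proof. by apply: is_derive_eq; rewrite /GRing.scale/=; ring. Qed.

Let dgph t : is_derive t 1 gph (- (2 * a * t)).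
Proof. by apply: is_derive_eq; rewrite /GRing.scale/=; ring. Qed.

Let chirpker w e : R -> R := (expR \o gph) * (cos \o phase w e).

Let chirpkerE w e t : chirpker w e t = gauss a t * cos (phase w e t).
Proof. by []. Qed.

Let derive_continuous (f : R -> R) :
  (forall t : R, derivable f t 1) -> continuous f.
Proof.
by move=> df x; apply: differentiable_continuous; apply/derivable1_diffP; exact: df.
Qed.

Let cphase w e : continuous (phase w e).
Proof. by apply: derive_continuous => t; exact: ex_derive. Qed.

Let mcos w e : measurable_fun setT (cos \o phase w e).
Proof.
apply: continuous_measurable_fun => t; apply: continuous_comp; first exact: cphase.
exact: continuous_cos.
Qed.

(** With I(w) the integral of exp(-(a - ib) t^2 - iwt), [chirpi w e] is the real part of exp(ie)
    I(w), and [chirpti w e] below is the real part of exp(ie) i I'(w). *)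
Let chirpi w e := \int[mu]_t chirpker w e t.

Let chirpti w e := \int[mu]_t (t * chirpker w e t).

Let integrable_chirpker w e : mu.-integrable setT (EFin \o chirpker w e).
Proof.
apply: (@integrable_le _ _ _ mu _ (gauss a)); last exact: integrable_gauss.
  by apply: measurable_funM; [exact: measurable_gauss|exact: mcos].
move=> t; rewrite chirpkerE normrM ger0_norm ?gauss_ge0//.
by rewrite ler_piMr ?gauss_ge0// ler_norml cos_geN1 cos_le1.
Qed.

Let mul_chirpker_le w e t : `|t * chirpker w e t| <= `|t| * gauss a t.
Proof.
rewrite chirpkerE !normrM (ger0_norm (gauss_ge0 _ _)) mulrA.
by rewrite ler_piMr ?mulr_ge0 ?gauss_ge0// ler_norml cos_geN1 cos_le1.
Qed.

Let integrable_tchirpker w e :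
  mu.-integrable setT (EFin \o (fun t => t * chirpker w e t)).
Proof.
apply: (@integrable_le _ _ _ mu _ (fun t => `|t| * gauss a t)) => //.
  by apply: measurable_funM => //; apply: measurable_funM; [exact: measurable_gauss|exact: mcos].
exact: integrable_mul_gauss.
Qed.

Let pih : R := pi / 2.

(** Differentiation in w brings out t times a sine, which is the cosine kernel with its phase
    lowered by pi / 2; the bound |t| exp(-a t^2) is uniform in w and justifies differentiating under
    the integral. *)
Let chirpi_deriv w e : is_derive w 1 (chirpi ^~ e) (chirpti w (e - pih)).
Proof.
have dk (w' t : R) : is_derive w' 1 (fun w'' => chirpker w'' e t) (t * chirpker w' (e - pih) t).
  have -> : (fun w'' => chirpker w'' e t) =
     cst (gauss a t) * (cos \o (fun w'' => phase w'' e t)) by [].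
  apply: is_derive_eq; rewrite /GRing.scale/= chirpkerE /phase addrA cosBpihalf; ring.
have wI : (`]w - 1, w + 1[%classic : set R) w by rewrite /= in_itv/=; lra.
have dE : forall x y : R, partial1of2 (fun w' t => chirpker w' e t) x y =
    y * chirpker x (e - pih) y.
  by move=> x y; rewrite partial1of2E; have := dk x y; case.
apply: DeriveDef.
  apply: (@derivable_under_integral _ _ _ mu (fun w' t => chirpker w' e t) setT measurableT
    w (w - 1) (w + 1) wI _ _ (fun t => `|t| * gauss a t)) => //.
  - by move=> t; rewrite mulr_ge0// gauss_ge0.
  - exact: integrable_mul_gauss.
  - by move=> x y _ _; rewrite dE mul_chirpker_le.
rewrite -derive1E (@differentiation_under_integral _ _ _ mu (fun w' t => chirpker w' e t) setT measurableT
    w (w - 1) (w + 1) wI _ _ (fun t => `|t| * gauss a t)) => //.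
- by apply: eq_Rintegral => t _; rewrite dE.
- by move=> t; rewrite mulr_ge0// gauss_ge0.
- exact: integrable_mul_gauss.
- by move=> x y _ _; rewrite dE mul_chirpker_le.
Qed.

(** The left-hand side is the integral of the t-derivative of the kernel, which vanishes at both
    ends of the line. *)
Let chirp_by_parts w e :
  - (2 * a) * chirpti w e - 2 * b * chirpti w (e - pih) + w * chirpi w (e - pih) = 0.
Proof.
pose f t := - (2 * a) * (t * chirpker w e t) - 2 * b * (t * chirpker w (e - pih) t)
  + w * chirpker w (e - pih) t.
have dF t : is_derive t 1 (chirpker w e) (f t).
  rewrite /chirpker; apply: is_derive_eq.
  by rewrite /f !chirpkerE /GRing.scale/= /gauss/gph /phase addrA cosBpihalf; ring.
have cf : continuous f.
  have d1 w' e' t : derivable (chirpker w' e') t 1.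
    by rewrite /chirpker; apply: ex_derive.
  apply: derive_continuous => t; rewrite /f.
  by apply: derivableD; [apply: derivableB|]; apply: derivableM => //; exact: derivableM.
have i1 := integrable_tchirpker w e.
have i2 := integrable_tchirpker w (e - pih).
have i3 := integrable_chirpker w (e - pih).
have j1 : mu.-integrable setT (EFin \o (fun t => - (2 * a) * (t * chirpker w e t))).
  by rewrite /comp; under eq_fun do rewrite EFinM; exact: integrableZl.
have j2 : mu.-integrable setT (EFin \o (fun t => 2 * b * (t * chirpker w (e - pih) t))).
  by rewrite /comp; under eq_fun do rewrite EFinM; exact: integrableZl.
have j3 : mu.-integrable setT (EFin \o (fun t => w * chirpker w (e - pih) t)).
  by rewrite /comp; under eq_fun do rewrite EFinM; exact: integrableZl.
have j12 : mu.-integrable setT (EFin \o (fun t =>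
   - (2 * a) * (t * chirpker w e t) - 2 * b * (t * chirpker w (e - pih) t))).
  by rewrite /comp; under eq_fun do rewrite EFinB; exact: integrableB.
have iff : mu.-integrable setT (EFin \o f).
  by rewrite /comp /f; under eq_fun do rewrite EFinD; exact: integrableD.
(* Stated for every sequence with |u n| = n, so as to serve both ends. The bound used is exp(a n^2)
   >= a n^2 >= a n >= 1 / r. *)
have lim0 (u : nat -> R) : (forall n, `|u n| = n%:R) -> chirpker w e (u n) @[n --> \oo] --> 0.
  move=> un; apply/cvgr0Pnorm_le => r r0; near=> n.
  rewrite chirpkerE normrM ger0_norm ?gauss_ge0//.
  apply: (@le_trans _ _ (gauss a (u n))).
    by rewrite ler_piMr ?gauss_ge0// ler_norml cos_geN1 cos_le1.
  have n1 : (1 <= n)%N by near: n; exact: nbhs_infty_ge.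
  have nr : (a * r)^-1 <= n%:R by near: n; exact: nbhs_infty_ger.
  rewrite /gauss expRN -real_normK ?num_real// un.
  rewrite invf_ple ?posrE ?expR_gt0//.
  apply: le_trans (ltW (expR_gt1Dx _)); last first.
    by rewrite mulf_neq0 ?gt_eqF// exprn_gt0// ltr0n.
  apply: (@le_trans _ _ (a * n%:R ^+ 2)); last by rewrite lerDr.
  apply: (@le_trans _ _ (a * n%:R)).
    by rewrite -ler_pdivrMl// -invfM.
  by rewrite ler_pM2l// expr2 ler_peMr ?ler0n// ler1n.
have := Rintegral_deriv_eq0 dF cf iff (lim0 _ _) (lim0 _ _).
rewrite /f RintegralD// RintegralB// !RintegralZl//; apply => n.
  by rewrite ger0_norm.
by rewrite normrN ger0_norm.
Unshelve. all: by end_near. Qed.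

Let chirpiN w e : chirpi w (e - pih - pih) = - chirpi w e.
Proof.
rewrite -[RHS]mulN1r /chirpi /chirpti -RintegralZl//; apply: eq_Rintegral => t _.
by rewrite !chirpkerE /phase !addrA !cosBpihalf sinBpihalf; ring.
Qed.

Let chirptiN w e : chirpti w (e - pih - pih) = - chirpti w e.
Proof.
rewrite -[RHS]mulN1r /chirpi /chirpti -RintegralZl//; apply: eq_Rintegral => t _.
by rewrite !chirpkerE /phase !addrA !cosBpihalf sinBpihalf; ring.
Qed.

Definition chirp_cos w := \int[mu]_t (gauss a t * cos (b * t ^+ 2 - w * t)).

Definition chirp_sin w := \int[mu]_t (gauss a t * sin (b * t ^+ 2 - w * t)).

Let chirp_cosE : chirp_cos = chirpi ^~ 0.
Proof.
apply/funext => w; apply: eq_Rintegral => t _.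
by rewrite chirpkerE /phase addr0.
Qed.

Let chirp_sinE : chirp_sin = chirpi ^~ (0 - pih).
Proof.
apply/funext => w; apply: eq_Rintegral => t _.
by rewrite chirpkerE /phase addrA cosBpihalf addr0.
Qed.

(** Integration by parts at the phases 0 and -pi/2 gives two linear equations for the two first
    moments; the determinant is 4 (a^2 + b^2), nonzero because a > 0. *)
Let chirp_moments w :
  chirpti w 0 = w * (a * chirp_sin w + b * chirp_cos w) / (2 * (a ^+ 2 + b ^+ 2)) /\
  chirpti w (0 - pih) = w * (b * chirp_sin w - a * chirp_cos w) / (2 * (a ^+ 2 + b ^+ 2)).
Proof.
have := chirp_by_parts w 0; have := chirp_by_parts w (0 - pih).
rewrite chirptiN chirpiN chirp_cosE chirp_sinE.
set X := chirpi w 0; set Y := chirpi w _; set P := chirpti w 0; set Q := chirpti w _ => e2 e1.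
have d0 : a ^+ 2 + b ^+ 2 != 0 by rewrite gt_eqF// ltr_wpDr ?sqr_ge0// exprn_gt0.
split.
  have -> : P = (a ^+ 2 + b ^+ 2) * P / (a ^+ 2 + b ^+ 2) by field.
  have -> : (a ^+ 2 + b ^+ 2) * P = w * (a * Y + b * X) / 2.
    have -> : (a ^+ 2 + b ^+ 2) * P = w * (a * Y + b * X) / 2
       - a / 2 * (- (2 * a) * P - 2 * b * Q + w * Y)
       + b / 2 * (- (2 * a) * Q - 2 * b * - P + w * - X) by field.
    by rewrite e1 e2 !mulr0 addr0 subr0.
  by field.
have -> : Q = (a ^+ 2 + b ^+ 2) * Q / (a ^+ 2 + b ^+ 2) by field.
have -> : (a ^+ 2 + b ^+ 2) * Q = w * (b * Y - a * X) / 2.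
  have -> : (a ^+ 2 + b ^+ 2) * Q = w * (b * Y - a * X) / 2
     - b / 2 * (- (2 * a) * P - 2 * b * Q + w * Y)
     - a / 2 * (- (2 * a) * Q - 2 * b * - P + w * - X) by field.
  by rewrite e1 e2 !mulr0 !subr0.
by field.
Qed.

Let chirp_cos_deriv w : is_derive w 1 chirp_cos
  (w * (b * chirp_sin w - a * chirp_cos w) / (2 * (a ^+ 2 + b ^+ 2))).
Proof.
by rewrite -(chirp_moments w).2 [X in is_derive _ _ X]chirp_cosE; exact: chirpi_deriv.
Qed.

Let chirp_sin_deriv w : is_derive w 1 chirp_sin
  (- (w * (a * chirp_sin w + b * chirp_cos w) / (2 * (a ^+ 2 + b ^+ 2)))).
Proof.
rewrite -(chirp_moments w).1 [X in is_derive _ _ X]chirp_sinE -chirptiN.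
exact: chirpi_deriv.
Qed.

(* I(w) = \int exp(-(a - ib) t^2 - iwt) dt satisfies I' = - w / (2 (a - ib)) * I. *)
Lemma chirp_fourier_sqr w : chirp_cos w ^+ 2 + chirp_sin w ^+ 2 =
  (chirp_cos 0 ^+ 2 + chirp_sin 0 ^+ 2) * gauss (a / (2 * (a ^+ 2 + b ^+ 2))) w.
Proof.
have d0 : a ^+ 2 + b ^+ 2 != 0 by rewrite gt_eqF// ltr_wpDr ?sqr_ge0// exprn_gt0.
have df (x : R) : is_derive x 1 (chirp_cos ^+ 2 + chirp_sin ^+ 2)
    (- (a / (a ^+ 2 + b ^+ 2) * x) * (chirp_cos ^+ 2 + chirp_sin ^+ 2) x).
  have := chirp_cos_deriv x; have := chirp_sin_deriv x => d1 d2.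
  apply: is_derive_eq; rewrite /GRing.scale/= !fctE; field.
  by rewrite d0.
have -> : a / (2 * (a ^+ 2 + b ^+ 2)) = a / (a ^+ 2 + b ^+ 2) / 2 by field.
by have := ode_gauss df w; rewrite !fctE => ->.
Qed.

(** At b = 0 the system for the two parts decouples into two copies of the same equation, and the
    sine part starts from the value 0. *)
Lemma gauss_fourier w : b = 0 ->
  chirp_cos w = Num.sqrt (pi / a) * gauss (4 * a)^-1 w /\ chirp_sin w = 0.
Proof.
move=> b0; have an0 : a != 0 by rewrite gt_eqF.
have dX (x : R) : is_derive x 1 chirp_cos (- ((2 * a)^-1 * x) * chirp_cos x).
  by apply: is_derive_eq (chirp_cos_deriv x) _; rewrite b0; field.
have dY (x : R) : is_derive x 1 chirp_sin (- ((2 * a)^-1 * x) * chirp_sin x).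
  by apply: is_derive_eq (chirp_sin_deriv x) _; rewrite b0; field.
split.
  rewrite (ode_gauss dX w) /gauss (_ : (4 * a)^-1 = (2 * a)^-1 / 2); last by field.
  have -> : chirp_cos 0 = \int[mu]_t gauss a t; last by rewrite /Rintegral integral_gauss.
  by apply: eq_Rintegral => t _; rewrite b0 !mul0r subr0 cos0 mulr1.
rewrite (ode_gauss dY w) (_ : chirp_sin 0 = \int[mu]_t 0).
  by rewrite Rintegral_cst// !mul0r.
by apply: eq_Rintegral => t _; rewrite b0 !mul0r subr0 sin0 mulr0.
Qed.

End chirp_fourier.

(** * The Fourier transform of a bounded integrable function *)

Section fourier_basics.
Context {R : realType} {n : nat}.
Local Notation V := 'rV[R]_n.
Local Notation mu := (@lebesgue_rV R n).
Implicit Types (g : V -> R[i]) (x y xi : V).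

Local Notation Re := (@complex.Re R).
Local Notation Im := (@complex.Im R).
Local Notation normc := (@Normc.normc R).

(** Integrability makes the transform a pointwise bounded function, and boundedness adds square
    integrability; the class is stable under the sharp cutoffs of the main argument, which leave the
    Schwartz class. *)
Definition bounded_integrable g := [/\ measurable_fun setT (Re \o g),
  measurable_fun setT (Im \o g),
  mu.-integrable setT (EFin \o (normc \o g)) &
  exists M, forall x, normc (g x) <= M].

Lemma normc_ge0 (z : R[i]) : 0 <= normc z.
Proof. by case: z => a b; exact: sqrtr_ge0. Qed.

Lemma normc_sqr (z : R[i]) : normc z ^+ 2 = Re z ^+ 2 + Im z ^+ 2.
Proof. by case: z => a b /=; rewrite sqr_sqrtr// addr_ge0// sqr_ge0. Qed.

Lemma ler_Re_normc (z : R[i]) : `|Re z| <= normc z.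
Proof.
rewrite -(ler_pXn2r (ltn0Sn 1)) ?nnegrE ?normc_ge0//.
by rewrite normc_sqr real_normK ?num_real// lerDl sqr_ge0.
Qed.

Lemma ler_Im_normc (z : R[i]) : `|Im z| <= normc z.
Proof.
rewrite -(ler_pXn2r (ltn0Sn 1)) ?nnegrE ?normc_ge0//.
by rewrite normc_sqr real_normK ?num_real// lerDr sqr_ge0.
Qed.

Lemma ler_normc_ReIm (z : R[i]) : normc z <= `|Re z| + `|Im z|.
Proof.
rewrite -(ler_pXn2r (ltn0Sn 1)) ?nnegrE ?addr_ge0 ?normc_ge0//.
rewrite normc_sqr sqrrD !real_normK ?num_real//.
by rewrite -addrAC lerDl mulrn_wge0// mulr_ge0.
Qed.

Lemma Re_mulc (a b : R[i]) : Re (a * b) = Re a * Re b - Im a * Im b.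
Proof. by case: a b => ? ? []. Qed.

Lemma Im_mulc (a b : R[i]) : Im (a * b) = Re a * Im b + Im a * Re b.
Proof. by case: a b => ? ? []. Qed.

Lemma normc_cexpi (t : R) : normc (cexpi t) = 1.
Proof. by rewrite /cexpi /= cos2Dsin2 sqrtr1. Qed.

Lemma cexpiD (s t : R) : cexpi (s + t) = cexpi s * cexpi t.
Proof.
by apply/eqP; rewrite eq_complex Re_mulc Im_mulc/= cosD sinD eqxx /= addrC eqxx.
Qed.

Lemma dotprodBl x y xi : dotprod (x - y) xi = dotprod x xi - dotprod y xi.
Proof. by rewrite /dotprod -sumrB; apply: eq_bigr => i _; rewrite !mxE mulrBl. Qed.

Lemma measurable_normc d (T : measurableType d) (h : T -> R[i]) :
  measurable_fun setT (Re \o h) -> measurable_fun setT (Im \o h) ->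
  measurable_fun setT (normc \o h).
Proof.
move=> mr mi; rewrite (_ : _ \o _ =
    (fun z => Num.sqrt ((Re \o h) z ^+ 2 + (Im \o h) z ^+ 2))); last first.
  by apply/funext => z /=; case: (h z).
apply: (measurableT_comp (continuous_measurable_fun (@sqrt_continuous R))).
by apply: measurable_funD; exact: measurable_funX.
Qed.

Lemma measurable_dotprod d (T : measurableType d) (f h : T -> V) :
  measurable_fun setT f -> measurable_fun setT h ->
  measurable_fun setT (fun z => dotprod (f z) (h z)).
Proof.
move=> mf mh; apply: measurable_sum => i.
apply: measurable_funM; first exact: (measurableT_comp (measurable_coord i) mf).
exact: (measurableT_comp (measurable_coord i) mh).
Qed.

Definition wave g x xi := g x * cexpi (- (2 * pi * dotprod x xi)).

Lemma normc_wave g x xi : normc (wave g x xi) = normc (g x).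
Proof. by rewrite Normc.normcM normc_cexpi mulr1. Qed.

Lemma Re_wave g x xi : Re (wave g x xi) =
  Re (g x) * cos (2 * pi * dotprod x xi) + Im (g x) * sin (2 * pi * dotprod x xi).
Proof. by rewrite Re_mulc /cexpi/= cosN sinN mulrN opprK. Qed.

Lemma Im_wave g x xi : Im (wave g x xi) =
  Im (g x) * cos (2 * pi * dotprod x xi) - Re (g x) * sin (2 * pi * dotprod x xi).
Proof. by rewrite Im_mulc /cexpi/= cosN sinN mulrN addrC. Qed.

Let mcs (h : R -> R) : continuous h ->
  measurable_fun setT (fun z : V * V => h (2 * pi * dotprod z.1 z.2)).
Proof.
move=> ch; apply: measurableT_comp; first exact: continuous_measurable_fun.
by apply: measurable_funM => //; exact: measurable_dotprod.
Qed.

Lemma measurable_Re_wave g : measurable_fun setT (Re \o g) ->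
  measurable_fun setT (Im \o g) ->
  measurable_fun setT (fun z : V * V => Re (wave g z.1 z.2)).
Proof.
move=> mr mi; under eq_fun do rewrite Re_wave.
apply: measurable_funD; apply: measurable_funM.
- exact: measurableT_comp mr measurable_fst.
- by apply: mcs; exact: continuous_cos.
- exact: measurableT_comp mi measurable_fst.
- by apply: mcs; exact: continuous_sin.
Qed.

Lemma measurable_Im_wave g : measurable_fun setT (Re \o g) ->
  measurable_fun setT (Im \o g) ->
  measurable_fun setT (fun z : V * V => Im (wave g z.1 z.2)).
Proof.
move=> mr mi; under eq_fun do rewrite Im_wave.
apply: measurable_funB; apply: measurable_funM.
- exact: measurableT_comp mi measurable_fst.
- by apply: mcs; exact: continuous_cos.
- exact: measurableT_comp mr measurable_fst.
- by apply: mcs; exact: continuous_sin.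
Qed.

(** The integral is the difference of those of the positive and negative parts, and each of these is
    measurable in the parameter by Tonelli. *)
Lemma measurable_Rintegral d1 d2 (T1 : measurableType d1) (T2 : measurableType d2)
    (m : {sigma_finite_measure set T1 -> \bar R}) (F : T1 * T2 -> R) :
  measurable_fun setT F -> measurable_fun setT (fun s => \int[m]_t F (t, s)).
Proof.
move=> mF; apply: measurableT_comp; first exact: fine_measurable.
have mFE : measurable_fun setT (EFin \o F) by exact/measurable_EFinP.
have mp : measurable_fun setT (fubini_G m ((EFin \o F)^\+)%E).
  by apply: measurable_fun_fubini_tonelli_G => //; exact: measurable_funepos.
have mn : measurable_fun setT (fubini_G m ((EFin \o F)^\-)%E).
  by apply: measurable_fun_fubini_tonelli_G => //; exact: measurable_funeneg.
rewrite (_ : (fun s => _) = (fubini_G m ((EFin \o F)^\+) \- fubini_G m ((EFin \o F)^\-))%E).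
  exact: emeasurable_funB.
apply/funext => s; rewrite integralE /fubini_G/=; congr (_ - _)%E.
  by apply: eq_integral => t _; rewrite !funeposE.
by apply: eq_integral => t _; rewrite !funenegE.
Qed.

Lemma measurable_Re_fourier g : bounded_integrable g ->
  measurable_fun setT (Re \o fourier g).
Proof.
case=> mr mi _ _.
exact: (@measurable_Rintegral _ _ _ _ mu (fun z => Re (wave g z.1 z.2)) (measurable_Re_wave mr mi)).
Qed.

Lemma measurable_Im_fourier g : bounded_integrable g ->
  measurable_fun setT (Im \o fourier g).
Proof.
case=> mr mi _ _.
exact: (@measurable_Rintegral _ _ _ _ mu (fun z => Im (wave g z.1 z.2)) (measurable_Im_wave mr mi)).
Qed.

Lemma measurable_normc_fourier g : bounded_integrable g ->
  measurable_fun setT (normc \o fourier g).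
Proof.
by move=> bg; apply: measurable_normc; [exact: measurable_Re_fourier|exact: measurable_Im_fourier].
Qed.

Lemma integrable_Re_wave g xi : bounded_integrable g ->
  mu.-integrable setT (EFin \o (fun x => Re (wave g x xi))).
Proof.
move=> [mr mi ig _]; apply: (@integrable_le _ _ _ mu _ (normc \o g)) => //.
  exact: measurableT_comp (measurable_Re_wave mr mi) (pair2_measurable xi).
by move=> x; rewrite (le_trans (ler_Re_normc _))// normc_wave.
Qed.

Lemma integrable_Im_wave g xi : bounded_integrable g ->
  mu.-integrable setT (EFin \o (fun x => Im (wave g x xi))).
Proof.
move=> [mr mi ig _]; apply: (@integrable_le _ _ _ mu _ (normc \o g)) => //.
  exact: measurableT_comp (measurable_Im_wave mr mi) (pair2_measurable xi).
by move=> x; rewrite (le_trans (ler_Im_normc _))// normc_wave.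
Qed.

Lemma Re_fourierE g xi : Re (fourier g xi) = \int[mu]_x Re (wave g x xi).
Proof. by []. Qed.

Lemma Im_fourierE g xi : Im (fourier g xi) = \int[mu]_x Im (wave g x xi).
Proof. by []. Qed.

Let L1 g := \int[mu]_x normc (g x).

Lemma Re_fourier_le g xi : bounded_integrable g -> `|Re (fourier g xi)| <= L1 g.
Proof.
move=> bg; have [_ _ ig _] := bg.
rewrite Re_fourierE (le_trans (le_normr_Rintegral _ (integrable_Re_wave xi bg)))//.
apply: le_Rintegral => //.
- by have := integrable_abse (integrable_Re_wave xi bg).
- by move=> x _; rewrite (le_trans (ler_Re_normc _))// normc_wave.
Qed.

Lemma Im_fourier_le g xi : bounded_integrable g -> `|Im (fourier g xi)| <= L1 g.
Proof.
move=> bg; have [_ _ ig _] := bg.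
rewrite Im_fourierE (le_trans (le_normr_Rintegral _ (integrable_Im_wave xi bg)))//.
apply: le_Rintegral => //.
- by have := integrable_abse (integrable_Im_wave xi bg).
- by move=> x _; rewrite (le_trans (ler_Im_normc _))// normc_wave.
Qed.

(* Rotating by the phase of the transform gives the constant 1 here. *)
Lemma normc_fourier_le g xi : bounded_integrable g -> normc (fourier g xi) <= L1 g.
Proof.
move=> bg; have [_ _ ig _] := bg; set N := normc (fourier g xi).
have L0 : 0 <= L1 g by apply: Rintegral_ge0 => x _; exact: normc_ge0.
have [->//|N0] := eqVneq N 0.
have Np : 0 < N by rewrite lt_neqAle eq_sym N0 normc_ge0.
rewrite -(ler_pM2l Np) -expr2 normc_sqr.
set X := Re (fourier g xi); set Y := Im (fourier g xi).
have iR := integrable_Re_wave xi bg; have iI := integrable_Im_wave xi bg.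
have iX : mu.-integrable setT (EFin \o (fun x => X * Re (wave g x xi))).
  by rewrite /comp; under eq_fun do rewrite EFinM; exact: integrableZl.
have iY : mu.-integrable setT (EFin \o (fun x => Y * Im (wave g x xi))).
  by rewrite /comp; under eq_fun do rewrite EFinM; exact: integrableZl.
have -> : X ^+ 2 + Y ^+ 2 = \int[mu]_x (X * Re (wave g x xi) + Y * Im (wave g x xi)).
  by rewrite RintegralD// !RintegralZl// -Re_fourierE -Im_fourierE.
rewrite -RintegralZl//; apply: le_Rintegral => //.
- by rewrite /comp; under eq_fun do rewrite EFinD; exact: integrableD.
- by rewrite /comp; under eq_fun do rewrite EFinM; exact: integrableZl.
move=> x _; apply: le_trans (ler_norm _) _.
rewrite -(normc_wave g x xi) -(ler_pXn2r (ltn0Sn 1)) ?nnegrE ?mulr_ge0 ?normc_ge0//.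
rewrite exprMn !normc_sqr -/X -/Y real_normK ?num_real//.
set r := Re _; set i := Im _.
rewrite -subr_ge0; have -> : (X ^+ 2 + Y ^+ 2) * (r ^+ 2 + i ^+ 2) - (X * r + Y * i) ^+ 2
  = (X * i - Y * r) ^+ 2 by ring.
exact: sqr_ge0.
Qed.

End fourier_basics.

(** * Bessel's inequality and Plancherel's theorem *)

Section plancherel.
Context {R : realType} {n : nat}.
Local Notation V := 'rV[R]_n.
Local Notation mu := (@lebesgue_rV R n).
Local Notation leb := (@lebesgue_measure R).
Implicit Types (g : V -> R[i]) (x y xi : V) (t : R).

Local Notation Re := (@complex.Re R).
Local Notation Im := (@complex.Im R).
Local Notation normc := (@Normc.normc R).

Definition gaussV t x : R := \prod_i gauss t (x ord0 i).

(** The Fourier transform of [gauss t]. It has mass 1 and concentrates at 0 as t tends to 0. *)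
Definition heat1 t (u : R) : R := Num.sqrt (pi / t) * gauss (pi ^+ 2 / t) u.

Definition heatV t x : R := \prod_i heat1 t (x ord0 i).

Lemma gaussV_ge0 t x : 0 <= gaussV t x.
Proof. by apply: prodr_ge0 => i _; exact: gauss_ge0. Qed.

Lemma heat1_ge0 t u : 0 <= heat1 t u.
Proof. by rewrite mulr_ge0 ?gauss_ge0. Qed.

Lemma heatV_ge0 t x : 0 <= heatV t x.
Proof. by apply: prodr_ge0 => i _; exact: heat1_ge0. Qed.

Lemma measurable_prod_coord (h : 'I_n -> R -> R) :
  (forall i, measurable_fun setT (h i)) ->
  measurable_fun setT (fun x => \prod_i h i (x ord0 i)).
Proof.
move=> mh; apply: measurable_prod => i _.
exact: (measurableT_comp (mh i) (measurable_coord i)).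
Qed.

Lemma measurable_gaussV t : measurable_fun setT (gaussV t).
Proof. by apply: (measurable_prod_coord (h := fun=> gauss t)) => i; exact: measurable_gauss. Qed.

Lemma measurable_heat1 t : measurable_fun setT (heat1 t).
Proof. by apply: measurable_funM => //; exact: measurable_gauss. Qed.

Lemma measurable_heatV t : measurable_fun setT (heatV t).
Proof. by apply: (measurable_prod_coord (h := fun=> heat1 t)) => i; exact: measurable_heat1. Qed.

Lemma integral_gaussV t : 0 < t ->
  (\int[mu]_x (gaussV t x)%:E)%E = (Num.sqrt (pi / t) ^+ n)%:E.
Proof.
move=> t0; rewrite (ge0_integral_prod (g := fun=> gauss t)); last 2 first.
- by move=> i; exact: measurable_gauss.
- by move=> i u; exact: gauss_ge0.
under eq_bigr do rewrite integral_gauss//.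
by rewrite -(big_morph EFin (@EFinM R) erefl) prodr_const card_ord.
Qed.

Lemma integrable_gaussV t : 0 < t -> mu.-integrable setT (EFin \o gaussV t).
Proof.
move=> t0; apply/integrableP; split.
  by apply/measurable_EFinP; exact: measurable_gaussV.
under eq_integral do rewrite /= ger0_norm ?gaussV_ge0//.
by rewrite integral_gaussV// ltry.
Qed.

Lemma measurable_rVsub (x : V) : measurable_fun setT (fun y : V => x - y).
Proof.
apply/measurable_fun_rVP => i; under eq_fun do rewrite !mxE.
by apply: measurable_funB => //; exact: measurable_coord.
Qed.

Lemma measurable_rVsub2 : measurable_fun setT (fun z : V * V => z.1 - z.2).
Proof.
apply/measurable_fun_rVP => i; under eq_fun do rewrite !mxE.
by apply: measurable_funB; [exact: measurableT_comp (measurable_coord i) measurable_fst|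
  exact: measurableT_comp (measurable_coord i) measurable_snd].
Qed.

Lemma integral_heatV t x : 0 < t -> (\int[mu]_y (heatV t (x - y))%:E)%E = 1%E.
Proof.
move=> t0.
have h1 i s : heat1 t ((x - s) ord0 i) = Num.sqrt (pi / t) * gauss (pi ^+ 2 / t) (s ord0 i - x ord0 i).
  by rewrite /heat1 /gauss !mxE -[in LHS]opprB sqrrN.
under eq_integral do rewrite /heatV (eq_bigr _ (fun i _ => h1 i _)).
have mh i : measurable_fun setT (fun s : R => Num.sqrt (pi / t) * gauss (pi ^+ 2 / t) (s - x ord0 i)).
  apply: measurable_funM => //; apply: (measurableT_comp (measurable_gauss _)).
  exact: measurable_funB.
rewrite (ge0_integral_prod (g := fun i s => Num.sqrt (pi / t) * gauss (pi ^+ 2 / t) (s - x ord0 i)))//; last first.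
  by move=> i s; rewrite mulr_ge0// gauss_ge0.
have pt0 : 0 < pi ^+ 2 / t by rewrite divr_gt0// exprn_gt0// pi_gt0.
apply: big1 => i _; under eq_integral do rewrite EFinM.
rewrite ge0_integralZl//; last 2 first.
- apply/measurable_EFinP; apply: (measurableT_comp (measurable_gauss _)).
  exact: measurable_funB.
- by move=> s _; rewrite lee_fin gauss_ge0.
rewrite integral_gauss_center// -EFinM -sqrtrM ?divr_ge0 ?pi_ge0 ?ltW//.
have -> : pi / t * (pi / (pi ^+ 2 / t)) = 1 :> R.
  have pn0 : pi != 0 :> R by rewrite gt_eqF// pi_gt0.
  by move: (pi : R) pn0 => P P0; field; rewrite P0 gt_eqF.
by rewrite sqrtr1.
Qed.

Lemma measurable_heatVB t x : measurable_fun setT (fun y => heatV t (x - y)).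
Proof. exact: measurableT_comp (measurable_heatV t) (measurable_rVsub x). Qed.

Lemma integrable_heatV t x : 0 < t ->
  mu.-integrable setT (EFin \o (fun y => heatV t (x - y))).
Proof.
move=> t0; apply/integrableP; split.
  by apply/measurable_EFinP; exact: measurable_heatVB.
under eq_integral do rewrite /= ger0_norm ?heatV_ge0//.
by rewrite integral_heatV// ltry.
Qed.

Lemma Re_realc (r : R) (z : R[i]) : Re (r%:C%C * z) = r * Re z.
Proof. by case: z => a b /=; rewrite mul0r subr0. Qed.

Lemma Im_realc (r : R) (z : R[i]) : Im (r%:C%C * z) = r * Im z.
Proof. by case: z => a b /=; rewrite mul0r addr0. Qed.

Lemma cexpi_sum (h : 'I_n -> R) : cexpi (\sum_i h i) = \prod_i cexpi (h i).
Proof.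
elim/big_ind2 : _ => //; first by rewrite /cexpi cos0 sin0.
by move=> a b c d <- <-; rewrite cexpiD.
Qed.

Lemma cintegrable_chirp (a b w : R) : 0 < a ->
  cintegrable leb (fun s : R => (gauss a s)%:C%C * cexpi (b * s ^+ 2 - w * s)).
Proof.
move=> a0; set G := fun s : R => _.
have mc (h : R -> R) : continuous h -> measurable_fun setT (fun s : R => h (b * s ^+ 2 - w * s)).
  move=> ch; apply: (measurableT_comp (continuous_measurable_fun ch)).
  by apply: measurable_funB; apply: measurable_funM => //; exact: measurable_funX.
have ml s : `|Re (G s)| <= gauss a s /\ `|Im (G s)| <= gauss a s.
  have -> : gauss a s = normc (G s).
    by rewrite Normc.normcM normc_cexpi mulr1/= expr0n/= addr0 sqrtr_sqr ger0_norm// gauss_ge0.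
  by split; [exact: ler_Re_normc|exact: ler_Im_normc].
split; apply: (@integrable_le _ _ _ leb _ (gauss a)); try exact: integrable_gauss.
- under eq_fun do rewrite Re_realc.
  by apply: measurable_funM; [exact: measurable_gauss|by apply: (mc cos); exact: continuous_cos].
- by move=> s; exact: (ml s).1.
- under eq_fun do rewrite Im_realc.
  by apply: measurable_funM; [exact: measurable_gauss|by apply: (mc sin); exact: continuous_sin].
- by move=> s; exact: (ml s).2.
Qed.

(** The integrand is a product over coordinates of one-dimensional chirps with b = 0 and frequency 2
    pi z_i; the sine integral is its imaginary part, up to sign. *)
Lemma gauss_fourierV t (z : V) : 0 < t ->
  [/\ mu.-integrable setT (EFin \o (fun xi => gaussV t xi * cos (2 * pi * dotprod z xi))),
   mu.-integrable setT (EFin \o (fun xi => gaussV t xi * sin (2 * pi * dotprod z xi))),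
   \int[mu]_xi (gaussV t xi * cos (2 * pi * dotprod z xi)) = heatV t z &
   \int[mu]_xi (gaussV t xi * sin (2 * pi * dotprod z xi)) = 0].
Proof.
move=> t0.
pose G (i : 'I_n) (s : R) : R[i] := (gauss t s)%:C%C * cexpi (0 * s ^+ 2 - 2 * pi * z ord0 i * s).
have GE xi : \prod_i G i (xi ord0 i) = (gaussV t xi)%:C%C * cexpi (- (2 * pi * dotprod z xi)).
  rewrite big_split/= -rmorph_prod/=; congr (_ * _).
  rewrite /dotprod mulr_sumr -sumrN.
  rewrite cexpi_sum.
  by apply: eq_bigr => i _; rewrite mul0r sub0r !mulrA.
have iG i : cintegrable leb (G i) by exact: cintegrable_chirp.
have cG i : cint leb (G i) = (heat1 t (z ord0 i))%:C%C.
  have [c0 s0] := @gauss_fourier R t 0 t0 (2 * pi * z ord0 i) erefl.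
  apply/eqP; rewrite eq_complex; apply/andP; split; apply/eqP.
    rewrite -[LHS]/(\int[leb]_s Re (G i s)).
    under eq_Rintegral do rewrite /G Re_realc.
    rewrite -[LHS]/(chirp_cos t 0 (2 * pi * z ord0 i)) c0 /heat1/= /gauss; congr (_ * expR (- _)).
    by field; rewrite gt_eqF.
  rewrite -[LHS]/(\int[leb]_s Im (G i s)).
  under eq_Rintegral do rewrite /G Im_realc.
  by rewrite -[LHS]/(chirp_sin t 0 (2 * pi * z ord0 i)) s0.
have [[i1 i2]] := cintegral_prod iG.
rewrite (eq_bigr _ (fun i _ => cG i)) -rmorph_prod/=.
have rE xi : Re (\prod_i G i (xi ord0 i)) = gaussV t xi * cos (2 * pi * dotprod z xi).
  by rewrite GE Re_realc/= cosN.
have iE xi : Im (\prod_i G i (xi ord0 i)) = - (gaussV t xi * sin (2 * pi * dotprod z xi)).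
  by rewrite GE Im_realc/= sinN mulrN.
move: i1 i2; rewrite (_ : EFin \o _ = EFin \o (fun xi => gaussV t xi * cos (2 * pi * dotprod z xi))); last first.
  by apply/funext => xi/=; rewrite rE.
move=> i1 i2 [e1 e2]; split => //.
- rewrite (_ : EFin \o _ = (fun xi => - (Im (\prod_i G i (xi ord0 i)))%:E)%E).
    exact: integrableN.
  by apply/funext => xi/=; rewrite iE opprK.
- by rewrite /heatV -e1; apply: eq_Rintegral => xi _; rewrite rE.
- have /eqP : - (\int[mu]_xi (gaussV t xi * sin (2 * pi * dotprod z xi))) = 0.
    rewrite -[RHS]e2 -mulN1r -RintegralZl//.
      by apply: eq_Rintegral => xi _; rewrite iE mulN1r.
    rewrite (_ : EFin \o _ = (fun xi => - (Im (\prod_i G i (xi ord0 i)))%:E)%E).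
      exact: integrableN.
    by apply/funext => xi/=; rewrite iE opprK.
  by rewrite oppr_eq0 => /eqP.
Qed.

End plancherel.

#[export] Hint Extern 0 (is_true (0 <= Normc.normc _)) => exact: normc_ge0 : core.

Section plancherel_identity.
Context {R : realType} {n : nat}.
Local Notation V := 'rV[R]_n.
Local Notation mu := (@lebesgue_rV R n).
Implicit Types (g : V -> R[i]) (x y xi : V) (t : R).

Local Notation Re := (@complex.Re R).
Local Notation Im := (@complex.Im R).
Local Notation normc := (@Normc.normc R).

(** The real part of g(x) times the conjugate of g(y). *)
Definition correl g x y : R := Re (g x) * Re (g y) + Im (g x) * Im (g y).

Lemma correl_le g x y : `|correl g x y| <= normc (g x) * normc (g y).
Proof.
rewrite -(ler_pXn2r (ltn0Sn 1)) ?nnegrE ?mulr_ge0 ?normc_ge0//.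
rewrite exprMn !normc_sqr real_normK ?num_real// /correl.
set a := Re (g x); set b := Im (g x); set c := Re (g y); set e := Im (g y).
rewrite -subr_ge0 (_ : _ - _ = (a * e - b * c) ^+ 2) ?sqr_ge0//; ring.
Qed.

Lemma correl_wave g x y xi : correl (wave g ^~ xi) x y =
  correl g x y * cos (2 * pi * dotprod (x - y) xi) +
  (Im (g x) * Re (g y) - Re (g x) * Im (g y)) * sin (2 * pi * dotprod (x - y) xi).
Proof.
rewrite /correl !Re_wave !Im_wave dotprodBl (mulrBr (2 * pi)) cosB sinB; ring.
Qed.

Lemma correl_diag g x : correl g x x = normc (g x) ^+ 2.
Proof. by rewrite /correl normc_sqr !expr2. Qed.

Lemma integrable_scalel (f : V -> R) (k : R) : mu.-integrable setT (EFin \o f) ->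
  mu.-integrable setT (EFin \o (fun x => k * f x)).
Proof. by move=> fi; rewrite /comp; under eq_fun do rewrite EFinM; exact: integrableZl. Qed.

Lemma integrable_add (f h : V -> R) : mu.-integrable setT (EFin \o f) ->
  mu.-integrable setT (EFin \o h) -> mu.-integrable setT (EFin \o (fun x => f x + h x)).
Proof. by move=> fi hi; rewrite /comp; under eq_fun do rewrite EFinD; exact: integrableD. Qed.

Lemma measurable_swapped d1 d2 d3 (T1 : measurableType d1) (T2 : measurableType d2)
    (T3 : measurableType d3) (F : T1 * T2 -> T3) :
  measurable_fun setT F -> measurable_fun setT (fun z : T2 * T1 => F (z.2, z.1)).
Proof.
by move=> mF; apply: (measurableT_comp mF); apply: measurable_fun_pair;
  [exact: measurable_snd|exact: measurable_fst].
Qed.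

(** The Gaussian weight is what makes the exchange of integrals legitimate: without it nothing
    decays in xi. The two copies of the transform are expanded one after the other, so that each
    exchange concerns a function of two variables dominated by a product. *)
Lemma plancherel_gauss g t : bounded_integrable g -> 0 < t ->
  \int[mu]_xi (gaussV t xi * normc (fourier g xi) ^+ 2) =
  \int[mu]_x \int[mu]_y (correl g x y * heatV t (x - y)).
Proof.
move=> bg t0; have [mr mi ig _] := bg.
set X := fun xi => Re (fourier g xi); set Y := fun xi => Im (fourier g xi).
set L := \int[mu]_x normc (g x).
have mX : measurable_fun setT X := measurable_Re_fourier bg.
have mY : measurable_fun setT Y := measurable_Im_fourier bg.
have mw1 : measurable_fun setT (fun z : V * V => Re (wave g z.2 z.1)).
  exact: (measurable_swapped (measurable_Re_wave mr mi)).
have mw2 : measurable_fun setT (fun z : V * V => Im (wave g z.2 z.1)).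
  exact: (measurable_swapped (measurable_Im_wave mr mi)).
have mK1 : measurable_fun setT (fun z : V * V => gaussV t z.1).
  exact: measurableT_comp (measurable_gaussV t) measurable_fst.
(* One copy of the transform is opened; the other one stays, bounded by the L^1 norm L. *)
pose F1 (z : V * V) := gaussV t z.1 * (Re (wave g z.2 z.1) * X z.1 + Im (wave g z.2 z.1) * Y z.1).
have mF1 : measurable_fun setT F1.
  apply: measurable_funM => //; apply: measurable_funD; apply: measurable_funM => //.
    exact: measurableT_comp mX measurable_fst.
  exact: measurableT_comp mY measurable_fst.
have F1_le xi x : `|F1 (xi, x)| <= (2 * L * gaussV t xi) * normc (g x).
  rewrite /F1/= normrM ger0_norm ?gaussV_ge0//.
  rewrite (mulrC _ (gaussV t xi)) -mulrA ler_wpM2l ?gaussV_ge0//.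
  apply: le_trans (ler_normD _ _) _; rewrite !normrM.
  have := ler_pM (normr_ge0 _) (normr_ge0 _) (ler_Re_normc (wave g x xi)) (Re_fourier_le xi bg).
  have := ler_pM (normr_ge0 _) (normr_ge0 _) (ler_Im_normc (wave g x xi)) (Im_fourier_le xi bg).
  rewrite normc_wave -/(X xi) -/(Y xi) -/L => h1 h2.
  by apply: le_trans (lerD h2 h1) _; rewrite -mulrA mulr_natl mulr2n mulrC.
have iK := integrable_scalel (2 * L) (integrable_gaussV t0).
have e1 xi : gaussV t xi * normc (fourier g xi) ^+ 2 = \int[mu]_x F1 (xi, x).
  have i1 := integrable_Re_wave xi bg; have i2 := integrable_Im_wave xi bg.
  rewrite normc_sqr.
  rewrite -[RHS]/(\int[mu]_x (gaussV t xi * (Re (wave g x xi) * X xi + Im (wave g x xi) * Y xi))).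
  have j1 : mu.-integrable setT (EFin \o (fun x => Re (wave g x xi) * X xi)).
    by rewrite /comp; under eq_fun do rewrite EFinM; exact: integrableZr.
  have j2 : mu.-integrable setT (EFin \o (fun x => Im (wave g x xi) * Y xi)).
    by rewrite /comp; under eq_fun do rewrite EFinM; exact: integrableZr.
  rewrite RintegralZl//; last exact: integrable_add.
  by rewrite RintegralD// !RintegralZr// -Re_fourierE -Im_fourierE !expr2.
under eq_Rintegral do rewrite e1.
rewrite (dominated_Fubini mF1 iK ig F1_le); apply: eq_Rintegral => x _.
(* The second copy is opened with x fixed. *)
pose F2 (z : V * V) := gaussV t z.1 * correl (wave g ^~ z.1) x z.2.
have mF2 : measurable_fun setT F2.
  have p1 : measurable_fun setT (fun z : V * V => (x, z.1)).
    by apply: measurable_fun_pair => //; exact: measurable_fst.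
  apply: measurable_funM => //; apply: measurable_funD; apply: measurable_funM => //.
    exact: (measurableT_comp (measurable_Re_wave mr mi) p1).
  exact: (measurableT_comp (measurable_Im_wave mr mi) p1).
have F2_le xi y : `|F2 (xi, y)| <= (normc (g x) * gaussV t xi) * normc (g y).
  rewrite /F2/= normrM ger0_norm ?gaussV_ge0// (mulrC _ (gaussV t xi)) -mulrA.
  rewrite ler_wpM2l ?gaussV_ge0// (le_trans (correl_le _ _ _))//.
  by rewrite !normc_wave.
have iK2 := integrable_scalel (normc (g x)) (integrable_gaussV t0).
have e2 xi : F1 (xi, x) = \int[mu]_y F2 (xi, y).
  have i1 := integrable_Re_wave xi bg; have i2 := integrable_Im_wave xi bg.
  have j1 := integrable_scalel (Re (wave g x xi)) i1.
  have j2 := integrable_scalel (Im (wave g x xi)) i2.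
  rewrite /F2/= RintegralZl//; last exact: integrable_add.
  by rewrite RintegralD// !RintegralZl// -Re_fourierE -Im_fourierE.
under eq_Rintegral do rewrite e2.
rewrite (dominated_Fubini mF2 iK2 ig F2_le); apply: eq_Rintegral => y _.
(* Only the cosine part survives the integration in xi, because the Gaussian is even. *)
have [i1 i2 c1 c2] := gauss_fourierV (x - y) t0.
rewrite /F2/=.
transitivity (\int[mu]_xi (correl g x y * (gaussV t xi * cos (2 * pi * dotprod (x - y) xi)) +
  (Im (g x) * Re (g y) - Re (g x) * Im (g y)) * (gaussV t xi * sin (2 * pi * dotprod (x - y) xi)))).
  by apply: eq_Rintegral => xi _; rewrite correl_wave; ring.
rewrite RintegralD//; [|exact: integrable_scalel..].
by rewrite !RintegralZl// c1 c2 mulr0 addr0.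
Qed.

Lemma integrable_bounded_sqr g : bounded_integrable g ->
  mu.-integrable setT (EFin \o (fun x => normc (g x) ^+ 2)).
Proof.
move=> [mr mi ig [M gM]].
apply: (@integrable_le _ _ _ mu _ (fun x => M * normc (g x))).
- by apply: measurable_funX; exact: measurable_normc.
- by move=> x; rewrite normrX ger0_norm ?normc_ge0// expr2 ler_wpM2r ?normc_ge0.
- exact: integrable_scalel.
Qed.

Lemma heatV_sym t x y : heatV t (x - y) = heatV t (y - x).
Proof. by apply: eq_bigr => i _; rewrite /heat1 /gauss !mxE; congr (_ * expR (- (_ * _))); rewrite -sqrrN opprB. Qed.

Lemma Rintegral_heatV t x : 0 < t -> \int[mu]_y heatV t (x - y) = 1.
Proof. by move=> t0; rewrite /Rintegral integral_heatV. Qed.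

Lemma heatV_le t x : 0 < t -> heatV t x <= Num.sqrt (pi / t) ^+ n.
Proof.
move=> t0; rewrite -[X in _ ^+ X]card_ord -prodr_const; apply: ler_prod => i _.
rewrite heat1_ge0 /= /heat1 ler_piMr// /gauss -expR0 ler_expR oppr_le0.
by rewrite mulr_ge0 ?sqr_ge0// divr_ge0 ?sqr_ge0// ltW.
Qed.

(* Schur test: |g(x) g(y)| <= (|g(x)|^2 + |g(y)|^2) / 2 and the kernel has mass 1. *)
Lemma fourier_gauss_le g t : bounded_integrable g -> 0 < t ->
  \int[mu]_xi (gaussV t xi * normc (fourier g xi) ^+ 2) <=
  \int[mu]_x (normc (g x) ^+ 2).
Proof.
move=> bg t0; rewrite plancherel_gauss//.
have [mr mi ig _] := bg; have i2 := integrable_bounded_sqr bg.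
have mn := measurable_normc mr mi.
have mn2 : measurable_fun setT (fun x => normc (g x) ^+ 2) by exact: measurable_funX.
pose H x := \int[mu]_y (normc (g y) ^+ 2 * heatV t (x - y)).
have iy x : mu.-integrable setT (EFin \o (fun y => normc (g y) ^+ 2 * heatV t (x - y))).
  apply: (@integrable_le _ _ _ mu _ (fun y => Num.sqrt (pi / t) ^+ n * normc (g y) ^+ 2)).
  - by apply: measurable_funM => //; exact: measurable_heatVB.
  - move=> y; rewrite ger0_norm ?mulr_ge0 ?heatV_ge0 ?sqr_ge0// mulrC ler_wpM2r ?sqr_ge0//.
    exact: heatV_le.
  - exact: integrable_scalel.
have HE : (\int[mu]_x (H x)%:E = \int[mu]_x (normc (g x) ^+ 2)%:E)%E.
  under eq_integral => x _ do rewrite /H /Rintegral fineK ?(integrable_fin_num _ (iy x))//.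
  have := @fubini_tonelli _ _ _ _ R mu mu (fun z : V * V => (normc (g z.2) ^+ 2 * heatV t (z.1 - z.2))%:E).
  rewrite /fubini_F /fubini_G/= => ->; last 2 first.
  - apply/measurable_EFinP; apply: measurable_funM.
      exact: measurableT_comp mn2 measurable_snd.
    exact: measurableT_comp (measurable_heatV t) measurable_rVsub2.
  - by move=> z; rewrite lee_fin mulr_ge0 ?heatV_ge0 ?sqr_ge0.
  apply: eq_integral => y _; under eq_integral do rewrite EFinM heatV_sym.
  rewrite ge0_integralZl//; last 3 first.
  - by apply/measurable_EFinP; exact: measurable_heatVB.
  - by move=> x _; rewrite lee_fin heatV_ge0.
  - by rewrite lee_fin sqr_ge0.
  by rewrite integral_heatV// mule1.
have iH : mu.-integrable setT (EFin \o H).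
  apply/integrableP; split.
    apply/measurable_EFinP.
    have mH : measurable_fun setT (fun z : V * V => normc (g z.1) ^+ 2 * heatV t (z.2 - z.1)).
      apply: measurable_funM; first exact: measurableT_comp mn2 measurable_fst.
      apply: (measurableT_comp (measurable_heatV t)).
      exact: (measurable_swapped measurable_rVsub2).
    exact: (measurable_Rintegral mu mH).
  have H0 x : 0 <= H x.
    by apply: Rintegral_ge0 => y _; rewrite mulr_ge0 ?heatV_ge0 ?sqr_ge0.
  under eq_integral do rewrite /= ger0_norm//.
  by rewrite HE -ge0_fin_numE ?(integrable_fin_num _ i2)//; apply: integral_ge0 => x _; rewrite lee_fin sqr_ge0.
have mc : measurable_fun setT (fun z : V * V => correl g z.1 z.2).
  apply: measurable_funD; apply: measurable_funM.
  - exact: measurableT_comp mr measurable_fst.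
  - exact: measurableT_comp mr measurable_snd.
  - exact: measurableT_comp mi measurable_fst.
  - exact: measurableT_comp mi measurable_snd.
have mF : measurable_fun setT (fun z : V * V => correl g z.1 z.2 * heatV t (z.1 - z.2)).
  by apply: measurable_funM => //; exact: measurableT_comp (measurable_heatV t) measurable_rVsub2.
have ix x : mu.-integrable setT (EFin \o (fun y => correl g x y * heatV t (x - y))).
  apply: (@integrable_section2 _ _ _ _ _ mu _ mF (fun x => Num.sqrt (pi / t) ^+ n * normc (g x)) (normc \o g)) => //.
    move=> x' y; rewrite normrM (ger0_norm (heatV_ge0 _ _)) mulrC -mulrA.
    by rewrite ler_pM ?heatV_ge0 ?heatV_le ?correl_le.
have iF : mu.-integrable setT (EFin \o (fun x => \int[mu]_y (correl g x y * heatV t (x - y)))).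
  apply: (@integrable_dominated_integral2 _ _ _ _ _ mu mu _ mF (fun x => Num.sqrt (pi / t) ^+ n * normc (g x)) (normc \o g)) => //.
    exact: integrable_scalel.
  move=> x' y; rewrite normrM (ger0_norm (heatV_ge0 _ _)) mulrC -mulrA.
  by rewrite ler_pM ?heatV_ge0 ?heatV_le ?correl_le.
apply: (@le_trans _ _ (\int[mu]_x (2^-1 * normc (g x) ^+ 2 + 2^-1 * H x))).
  apply: le_Rintegral => //.
    by apply: integrable_add; exact: integrable_scalel.
  move=> x _.
  have -> : 2^-1 * normc (g x) ^+ 2 + 2^-1 * H x =
     \int[mu]_y (2^-1 * normc (g x) ^+ 2 * heatV t (x - y) + 2^-1 * (normc (g y) ^+ 2 * heatV t (x - y))).
    rewrite RintegralD//; [|by apply: integrable_scalel => //; exact: integrable_heatV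
      |by apply: integrable_scalel].
    rewrite !RintegralZl//; last exact: integrable_heatV.
    by rewrite Rintegral_heatV// mulr1.
  apply: le_Rintegral => //.
    by apply: integrable_add; apply: integrable_scalel => //; exact: integrable_heatV.
  move=> y _; apply: (@le_trans _ _ ((2^-1 * normc (g x) ^+ 2 + 2^-1 * normc (g y) ^+ 2) * heatV t (x - y))); last first.
    by rewrite mulrDl -(mulrA _ (normc (g y) ^+ 2)).
  apply: ler_wpM2r; first exact: heatV_ge0.
  apply: le_trans (ler_norm _) (le_trans (correl_le _ _ _) _).
  have := sqr_ge0 (normc (g x) - normc (g y)).
  by rewrite sqrrB; lra.
rewrite RintegralD//; [|exact: integrable_scalel..].
rewrite !RintegralZl// [X in _ + _ * X](_ : _ = \int[mu]_x normc (g x) ^+ 2).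
  by rewrite -mulrDl (_ : 2^-1 + 2^-1 = 1 :> R) ?mul1r//; field.
by rewrite /Rintegral HE.
Qed.

End plancherel_identity.

(** * Removal of the Gaussian weight *)

Section plancherel_limit.
Context {R : realType} {n : nat}.
Local Notation V := 'rV[R]_n.
Local Notation mu := (@lebesgue_rV R n).
Implicit Types (g : V -> R[i]) (x y xi : V) (t : R).

Local Notation Re := (@complex.Re R).
Local Notation Im := (@complex.Im R).
Local Notation normc := (@Normc.normc R).

Lemma gaussVE t x : gaussV t x = expR (- (t * \sum_i x ord0 i ^+ 2)).
Proof.
rewrite mulr_sumr -sumrN (big_morph expR (@expRD R) (@expR0 R)).
exact: eq_bigr.
Qed.

Lemma integrable_gaussV_sqr g t : bounded_integrable g -> 0 < t ->
  mu.-integrable setT (EFin \o (fun xi => gaussV t xi * normc (fourier g xi) ^+ 2)).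
Proof.
move=> bg t0; set L := \int[mu]_x normc (g x).
apply: (@integrable_le _ _ _ mu _ (fun xi => L ^+ 2 * gaussV t xi)).
- apply: measurable_funM; first exact: measurable_gaussV.
  by apply: measurable_funX; exact: measurable_normc_fourier.
- move=> xi; rewrite ger0_norm ?mulr_ge0 ?gaussV_ge0 ?sqr_ge0// mulrC.
  rewrite ler_wpM2r ?gaussV_ge0// ler_pXn2r ?nnegrE ?normc_ge0//.
    exact: normc_fourier_le.
  by apply: Rintegral_ge0 => x _; exact: normc_ge0.
by apply: integrable_scalel; exact: integrable_gaussV.
Qed.

(** The weights exp(-t |xi|^2) increase to 1 as t = 1/(k+1) decreases, so monotone convergence
    removes them from [fourier_gauss_le]. *)
Theorem bessel g : bounded_integrable g ->
  (\int[mu]_xi (normc (fourier g xi) ^+ 2)%:E <= \int[mu]_x (normc (g x) ^+ 2)%:E)%E.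
Proof.
move=> bg; have mf := measurable_normc_fourier bg.
pose t (k : nat) : R := k.+1%:R^-1.
have t0 k : 0 < t k by rewrite invr_gt0 ltr0n.
pose G k xi := (gaussV (t k) xi * normc (fourier g xi) ^+ 2)%:E.
have G0 k xi : (0 <= G k xi)%E by rewrite lee_fin mulr_ge0 ?gaussV_ge0 ?sqr_ge0.
have cG xi : G k xi @[k --> \oo] --> (normc (fourier g xi) ^+ 2)%:E.
  apply: cvg_EFin; first exact: nearW.
  rewrite /comp /G/= -[X in _ --> X]mul1r; apply: cvgM (cvg_cst _).
  under eq_fun do rewrite gaussVE.
  have ct : - (t k * \sum_i xi ord0 i ^+ 2) @[k --> \oo] --> - (0 * \sum_i xi ord0 i ^+ 2).
    by apply: cvgN; apply: cvgM; [exact: cvg_harmonic|exact: cvg_cst].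
  rewrite mul0r oppr0 in ct.
  by rewrite -(@expR0 R); apply: continuous_cvg => //; exact: continuous_expR.
have mG k : measurable_fun setT (G k).
  apply/measurable_EFinP; apply: measurable_funM; first exact: measurable_gaussV.
  exact: measurable_funX.
have := @cvg_monotone_convergence _ _ _ mu setT measurableT G mG (fun k xi _ => G0 k xi) _.
have ndG xi : setT xi -> {homo G ^~ xi : k l / (k <= l)%N >-> (k <= l)%E}.
  move=> _ k l kl; rewrite lee_fin ler_wpM2r ?sqr_ge0// !gaussVE ler_expR lerN2.
  rewrite ler_wpM2r ?sumr_ge0//; first by move=> i _; exact: sqr_ge0.
  by rewrite lef_pV2 ?posrE ?ltr0n// ler_nat ltnS.
move=> /(_ ndG).
under [X in _ --> X -> _]eq_integral do rewrite (cvg_lim _ (cG _))//.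
move=> cI; apply: (cvge_le _ cI); apply: nearW => k.
have ik := integrable_gaussV_sqr bg (t0 k).
have i2 := integrable_bounded_sqr bg.
have := fourier_gauss_le bg (t0 k).
rewrite -lee_fin /Rintegral !fineK//; first exact: integrable_fin_num i2.
exact: integrable_fin_num ik.
Qed.

(** Half of the exponent is kept as a kernel of mass 1 with parameter 2t; the other half is a free
    factor that is small away from the origin. *)
Lemma heatV_split t x : 0 < t ->
  heatV t x = Num.sqrt 2 ^+ n * heatV (2 * t) x * gaussV (pi ^+ 2 / (2 * t)) x.
Proof.
move=> t0; rewrite /heatV /gaussV -[X in _ ^+ X]card_ord -prodr_const -!big_split/=.
apply: eq_bigr => i _; rewrite /heat1.
have tn0 : t != 0 by rewrite gt_eqF.
have -> : Num.sqrt (pi / t) = Num.sqrt 2 * Num.sqrt (pi / (2 * t)).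
  by rewrite -sqrtrM//; congr Num.sqrt; move: (pi : R) => P; field.
have -> : gauss (pi ^+ 2 / t) (x ord0 i) =
    gauss (pi ^+ 2 / (2 * t)) (x ord0 i) * gauss (pi ^+ 2 / (2 * t)) (x ord0 i).
  by rewrite /gauss -expRD; congr expR; move: (pi : R) => P; field.
by rewrite !mulrA.
Qed.

(** The free factor of [heatV_split] is at most 1 / (s d^2) where some coordinate is at least d in
    size, which is O(t); the mass of the kernel far from the origin is thus O(t). *)
Lemma heatV_tail t (d : R) x (i : 'I_n) : 0 < t -> 0 < d -> d <= `|x ord0 i| ->
  heatV t x <= Num.sqrt 2 ^+ n * (2 * t / (pi ^+ 2 * d ^+ 2)) * heatV (2 * t) x.
Proof.
move=> t0 d0 dx; rewrite heatV_split// mulrAC ler_wpM2r ?heatV_ge0// ler_wpM2l ?exprn_ge0// gaussVE.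
have p0 : 0 < pi :> R by exact: pi_gt0.
set s := pi ^+ 2 / (2 * t).
have s0 : 0 < s by rewrite divr_gt0 ?exprn_gt0// mulr_gt0.
have sd0 : 0 < s * d ^+ 2 by rewrite mulr_gt0// exprn_gt0.
apply: (@le_trans _ _ (s * d ^+ 2)^-1); last first.
  rewrite /s; move: (pi : R) p0 => P P0; apply: eqW.
  by field; rewrite !gt_eqF.
rewrite expRN lef_pV2 ?posrE ?expR_gt0//.
apply: le_trans (expR_ge1Dx _); rewrite -[leLHS]add0r lerD//.
rewrite ler_wpM2l ?(ltW s0)// (bigD1 i)//= -[leLHS]addr0 lerD//.
  by rewrite -[leRHS]real_normK ?num_real// ler_pXn2r ?nnegrE// ltW.
by apply: sumr_ge0 => j _; exact: sqr_ge0.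
Qed.

(* The Gaussian kernels form an approximate identity. *)
Lemma cvg_heat_correl g x (M : R) : bounded_integrable g ->
  continuous (Re \o g : V -> R) -> continuous (Im \o g : V -> R) ->
  (forall y, normc (g y) <= M) ->
  \int[mu]_y (correl g x y * heatV k.+1%:R^-1 (x - y)) @[k --> \oo] --> normc (g x) ^+ 2.
Proof.
move=> bg cR cI gM; have [mr mi ig _] := bg.
have M0 : 0 <= M by apply: le_trans (gM x); exact: normc_ge0.
have mc : measurable_fun setT (correl g x).
  by apply: measurable_funD; apply: measurable_funM.
have corM y : `|correl g x y| <= M ^+ 2.
  by rewrite (le_trans (correl_le _ _ _))// expr2 ler_pM ?normc_ge0.
have ih (k : R) t : 0 < t -> mu.-integrable setT (EFin \o (fun y => k * heatV t (x - y))).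
  by move=> t0; apply: integrable_scalel; exact: integrable_heatV.
have ic t : 0 < t -> mu.-integrable setT (EFin \o (fun y => correl g x y * heatV t (x - y))).
  move=> t0; apply: (@integrable_le _ _ _ mu _ (fun y => M ^+ 2 * heatV t (x - y))).
  - by apply: measurable_funM => //; exact: measurable_heatVB.
  - by move=> y; rewrite normrM (ger0_norm (heatV_ge0 _ _)) ler_wpM2r ?heatV_ge0.
  - exact: ih.
have cc : continuous (correl g x : V -> R).
  move=> y; exact: (cvgD (cvgM (cvg_cst _) (cR y)) (cvgM (cvg_cst _) (cI y))).
apply/cvgrPdist_le => /= e e0.
have e20 : 0 < e / 2 by rewrite divr_gt0.
have /cvgrPdist_le/(_ _ e20)/nbhs_ballP[d /= d0 dP] := cc x.
pose c := Num.sqrt 2 ^+ n * (2 / (pi ^+ 2 * d ^+ 2)).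
have c0 : 0 <= c.
  by rewrite mulr_ge0 ?exprn_ge0// divr_ge0// mulr_ge0 ?sqr_ge0.
near=> k; set t : R := k.+1%:R^-1.
have t0 : 0 < t by rewrite invr_gt0 ltr0n.
have t20 : 0 < 2 * t by rewrite mulr_gt0.
have K0 : 0 <= 2 * M ^+ 2 * c * t.
  by apply: mulr_ge0 (ltW t0); apply: mulr_ge0 c0; rewrite mulr_ge0// sqr_ge0.
have tb : 2 * M ^+ 2 * c * t <= e / 2.
  have : 2 * M ^+ 2 * c / (e / 2) <= k%:R by near: k; exact: nbhs_infty_ger.
  rewrite ler_pdivrMr// => h; rewrite /t ler_pdivrMr ?ltr0n//.
  rewrite (le_trans h)// mulrC ler_wpM2l ?(ltW e20)// ler_nat.
  exact: leqnSn.
rewrite -correl_diag distrC.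
have -> : correl g x x = \int[mu]_y (correl g x x * heatV t (x - y)).
  by rewrite RintegralZl// ?Rintegral_heatV ?mulr1//; exact: integrable_heatV.
rewrite -RintegralB//; [|exact: ic|exact: ih].
have iB : mu.-integrable setT (EFin \o (fun y => correl g x y * heatV t (x - y) - correl g x x * heatV t (x - y))).
  by rewrite /comp; under eq_fun do rewrite EFinB; apply: integrableB => //; [exact: ic|exact: ih].
apply: le_trans (le_normr_Rintegral _ iB) _ => //.
apply: (@le_trans _ _ (\int[mu]_y (e / 2 * heatV t (x - y) + 2 * M ^+ 2 * c * t * heatV (2 * t) (x - y)))).
  apply: le_Rintegral => //.
  - by have := integrable_abse iB.
  - by apply: integrable_add; exact: ih.
  move=> y _; rewrite -mulrBl normrM (ger0_norm (heatV_ge0 _ _)).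
  have [xy|] := pselect (ball x d y).
    rewrite -[leLHS]addr0 lerD//; last exact: (mulr_ge0 K0 (heatV_ge0 _ _)).
    by rewrite ler_wpM2r ?heatV_ge0// distrC; exact: dP.
  move=> nxy.
  have [i di] : exists i, d <= `|(x - y) ord0 i|.
    apply: contrapT => /forallNP h; apply: nxy; split => // j i; rewrite ord1.
    by rewrite -ball_normE/= ltNge; apply/negP => hd; apply: (h i); rewrite !mxE.
  rewrite -[leLHS]add0r lerD//; first exact: (mulr_ge0 (ltW e20) (heatV_ge0 _ _)).
  have -> : 2 * M ^+ 2 * c * t * heatV (2 * t) (x - y) =
     2 * M ^+ 2 * (Num.sqrt 2 ^+ n * (2 * t / (pi ^+ 2 * d ^+ 2)) * heatV (2 * t) (x - y)).
    rewrite /c; move: (pi : R) (Num.sqrt (2:R)) (heatV _ _) => P S H.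
    by rewrite !mulrA; ring.
  rewrite ler_pM ?heatV_ge0//; last exact: heatV_tail di.
  apply: le_trans (ler_normB _ _) _.
  by rewrite mulr_natl mulr2n lerD.
rewrite RintegralD//; [|exact: ih..].
rewrite !RintegralZl//; [|exact: integrable_heatV..].
rewrite !Rintegral_heatV// !mulr1 [leRHS]splitr.
by rewrite lerD2l.
Unshelve. all: by end_near. Qed.

(** The reverse of [bessel]. Continuity makes the smoothed correlations converge to |g|^2 at every
    point, M |g| dominates them, and on the transform side the weight is at most 1. *)
Theorem plancherel_ge g : bounded_integrable g ->
  continuous (Re \o g : V -> R) -> continuous (Im \o g : V -> R) ->
  (\int[mu]_x (normc (g x) ^+ 2)%:E <= \int[mu]_xi (normc (fourier g xi) ^+ 2)%:E)%E.
Proof.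
move=> bg cR cI; have [mr mi ig [M gM]] := bg.
have mf := measurable_normc_fourier bg; have mn := measurable_normc mr mi.
pose t (k : nat) : R := k.+1%:R^-1.
have t0 k : 0 < t k by rewrite invr_gt0 ltr0n.
pose h k x := \int[mu]_y (correl g x y * heatV (t k) (x - y)).
have mc : measurable_fun setT (fun z : V * V => correl g z.2 z.1).
  apply: measurable_funD; apply: measurable_funM.
  - exact: measurableT_comp mr measurable_snd.
  - exact: measurableT_comp mr measurable_fst.
  - exact: measurableT_comp mi measurable_snd.
  - exact: measurableT_comp mi measurable_fst.
have mh k : measurable_fun setT (h k).
  have mF : measurable_fun setT (fun z : V * V => correl g z.2 z.1 * heatV (t k) (z.2 - z.1)).
    apply: measurable_funM => //; apply: (measurableT_comp (measurable_heatV (t k))).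
    exact: (measurable_swapped measurable_rVsub2).
  exact: (measurable_Rintegral mu mF).
have corM x y : `|correl g x y| <= normc (g x) * M.
  by rewrite (le_trans (correl_le _ _ _))// ler_wpM2l ?normc_ge0.
have hM k x : `|h k x| <= M * normc (g x).
  have ih : mu.-integrable setT (EFin \o (fun y => normc (g x) * M * heatV (t k) (x - y))).
    by apply: integrable_scalel; exact: integrable_heatV.
  have mcx : measurable_fun setT (correl g x).
    by apply: measurable_funD; apply: measurable_funM.
  have ic : mu.-integrable setT (EFin \o (fun y => correl g x y * heatV (t k) (x - y))).
    apply: (@integrable_le _ _ _ mu _ (fun y => normc (g x) * M * heatV (t k) (x - y))) => //.
      by apply: measurable_funM => //; exact: measurable_heatVB.
    by move=> y; rewrite normrM (ger0_norm (heatV_ge0 _ _)) ler_wpM2r ?heatV_ge0.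
  rewrite mulrC -[leRHS]mulr1 -(Rintegral_heatV x (t0 k)).
  rewrite -RintegralZl//; last exact: integrable_heatV.
  apply: le_trans (le_normr_Rintegral _ ic) _ => //.
  apply: le_Rintegral => //; first by have := integrable_abse ic.
  by move=> y _; rewrite normrM (ger0_norm (heatV_ge0 _ _)) ler_wpM2r ?heatV_ge0.
have cI' : (\int[mu]_x (h k x)%:E)%E @[k --> \oo] --> (\int[mu]_x (normc (g x) ^+ 2)%:E)%E.
  apply: (@dominated_cvg _ _ _ mu setT measurableT (fun k => EFin \o h k)
    (fun x => (normc (g x) ^+ 2)%:E) (EFin \o (fun x => M * normc (g x)))).
  - by move=> k; apply/measurable_EFinP; exact: mh.
  - move=> x _; apply: cvg_EFin; first exact: nearW.
    exact: (@cvg_heat_correl g x M).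
  - by [].
  - exact: integrable_scalel.
  - by move=> k x _; rewrite lee_fin hM.
apply: (cvge_le _ cI'); apply: nearW => k.
have ihk : mu.-integrable setT (EFin \o h k).
  by apply: (@integrable_le _ _ _ mu _ (fun x => M * normc (g x))) => //; exact: integrable_scalel.
have ik := integrable_gaussV_sqr bg (t0 k).
apply: (@le_trans _ _ (\int[mu]_xi (gaussV (t k) xi * normc (fourier g xi) ^+ 2)%:E)%E).
  rewrite -(fineK (integrable_fin_num measurableT ihk)).
  rewrite -(fineK (integrable_fin_num measurableT ik)) lee_fin.
  by exact/eqW/esym/plancherel_gauss.
apply: ge0_le_integral => //.
- by move=> x _; rewrite lee_fin mulr_ge0 ?gaussV_ge0 ?sqr_ge0.
- by apply/measurable_EFinP; apply: measurable_funM; [exact: measurable_gaussV|exact: measurable_funX].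
- by apply/measurable_EFinP; exact: measurable_funX.
- move=> x _; rewrite lee_fin ler_piMl ?sqr_ge0// gaussVE -expR0 ler_expR oppr_le0.
  by rewrite mulr_ge0 ?(ltW (t0 k))// sumr_ge0// => i _; exact: sqr_ge0.
Qed.

End plancherel_limit.

(** * The Hausdorff-Young inequality *)

Section hausdorff_young.
Context {R : realType} {n : nat}.
Local Notation V := 'rV[R]_n.
Local Notation mu := (@lebesgue_rV R n).
Local Notation leb := (@lebesgue_measure R).
Implicit Types (g : V -> R[i]) (x y xi : V) (A : set V).

Local Notation Re := (@complex.Re R).
Local Notation Im := (@complex.Im R).
Local Notation normc := (@Normc.normc R).

Definition cutoff A g : V -> R[i] := fun x => (\1_A x)%:C%C * g x.

Lemma normc_real (r : R) : normc r%:C%C = `|r|.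
Proof. by rewrite /= expr0n/= addr0 sqrtr_sqr. Qed.

Lemma normc_cutoff A g x : normc (cutoff A g x) = \1_A x * normc (g x).
Proof. by rewrite Normc.normcM normc_real ger0_norm. Qed.

Lemma indic_le1 A x : \1_A x <= 1 :> R.
Proof. by rewrite indicE; case: (x \in A). Qed.

Lemma normc_cutoff_le A g x : normc (cutoff A g x) <= normc (g x).
Proof. by rewrite normc_cutoff ler_piMl// indic_le1. Qed.

Lemma bounded_integrable_cutoff A g : measurable A -> bounded_integrable g ->
  bounded_integrable (cutoff A g).
Proof.
move=> mA [mr mi ig [M gM]]; split.
- rewrite (_ : _ \o _ = (fun x => \1_A x * (Re \o g) x)).
    by apply: measurable_funM => //; exact: measurable_indic.
  by apply/funext => x; rewrite /= /cutoff Re_realc.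
- rewrite (_ : _ \o _ = (fun x => \1_A x * (Im \o g) x)).
    by apply: measurable_funM => //; exact: measurable_indic.
  by apply/funext => x; rewrite /= /cutoff Im_realc.
- apply: (@integrable_le _ _ _ mu _ (normc \o g)) => //.
    rewrite (_ : _ \o _ = (fun x => \1_A x * (normc \o g) x)).
      by apply: measurable_funM; [exact: measurable_indic|exact: measurable_normc].
    by apply/funext => x; rewrite /= normc_cutoff.
  by move=> x; rewrite /= ger0_norm// normc_cutoff_le.
- by exists M => x; rewrite (le_trans (normc_cutoff_le _ _ _)).
Qed.

Lemma fourierDZ g h (r : R) xi : bounded_integrable g -> bounded_integrable h ->
  fourier (fun x => g x + r%:C%C * h x) xi = fourier g xi + r%:C%C * fourier h xi.
Proof.
move=> bg bh.
have wD x : wave (fun x => g x + r%:C%C * h x) x xi = wave g x xi + r%:C%C * wave h x xi.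
  by rewrite /wave mulrDl mulrA.
have ReD (u v : R[i]) : Re (u + v) = Re u + Re v by case: u v => ? ? [].
have ImD (u v : R[i]) : Im (u + v) = Im u + Im v by case: u v => ? ? [].
apply/eqP; rewrite eq_complex ReD ImD Re_realc Im_realc !Re_fourierE !Im_fourierE.
apply/andP; split; apply/eqP.
  rewrite -RintegralZl//; last exact: integrable_Re_wave.
  rewrite -RintegralD//; last 2 first.
  - exact: integrable_Re_wave.
  - by apply: integrable_scalel; exact: integrable_Re_wave.
  by apply: eq_Rintegral => x _; rewrite wD ReD Re_realc.
rewrite -RintegralZl//; last exact: integrable_Im_wave.
rewrite -RintegralD//; last 2 first.
- exact: integrable_Im_wave.
- by apply: integrable_scalel; exact: integrable_Im_wave.
by apply: eq_Rintegral => x _; rewrite wD ImD Im_realc.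
Qed.

Lemma fourier_cutoffD A g xi : measurable A -> bounded_integrable g ->
  fourier g xi = fourier (cutoff A g) xi + fourier (cutoff (~` A) g) xi.
Proof.
move=> mA bg.
have b1 := bounded_integrable_cutoff mA bg.
have b2 := bounded_integrable_cutoff (measurableC mA) bg.
rewrite -[fourier (cutoff (~` A) g) xi]mul1r -[1]/((1 : R)%:C%C) -fourierDZ//.
congr (fourier _ xi); apply/funext => x; rewrite mul1r /cutoff -mulrDl -rmorphD/= !indicE in_setC.
by case: (x \in A); rewrite /= ?addr0 ?add0r rmorph1 mul1r.
Qed.

Variables (g : V -> R[i]) (r N : R).
Hypotheses (bg : bounded_integrable g) (r1 : 1 < r) (r2 : r < 2) (N0 : 0 < N).
Hypothesis gN : (\int[mu]_x (normc (g x) `^ r)%:E <= N%:E)%E.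

(** Chosen so that k + 2 = r / (r - 1), the conjugate exponent. The layer cake runs over u =
    lambda^k, since |fhat|^(k+2) is |fhat|^2 times the length of the interval from 0 to |fhat|^k. *)
Let k : R := (2 - r) / (r - 1).

Let k0 : 0 < k. Proof. by rewrite divr_gt0// subr_gt0. Qed.

Let W x : R := normc (g x).

Let B x : R := (2 * N * W x `^ (1 - r)) `^ k.

Let mW : measurable_fun setT W.
Proof. by have [mr mi _ _] := bg; exact: measurable_normc. Qed.

Let mB : measurable_fun setT B.
Proof.
apply: (@measurableT_comp _ _ _ _ _ _ (fun z : R => z `^ k)); first exact: measurable_powR.
apply: measurable_funM => //.
by apply: (@measurableT_comp _ _ _ _ _ _ (fun z : R => z `^ (1 - r))) => //; exact: measurable_powR.
Qed.

(* [u <= B x] means |g x| <= (2 N / u^(1/k))^(1/(r-1)); above that height the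
   L^1 norm of g, hence its transform, is at most u^(1/k) / 2. *)
Let low (u : R) : set V := [set x | u <= B x].

Let mlow u : measurable (low u).
Proof.
rewrite (_ : low u = B @^-1` `[u, +oo[); last first.
  by apply/seteqP; split => x /=; rewrite in_itv/= andbT.
by rewrite -[X in measurable X]setTI; apply: mB.
Qed.

(** The exponents balance because 2 + k (1 - r) = r: integrating |g|^2 over the heights u <= [B x]
    gives back |g|^r. *)
Let WB x : B x * W x ^+ 2 = (2 * N) `^ k * W x `^ r.
Proof.
have [W0|W0] := eqVneq (W x) 0.
  by rewrite W0 expr0n mulr0 powR0 ?mulr0// gt_eqF// (lt_trans ltr01).
have Wp : 0 < W x by rewrite lt_neqAle eq_sym W0 /W normc_ge0.
rewrite /B powRM ?powR_ge0 ?mulr_ge0 ?(ltW N0)// -mulrA; congr (_ * _).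
rewrite -powRrM -(@powR_mulrn _ _ 2) ?(ltW Wp)// -powRD; last by rewrite W0 implybT.
by congr (_ `^ _); rewrite /k; field; rewrite subr_eq0 gt_eqF.
Qed.

(** At height l = u^(1/k) the part of g outside [low u] has L^1 norm at most l / 2, since there |g|
    <= l |g|^r / (2N). If |fhat(xi)| > l, the low part therefore carries at least half of it. *)
Let low_fourier u xi : 0 < u -> u < normc (fourier g xi) `^ k ->
  normc (fourier g xi) ^+ 2 <= 4 * normc (fourier (cutoff (low u) g) xi) ^+ 2.
Proof.
move=> u0 uk; have [mr mi ig _] := bg.
set l := u `^ k^-1.
have l0 : 0 < l by exact: powR_gt0.
have lu : l `^ k = u by rewrite -powRrM mulVf ?gt_eqF// powRr1// ltW.
have lt_f : l < normc (fourier g xi).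
  rewrite ltNge; apply/negP => fl; move: uk; rewrite ltNge => /negP; apply.
  by rewrite -lu; apply: ge0_ler_powR => //; rewrite ?nnegrE ?normc_ge0 ?(ltW k0) ?(ltW l0).
have bl := bounded_integrable_cutoff (mlow u) bg.
have bh := bounded_integrable_cutoff (measurableC (mlow u)) bg.
have hi_le : normc (fourier (cutoff (~` low u) g) xi) <= l / 2.
  apply: le_trans (normc_fourier_le xi bh) _.
  have iW : (\int[mu]_x (W x `^ r)%:E)%E \is a fin_num.
    rewrite ge0_fin_numE ?(le_lt_trans gN) ?ltry//.
    by apply: integral_ge0 => x _; rewrite lee_fin powR_ge0.
  have mWr : measurable_fun setT (fun x => W x `^ r).
    by apply: (@measurableT_comp _ _ _ _ _ _ (fun z : R => z `^ r)) => //; exact: measurable_powR.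
  have iWr : mu.-integrable setT (EFin \o (fun x => W x `^ r)).
    apply/integrableP; split; first exact/measurable_EFinP.
    under eq_integral do rewrite /= ger0_norm ?powR_ge0//.
    by rewrite -ge0_fin_numE// integral_ge0// => x _; rewrite lee_fin powR_ge0.
  have hE : l / 2 = l / (2 * N) * N by field; rewrite gt_eqF.
  rewrite hE; apply: (@le_trans _ _ (\int[mu]_x (l / (2 * N) * W x `^ r))).
    apply: le_Rintegral => //; [by case: bh|exact: integrable_scalel|].
    move=> x _; rewrite normc_cutoff indicE.
    have [|_] := boolP (x \in ~` low u); last first.
      by rewrite mul0r mulr_ge0 ?powR_ge0// divr_ge0// ?mulr_ge0 ?(ltW N0) ?(ltW l0).
    rewrite inE /low/= => /negP; rewrite -ltNge mul1r -/(W x) => Bu.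
    (* Where g vanishes, 0 to the power 1 - r is 0 by convention, so [B x] is 0 rather than infinite
       and the point falls outside [low u]; the bound is trivial there. *)
    have [W0|W0] := eqVneq (W x) 0.
      by rewrite W0 mulr_ge0 ?powR_ge0// divr_ge0// ?mulr_ge0 ?(ltW N0) ?(ltW l0).
    have Wp : 0 < W x by rewrite lt_neqAle eq_sym W0 /W normc_ge0.
    (* The condition [B x] < u, read through the increasing map z -> z^k. *)
    have NW : 2 * N * W x `^ (1 - r) <= l.
      rewrite leNgt; apply/negP => lN; move: Bu; rewrite ltNge => /negP; apply.
      rewrite -lu /B; apply: ge0_ler_powR; rewrite ?nnegrE ?(ltW k0) ?(ltW l0)//.
        by rewrite mulr_ge0 ?powR_ge0// mulr_ge0// ltW.
      exact: ltW.
    have {1}-> : W x = (2 * N * W x `^ (1 - r)) * (W x `^ r / (2 * N)).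
      have -> : 2 * N * W x `^ (1 - r) * (W x `^ r / (2 * N)) = W x `^ (1 - r) * W x `^ r.
        by field; rewrite gt_eqF.
      by rewrite -powRD ?W0 ?implybT// subrK powRr1// ltW.
    rewrite mulrAC [leRHS]mulrAC.
    rewrite -[X in _ <= X]mulrA mulrC mulrAC.
    have h : 0 <= W x `^ r / (2 * N) by rewrite divr_ge0 ?powR_ge0// mulr_ge0// ltW.
    have := ler_wpM2r h NW; rewrite !mulrA.
    by move=> h'; lra.
  rewrite RintegralZl// ler_wpM2l//.
    by rewrite divr_ge0// ?mulr_ge0 ?(ltW N0) ?(ltW l0).
  by rewrite -lee_fin /Rintegral fineK.
set a := normc (fourier g xi) in lt_f *; set b := normc (fourier (cutoff (low u) g) xi).
have ab : a <= b + l / 2.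
  rewrite /a (fourier_cutoffD xi (mlow u) bg).
  by apply: le_trans (le_normcD _ _) _; rewrite lerD2l.
have b0 : 0 <= b by exact: normc_ge0.
have a2 : a <= 2 * b by lra.
rewrite (_ : 4 * b ^+ 2 = (2 * b) ^+ 2); last by ring.
by rewrite ler_pXn2r ?nnegrE ?normc_ge0// mulr_ge0.
Qed.

(** Joint measurability of the two layer-cake integrands: the transform side uses the strict
    condition u < |fhat|^k of [low_fourier], the function side the condition u <= [B x] that defines
    [low]. *)
Let mG (b w : V -> R) : measurable_fun setT b -> measurable_fun setT w ->
  measurable_fun setT (fun z : R * V => (\1_(`]0, b z.2[) z.1 * w z.2)%:E) /\
  measurable_fun setT (fun z : R * V => (\1_(`]0, b z.2]) z.1 * w z.2)%:E).
Proof.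
move=> mb mw.
have mb2 : measurable_fun setT (fun z : R * V => b z.2 - z.1).
  by apply: measurable_funB => //; exact: measurableT_comp mb measurable_snd.
have mw2 : measurable_fun setT (fun z : R * V => w z.2).
  exact: measurableT_comp mw measurable_snd.
have m0 : measurable [set z : R * V | 0 < z.1].
  rewrite (_ : [set _ | _] = fst @^-1` `]0, +oo[); last first.
    by apply/seteqP; split => z /=; rewrite in_itv/= andbT.
  by rewrite -[X in measurable X]setTI; apply: measurable_fst.
have m1 : measurable [set z : R * V | z.1 < b z.2].
  rewrite (_ : [set _ | _] = (fun z => b z.2 - z.1) @^-1` `]0, +oo[); last first.
    by apply/seteqP; split => z /=; rewrite in_itv/= andbT subr_gt0.
  by rewrite -[X in measurable X]setTI; apply: mb2.
have m2 : measurable [set z : R * V | z.1 <= b z.2].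
  rewrite (_ : [set _ | _] = (fun z => b z.2 - z.1) @^-1` `[0, +oo[); last first.
    by apply/seteqP; split => z /=; rewrite in_itv/= andbT subr_ge0.
  by rewrite -[X in measurable X]setTI; apply: mb2.
split; apply/measurable_EFinP; apply: measurable_funM => //.
  rewrite (_ : (fun z => _) = \1_([set z : R * V | 0 < z.1] `&` [set z | z.1 < b z.2])).
    by apply: measurable_indic; exact: measurableI.
  apply/funext => z; rewrite !indicE; congr (_%:R); congr nat_of_bool.
  apply/idP/idP; rewrite !inE/= in_itv/=; first by move=> /andP[].
  by move=> [-> ->].
rewrite (_ : (fun z => _) = \1_([set z : R * V | 0 < z.1] `&` [set z | z.1 <= b z.2])).
  by apply: measurable_indic; exact: measurableI.
apply/funext => z; rewrite !indicE; congr (_%:R); congr nat_of_bool.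
apply/idP/idP; rewrite !inE/= in_itv/=; first by move=> /andP[].
by move=> [-> ->].
Qed.

(** Tonelli is used twice: to fix the height u, where [low_fourier] and [bessel] apply, and to
    return to fixed x, where the integral over u <= [B x] is evaluated by [WB]. The 4 is the square
    of the factor 2 lost in [low_fourier]. *)
Theorem hausdorff_young :
  (\int[mu]_xi (normc (fourier g xi) `^ (k + 2))%:E <= (4 * (2 * N) `^ k * N)%:E)%E.
Proof.
set F := fun xi => normc (fourier g xi).
have F0 xi : 0 <= F xi by exact: normc_ge0.
have mF : measurable_fun setT F := measurable_normc_fourier bg.
have mF2 : measurable_fun setT (fun xi => F xi ^+ 2) by exact: measurable_funX.
have mFk : measurable_fun setT (fun xi => F xi `^ k).
  by apply: (@measurableT_comp _ _ _ _ _ _ (fun z : R => z `^ k)) => //; exact: measurable_powR.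
have mW2 : measurable_fun setT (fun x => 4 * W x ^+ 2).
  by apply: measurable_funM => //; exact: measurable_funX.
have [mG1 _] := mG mFk mF2; have [_ mG2] := mG mB mW2.
have inner1 xi : (F xi `^ (k + 2))%:E =
    (\int[leb]_u (\1_(`]0%R, (F xi `^ k)%R[) u * F xi ^+ 2)%:E)%E.
  under eq_integral do rewrite EFinM.
  rewrite ge0_integralZr ?lee_fin ?sqr_ge0//; last by apply/measurable_EFinP; exact: measurable_indic.
  rewrite integral_indic//= setIT lebesgue_measure_itv/= lte_fin.
  case: ltP => [_|F00].
    rewrite oppr0 adde0 -EFinM; congr EFin.
    by rewrite -(@powR_mulrn _ _ 2)// -powRD// gt_eqF// addr_gt0.
  have : F xi `^ k = 0 by apply/eqP; rewrite eq_le F00 powR_ge0.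
  move/eqP; rewrite powR_eq0 => /andP[/eqP -> _].
  by rewrite mul0e powR0// gt_eqF// addr_gt0.
under eq_integral do rewrite inner1.
have := @fubini_tonelli _ _ _ _ R leb mu _ mG1.
rewrite /fubini_F /fubini_G/= => <-; last first.
  by move=> z; rewrite lee_fin mulr_ge0// sqr_ge0.
apply: (@le_trans _ _ (\int[leb]_u \int[mu]_x (\1_(`]0%R, (B x)]) u * (4 * W x ^+ 2))%:E)%E).
  apply: ge0_le_integral => //.
  - by move=> u _; apply: integral_ge0 => x _; rewrite lee_fin mulr_ge0// sqr_ge0.
  - apply: (@measurable_fun_fubini_tonelli_F _ _ _ _ _ mu _ mG1).
    by move=> z; rewrite lee_fin mulr_ge0// sqr_ge0.
  - apply: (@measurable_fun_fubini_tonelli_F _ _ _ _ _ mu _ mG2).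
    by move=> z; rewrite lee_fin mulr_ge0// mulr_ge0// sqr_ge0.
  move=> u _; have [u0|u0] := ltP 0 u; last first.
    rewrite integral0_eq ?integral_ge0//.
      by move=> x _; rewrite lee_fin mulr_ge0// mulr_ge0// sqr_ge0.
    move=> xi _; rewrite indicE memNset ?mul0r//= in_itv/= => /andP[].
    by rewrite ltNge u0.
  have bl := bounded_integrable_cutoff (mlow u) bg.
  have mfl := measurable_normc_fourier bl.
  apply: (@le_trans _ _ (\int[mu]_xi (4 * normc (fourier (cutoff (low u) g) xi) ^+ 2)%:E)%E).
    apply: ge0_le_integral => //.
    - by move=> x _; rewrite lee_fin mulr_ge0// sqr_ge0.
    - exact: (measurableT_comp mG1 (pair1_measurable u)).
    - by apply/measurable_EFinP; apply: measurable_funM => //; exact: measurable_funX.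
    move=> xi _; rewrite lee_fin indicE.
    case: (boolP (u \in _)) => [|_]; last by rewrite mul0r mulr_ge0// sqr_ge0.
    rewrite inE/= in_itv/= => /andP[_ uF].
    by rewrite mul1r; exact: low_fourier.
  under eq_integral do rewrite EFinM.
  rewrite ge0_integralZl//; last 2 first.
  - by apply/measurable_EFinP; exact: measurable_funX.
  - by move=> x _; rewrite lee_fin sqr_ge0.
  apply: le_trans (lee_wpmul2l _ (bessel bl)) _ => //.
  have [mr mi _ _] := bl.
  rewrite -ge0_integralZl//; last 2 first.
  - by apply/measurable_EFinP; apply: measurable_funX; exact: measurable_normc.
  - by move=> x _; rewrite lee_fin sqr_ge0.
  apply: ge0_le_integral => //.
  - by move=> x _; rewrite -EFinM lee_fin mulr_ge0// sqr_ge0.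
  - apply/measurable_EFinP; apply: measurable_funM => //.
    by apply: measurable_funX; exact: measurable_normc.
  - exact: (measurableT_comp mG2 (pair1_measurable u)).
  move=> x _; rewrite -EFinM lee_fin normc_cutoff !indicE.
  case: (boolP (x \in _)) => [|_]; last first.
    by rewrite mul0r expr0n/= mulr0 mulr_ge0// mulr_ge0// sqr_ge0.
  rewrite inE /low/= => uB; rewrite mem_set ?mul1r//.
  by rewrite /= in_itv/= u0.
have := @fubini_tonelli _ _ _ _ R leb mu _ mG2.
rewrite /fubini_F /fubini_G/= => ->; last first.
  by move=> z; rewrite lee_fin mulr_ge0// mulr_ge0// sqr_ge0.
have inner2 x : (\int[leb]_u (\1_(`]0%R, (B x)]) u * (4 * W x ^+ 2))%:E)%E =
    ((4 * (2 * N) `^ k) * W x `^ r)%:E.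
  under eq_integral do rewrite EFinM.
  have w0 : (0 <= (4 * W x ^+ 2)%:E)%E by rewrite lee_fin mulr_ge0// sqr_ge0.
  rewrite ge0_integralZr//; last by apply/measurable_EFinP; exact: measurable_indic.
  rewrite integral_indic//= setIT lebesgue_measure_itv/= lte_fin.
  have -> : (4 * (2 * N) `^ k * W x `^ r)%:E = (B x * (4 * W x ^+ 2))%:E.
    by congr EFin; rewrite mulrCA WB mulrA.
  case: ltP => [_|B0]; first by rewrite oppr0 adde0 -EFinM.
  have -> : B x = 0 by apply/eqP; rewrite eq_le B0 powR_ge0.
  by rewrite mul0e mul0r.
under eq_integral do rewrite inner2 EFinM.
rewrite ge0_integralZl//; last 3 first.
- apply/measurable_EFinP.
  by apply: (@measurableT_comp _ _ _ _ _ _ (fun z : R => z `^ r)) => //; exact: measurable_powR.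
- by move=> x _; rewrite lee_fin powR_ge0.
- by rewrite lee_fin mulr_ge0// powR_ge0.
by rewrite [leRHS]EFinM lee_wpmul2l// lee_fin mulr_ge0// powR_ge0.
Qed.

End hausdorff_young.

(** * Tail and ball estimates *)

Section power_integrals.
Context {R : realType}.
Local Notation leb := (@lebesgue_measure R).

Lemma is_derive_continuous (F : R -> R) (t a : R) : is_derive t 1 F a -> {for t, continuous F}.
Proof.
by move=> dF; apply: differentiable_continuous; apply/derivable1_diffP; exact: ex_derive.
Qed.

(** Meant for integrands in |t|, whose explicit primitives are correct on the half line only. *)
Lemma integral_even_FTC (f F : R -> R) (l : R) : (forall t, 0 <= f t) -> continuous f ->
  (forall t, f (- t) = f t) -> (forall t : R, 0 <= t -> is_derive t 1 F (f t)) ->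
  F t @[t --> +oo] --> l -> (\int[leb]_t (f t)%:E)%E = (2 * (l - F 0))%:E.
Proof.
move=> f0 cf fN dF Fl; rewrite ge0_symfun_integralT//; last by move=> t /=; rewrite fN.
rewrite -set_itvcy (@ge0_continuous_FTC2y _ f F 0 l) -?EFinB -?EFinM//.
- exact: continuous_subspaceT.
- by move=> x x0; have [] := dF x (ltW x0).
- by apply: cvg_at_right_filter; exact: is_derive_continuous (dF 0 (lexx 0)).
- by move=> x; rewrite in_itv/= andbT => x0; rewrite derive1E; have [] := dF x (ltW x0).
Qed.

Lemma powR_cvgy0 (e : R) : 0 < e -> t `^ (- e) @[t --> +oo] --> (0 : R).
Proof.
move=> e0; apply/cvgr0Pnorm_le => r r0; near=> t.
have t1 : 0 < t by near: t; exact: nbhs_pinfty_gt.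
have tr : r^-1 `^ e^-1 <= t by near: t; exact: nbhs_pinfty_ge.
rewrite ger0_norm ?powR_ge0// powRN invf_ple ?posrE ?powR_gt0//.
have -> : r^-1 = (r^-1 `^ e^-1) `^ e.
  by rewrite -powRrM mulVf ?gt_eqF// powRr1// invr_ge0 ltW.
by apply: ge0_ler_powR; rewrite ?nnegrE ?powR_ge0 ?(ltW t1) ?(ltW e0).
Unshelve. all: by end_near. Qed.

Lemma continuous_comp_norm (h : R -> R) (T : R) : 0 < T ->
  (forall x : R, 0 < x -> {for x, continuous h}) -> continuous (fun t : R => h (T + `|t|)).
Proof.
move=> T0 ch t; apply: (@continuous_comp _ _ _ (fun t : R => T + `|t|) h).
  by apply: cvgD; [exact: cvg_cst|exact: norm_continuous].
by apply: ch; rewrite ltr_pwDl.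
Qed.

Lemma integral_shift_powR (T e : R) : 1 < e -> 0 < T ->
  (\int[leb]_t ((T + `|t|) `^ (- e))%:E)%E = (2 * (T `^ (1 - e) / (e - 1)))%:E.
Proof.
move=> e1 T0; pose F t : R := - (e - 1)^-1 * (T + t) `^ (1 - e).
have e10 : e - 1 != 0 by rewrite subr_eq0 gt_eqF.
transitivity (2 * (0 - F 0))%:E; last first.
  by congr EFin; rewrite /F addr0 sub0r mulNr opprK [_^-1 * _]mulrC.
apply: (@integral_even_FTC (fun t => (T + `|t|) `^ (- e)) F 0).
- by move=> t; exact: powR_ge0.
- apply: (@continuous_comp_norm (fun x => x `^ (- e)) T) => // x x0.
  exact: is_derive_continuous (is_derive1_powR _ x0).
- by move=> t; rewrite normrN.
- move=> t t0; have Tt : 0 < T + t by rewrite ltr_pwDl.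
  have d1 : is_derive (T + t) 1 (fun x : R => x `^ (1 - e)) ((1 - e) * (T + t) `^ (1 - e - 1)).
    exact: is_derive1_powR.
  have d2 : is_derive t 1 (fun x : R => T + x) 1.
    by apply: is_derive_eq; rewrite add0r mulr1.
  have d3 := @is_derive1_comp _ (fun x : R => x `^ (1 - e)) (fun x : R => T + x) _ _ _ d1 d2.
  have -> : F = cst (- (e - 1)^-1) * ((fun x : R => x `^ (1 - e)) \o (fun x : R => T + x)) by [].
  apply: is_derive_eq; rewrite /GRing.scale/= ger0_norm// mulr0 addr0 mulr1.
  have -> : 1 - e - 1 = - e by ring.
  rewrite mulrA (_ : - (e - 1)^-1 * (1 - e) = 1) ?mul1r//.
  by rewrite mulNr -mulrN opprB mulVf.
rewrite -(mulr0 (- (e - 1)^-1)) /F; apply: cvgM; first exact: cvg_cst.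
rewrite (_ : (fun t => _) = (fun t => t `^ (- (e - 1))) \o (fun t => T + t)); last first.
  by apply/funext => t /=; rewrite opprB.
apply: (@cvg_comp _ _ _ _ _ _ (pinfty_nbhs R)); last first.
  by apply: powR_cvgy0; rewrite subr_gt0.
apply/cvgryPge => A; near=> t; rewrite -lerBlDl.
by near: t; apply: nbhs_pinfty_ge; rewrite num_real.
Unshelve. all: by end_near. Qed.

End power_integrals.

Section holder_inequality.
Context {R : realType} d (T : measurableType d).
Variable m : {measure set T -> \bar R}.

(** Hoelder's inequality between real bounds on integrals of powers, so that the estimates can be
    chained without handling norms with values in the extended reals. *)
Lemma holder_le (u v : T -> R) (a b U W : R) :
  measurable_fun setT u -> measurable_fun setT v ->
  (forall x, 0 <= u x) -> (forall x, 0 <= v x) -> 0 < a -> 0 < b -> a^-1 + b^-1 = 1 ->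
  0 <= U -> 0 <= W ->
  (\int[m]_x (u x `^ a)%:E <= (U `^ a)%:E)%E ->
  (\int[m]_x (v x `^ b)%:E <= (W `^ b)%:E)%E ->
  (\int[m]_x (u x * v x)%:E <= (U * W)%:E)%E.
Proof.
move=> mu mv u0 v0 a0 b0 ab U0 W0 uU vW.
have := @hoelder _ _ _ m u v a b mu mv a0 b0 ab.
rewrite Lnorm1 => h; apply: le_trans (le_trans _ h) _.
  apply: eqW; apply: eq_integral => x _ /=.
  by rewrite ger0_norm// mulr_ge0.
have norm_le (w : T -> R) (c Z : R) : (forall x, 0 <= w x) -> 0 < c -> 0 <= Z ->
    (\int[m]_x (w x `^ c)%:E <= (Z `^ c)%:E)%E -> ('N[m]_c%:E[EFin \o w] <= Z%:E)%E.
  move=> w0 c0 Z0 wZ; rewrite unlock.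
  have -> : Z%:E = ((Z `^ c)%:E `^ c^-1)%E.
    by rewrite poweR_EFin -powRrM divff ?gt_eqF// powRr1.
  have ci : 0 <= c^-1 by rewrite invr_ge0 ltW.
  apply: (@gt0_ler_poweR R c^-1 ci).
  - by rewrite in_itv/= leey andbT integral_ge0// => x _; exact: poweR_ge0.
  - by rewrite in_itv/= leey andbT lee_fin powR_ge0.
  apply: le_trans wZ; apply: eqW; apply: eq_integral => x _ /=.
  by rewrite ger0_norm.
by rewrite EFinM lee_pmul ?Lnorm_ge0//; apply: norm_le.
Qed.

End holder_inequality.

Section radial_bounds.
Context {R : realType} {n : nat}.
Local Notation V := 'rV[R]_n.
Local Notation mu := (@lebesgue_rV R n).
Local Notation leb := (@lebesgue_measure R).

Lemma euclid_norm_ge0 (x : V) : 0 <= euclid_norm x.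
Proof. exact: sqrtr_ge0. Qed.

Lemma coord_le_euclid_norm (x : V) i : `|x ord0 i| <= euclid_norm x.
Proof.
rewrite -sqrtr_sqr ler_sqrt ?sumr_ge0// => [|j _]; last exact: sqr_ge0.
by rewrite (bigD1 i)//= lerDl sumr_ge0// => j _; exact: sqr_ge0.
Qed.

Lemma measurable_euclid_norm : measurable_fun setT (@euclid_norm R n).
Proof.
apply: (measurableT_comp (continuous_measurable_fun (@sqrt_continuous R))).
apply: measurable_sum => i; apply: measurable_funX; exact: measurable_coord.
Qed.

Definition eball (T : R) : set V := [set x | euclid_norm x <= T].

Lemma measurable_eball T : measurable (eball T).
Proof.
rewrite (_ : eball T = @euclid_norm R n @^-1` `]-oo, T]); last first.
  by apply/seteqP; split => x /=; rewrite in_itv.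
by rewrite -[X in measurable X]setTI; apply: measurable_euclid_norm.
Qed.

Lemma measurable_powR_fun d (U : measurableType d) (h : U -> R) (a : R) :
  measurable_fun setT h -> measurable_fun setT (fun x => h x `^ a).
Proof.
by move=> mh; apply: (@measurableT_comp _ _ _ _ _ _ (fun z : R => z `^ a)).
Qed.

(** A substitute for polar coordinates: when |x| > T, every T + |x_i| is at most 2|x|, so |x|^(-k)
    is at most 2^k times the product of the (T + |x_i|)^(-k/n), whose factors are integrable because
    k > n. *)
Lemma integral_tail (k T : R) : (0 < n)%N -> n%:R < k -> 0 < T ->
  (\int[mu]_x (\1_(~` eball T) x * euclid_norm x `^ (- k))%:E <=
   (2 `^ k * (2 / (k / n%:R - 1)) ^+ n * T `^ (n%:R - k))%:E)%E.
Proof.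
move=> n0 nk T0; set e := k / n%:R.
have n0' : 0 < n%:R :> R by rewrite ltr0n.
have e1 : 1 < e by rewrite /e ltr_pdivlMr// mul1r.
have k0 : 0 < k by exact: lt_trans nk.
pose h (t : R) := (T + `|t|) `^ (- e).
have mh : measurable_fun setT h.
  apply: measurable_powR_fun; apply: measurable_funD => //; exact: measurable_normr.
have h0 t : 0 <= h t by exact: powR_ge0.
have mhp : measurable_fun setT (fun x : V => \prod_i h (x ord0 i)).
  by apply: (@measurable_prod_coord R n (fun=> h)).
apply: (@le_trans _ _ (\int[mu]_x (2 `^ k * \prod_i h (x ord0 i))%:E)%E).
  apply: ge0_le_integral => //.
  - by move=> x _; rewrite lee_fin mulr_ge0// powR_ge0.
  - apply/measurable_EFinP; apply: measurable_funM.
      by apply: measurable_indic; apply: measurableC; exact: measurable_eball.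
    by apply: measurable_powR_fun; exact: measurable_euclid_norm.
  - by apply/measurable_EFinP; exact: measurable_funM.
  move=> x _; rewrite lee_fin indicE.
  case: (boolP (x \in _)) => [|_]; last by rewrite mul0r mulr_ge0 ?powR_ge0// prodr_ge0.
  rewrite inE /eball/= => /negP; rewrite -ltNge => Tx; rewrite mul1r.
  have x0 : 0 < euclid_norm x by exact: lt_trans Tx.
  have -> : euclid_norm x `^ (- k) = 2 `^ k * (2 * euclid_norm x) `^ (- k).
    by rewrite powRM ?(ltW x0)// mulrA -powRD ?pnatr_eq0 ?implybT// subrr powRr0 mul1r.
  rewrite ler_wpM2l ?powR_ge0//.
  have -> : (2 * euclid_norm x) `^ (- k) = \prod_(i < n) (2 * euclid_norm x) `^ (- e).
    rewrite prodr_const card_ord -powR_mulrn ?powR_ge0// -powRrM mulNr.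
    by rewrite /e divfK// gt_eqF.
  apply: ler_prod => i _; rewrite powR_ge0/= /h !powRN.
  rewrite lef_pV2 ?posrE ?powR_gt0 ?mulr_gt0// ?ltr_pwDl//.
  apply: ge0_ler_powR; rewrite ?nnegrE ?addr_ge0 ?mulr_ge0 ?(ltW T0) ?(ltW x0)//.
    by rewrite ltW// (lt_trans ltr01).
  by rewrite mulr_natl mulr2n lerD ?(ltW Tx) ?coord_le_euclid_norm.
under eq_integral do rewrite EFinM.
have c0 : (0 <= (2 `^ k)%:E)%E by rewrite lee_fin powR_ge0.
rewrite ge0_integralZl//; last 2 first.
- exact/measurable_EFinP.
- by move=> x _; rewrite lee_fin prodr_ge0.
rewrite (ge0_integral_prod (g := fun=> h))//.
under eq_bigr do rewrite integral_shift_powR//.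
rewrite -(big_morph EFin (@EFinM R) erefl) prodr_const card_ord -EFinM lee_fin.
have -> : 2 * (T `^ (1 - e) / (e - 1)) = 2 / (e - 1) * T `^ (1 - e) by rewrite mulrCA mulrC.
rewrite exprMn mulrA -(powR_mulrn n (powR_ge0 T (1 - e))) -powRrM mulrBl mul1r.
by rewrite /e divfK// gt_eqF.
Qed.

Lemma lebesgue_eball (T : R) : 0 < T ->
  (mu (eball T) <= ((2 * T) ^+ n)%:E)%E.
Proof.
move=> T0.
apply: (@le_trans _ _ (mu [set x : V | forall i : 'I_n, `[- T, T]%classic (x ord0 i)])).
  apply: le_measure; rewrite ?inE//; first exact: measurable_eball.
    rewrite (_ : [set _ | _] = \bigcap_(i in [set: 'I_n]) ((fun x : V => x ord0 i) @^-1` `[- T, T])).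
      apply: fin_bigcap_measurable => // i _; rewrite -[X in measurable X]setTI.
      by apply: measurable_coord.
    by apply/seteqP; split => x /= h i; [move=> _|]; exact: h.
  move=> x /= xT i; rewrite in_itv/= -ler_norml.
  by apply: le_trans xT; exact: coord_le_euclid_norm.
rewrite (lebesgue_rV_box (A := fun=> `[- T, T]%classic))//.
under eq_bigr do rewrite lebesgue_measure_itv/= lte_fin gtrN// -EFinD opprK -mulr2n -[T *+ 2]mulr_natl.
by rewrite -(big_morph EFin (@EFinM R) erefl) prodr_const card_ord.
Qed.

End radial_bounds.

(** * L^r bounds inside and outside balls, and normalized Hausdorff-Young *)

Section localized_bounds.
Context {R : realType} {n : nat}.
Local Notation V := 'rV[R]_n.
Local Notation mu := (@lebesgue_rV R n).
Local Notation normc := (@Normc.normc R).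
Implicit Types (W : V -> R) (g : V -> R[i]).

Lemma powR_indic (A : set V) W x (r : R) : r != 0 ->
  (\1_A x * W x) `^ r = \1_A x * W x `^ r.
Proof.
move=> r0; rewrite indicE; case: (x \in A); rewrite ?mul1r//.
by rewrite !mul0r powR0.
Qed.

(** Write W^r = (|x|^th W)^r |x|^(-th r) and apply Hoelder with the exponents p/r and p/(p - r). The
    tail integral of the second factor converges precisely when 1/r < 1/p + th/n. *)
Lemma tail_bound (p th r : R) : (0 < n)%N -> 0 < r -> r < p -> 0 < th ->
  r^-1 < p^-1 + th / n%:R ->
  exists2 c : R, 0 < c & forall W (A T : R), measurable_fun setT W ->
    (forall x, 0 <= W x) -> 0 < A -> 0 < T ->
    (\int[mu]_x ((euclid_norm x `^ th * W x) `^ p)%:E <= (A `^ p)%:E)%E ->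
    (\int[mu]_x ((\1_(~` eball T) x * W x) `^ r)%:E <=
      ((c * A * T `^ (- (n%:R * (p^-1 + th / n%:R - r^-1)))) `^ r)%:E)%E.
Proof.
move=> n0 r0 rp th0 rs; have p0 : 0 < p by exact: lt_trans rp.
have pr0 : 0 < p - r by rewrite subr_gt0.
have n0' : 0 < n%:R :> R by rewrite ltr0n.
have [nn0 pn0 rn0 prn0] : [/\ n%:R != 0 :> R, p != 0, r != 0 & p - r != 0] by split; rewrite gt_eqF.
set a := p / r; set b := p / (p - r).
have a0 : 0 < a by rewrite divr_gt0.
have b0 : 0 < b by rewrite divr_gt0.
have bn0 : b != 0 by rewrite gt_eqF.
have ab : a^-1 + b^-1 = 1 by rewrite /a /b; field; rewrite prn0 pn0.
(* The power of 1/|x| left after Hoelder; k > n restates the hypothesis on 1/r. *)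
set k := th * r * b.
have nk : n%:R < k.
  have : 0 < (p^-1 + th / n%:R - r^-1) * (n%:R * r * b).
    by apply: mulr_gt0; [rewrite subr_gt0|apply: mulr_gt0 b0; exact: mulr_gt0].
  suff -> : (p^-1 + th / n%:R - r^-1) * (n%:R * r * b) = k - n%:R by rewrite subr_gt0.
  by rewrite /k /b; field; rewrite prn0 nn0 pn0 rn0.
have k0 : 0 < k by exact: lt_trans nk.
set C := 2 `^ k * (2 / (k / n%:R - 1)) ^+ n.
have C0 : 0 < C.
  by rewrite mulr_gt0 ?powR_gt0// exprn_gt0// divr_gt0// subr_gt0 ltr_pdivlMr// mul1r.
have tailC (T : R) : 0 < T -> (\int[mu]_x (\1_(~` eball T) x * euclid_norm x `^ (- k))%:E <=
    (C * T `^ (n%:R - k))%:E)%E by exact: integral_tail.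
move: C C0 tailC => C C0 tailC.
(* Hoelder contributes C^(1/b) to the integral of the r-th power, hence its r-th root here. *)
exists (C `^ (b * r)^-1) => [|W A T mW W0 A0 T0 WA]; first exact: powR_gt0.
have mball : measurable (~` eball T : set V) by apply: measurableC; exact: measurable_eball.
pose u (x : V) := (euclid_norm x `^ th * W x) `^ r.
pose v (x : V) := \1_(~` eball T) x * euclid_norm x `^ (- (th * r)).
have mu' : measurable_fun setT u.
  apply: measurable_powR_fun; apply: measurable_funM => //.
  by apply: measurable_powR_fun; exact: measurable_euclid_norm.
have mv : measurable_fun setT v.
  apply: measurable_funM; first exact: measurable_indic.
  by apply: measurable_powR_fun; exact: measurable_euclid_norm.
have u0 x : 0 <= u x by exact: powR_ge0.
have v0 x : 0 <= v x by rewrite mulr_ge0 ?powR_ge0.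
have uv x : (\1_(~` eball T) x * W x) `^ r = u x * v x.
  rewrite powR_indic// /u /v indicE; case: (boolP (x \in _)) => [|_]; last by rewrite !mul0r mulr0.
  rewrite inE /eball/= => /negP; rewrite -ltNge !mul1r => Tx.
  have x0 : 0 < euclid_norm x by exact: lt_trans Tx.
  rewrite powRM ?powR_ge0// -powRrM mulrAC -powRD ?subrr ?powRr0 ?mul1r//.
  by rewrite (gt_eqF x0) implybT.
under eq_integral do rewrite uv.
have CT0 : 0 < C * T `^ (n%:R - k) by rewrite mulr_gt0 ?powR_gt0.
have -> : (C `^ (b * r)^-1 * A * T `^ (- (n%:R * (p^-1 + th / n%:R - r^-1)))) `^ r =
    A `^ r * (C * T `^ (n%:R - k)) `^ b^-1.
  rewrite !powRM ?mulr_ge0 ?powR_ge0 ?(ltW A0) ?(ltW C0)// -!powRrM.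
  rewrite [C `^ _ * _]mulrC -mulrA; congr (_ * (_ `^ _ * _ `^ _)).
    by field; rewrite rn0 bn0.
  by rewrite /k /b; field; rewrite prn0 nn0 pn0 rn0.
apply: holder_le a0 b0 ab _ _ _ _ => //; rewrite ?powR_ge0//.
  rewrite -powRrM (_ : r * a = p); last by rewrite /a; field.
  apply: le_trans WA; apply: eqW.
  by apply: eq_integral => x _; rewrite /u -powRrM (_ : r * a = p)// /a; field.
rewrite -powRrM mulVf// powRr1 ?(ltW CT0)//.
apply: le_trans (tailC T T0).
apply: eqW; apply: eq_integral => x _.
rewrite /v (powR_indic (~` eball T) (fun x => euclid_norm x `^ (- (th * r))))//.
by rewrite -powRrM mulNr.
Qed.

(** Hoelder with the exponents 2/r and 2/(2 - r) against the indicator of the ball, whose volume is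
    at most (2T)^n. The case r = 1 gives the L^1 bounds of [split_bound]. *)
Lemma ball_bound (r : R) W (m T : R) : 0 < r -> r < 2 -> measurable_fun setT W ->
  (forall x, 0 <= W x) -> 0 <= m -> 0 < T ->
  (\int[mu]_x (W x ^+ 2)%:E <= (m ^+ 2)%:E)%E ->
  (\int[mu]_x ((\1_(eball T) x * W x) `^ r)%:E <=
    ((m * (2 * T) `^ (n%:R * (r^-1 - 2^-1))) `^ r)%:E)%E.
Proof.
move=> r0 r2 mW W0 m0 T0 Wm.
have rn0 : r != 0 by rewrite gt_eqF.
have r20 : 0 < 2 - r by rewrite subr_gt0.
have r2n0 : 2 - r != 0 by rewrite gt_eqF.
set a := 2 / r; set b := 2 / (2 - r).
have a0 : 0 < a by rewrite divr_gt0.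
have b0 : 0 < b by rewrite divr_gt0.
have ab : a^-1 + b^-1 = 1 by rewrite /a /b; field; rewrite r2n0 rn0.
have T20 : 0 < 2 * T by rewrite mulr_gt0.
have bn0 : b != 0 by rewrite gt_eqF.
have -> : (m * (2 * T) `^ (n%:R * (r^-1 - 2^-1))) `^ r = m `^ r * (2 * T) `^ (n%:R * b^-1).
  rewrite powRM ?powR_ge0// -powRrM; congr (_ * _ `^ _).
  by rewrite /b; field; rewrite rn0 r2n0.
under eq_integral do rewrite powR_indic// mulrC.
apply: holder_le a0 b0 ab _ _ _ _ => //; rewrite ?powR_ge0//.
- exact: measurable_powR_fun.
- by apply: measurable_indic; exact: measurable_eball.
- by move=> x; exact: powR_ge0.
- rewrite -powRrM (_ : r * a = 2%:R) ?powR_mulrn//; last by rewrite /a; field.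
  apply: le_trans Wm; apply: eqW.
  apply: eq_integral => x _; rewrite -powRrM (_ : r * a = 2%:R) ?powR_mulrn//.
  by rewrite /a; field.
rewrite -powRrM (divfK bn0) (powR_mulrn n (ltW T20)).
apply: le_trans (lebesgue_eball T0); apply: eqW.
transitivity (\int[mu]_x (\1_(eball T : set V) x)%:E)%E; last first.
  by rewrite integral_indic ?setIT//; exact: measurable_eball.
apply: eq_integral => x _; rewrite indicE; case: (_ \in _) => /=.
  by rewrite powR1.
by rewrite powR0.
Qed.

(** The homogeneous form: with N = nu^r in [hausdorff_young], the power of nu on the right is r (k +
    1) = r / (r - 1). *)
Lemma hausdorff_young_norm (r : R) : 1 < r -> r < 2 ->
  exists2 H : R, 0 < H & forall g (nu : R), bounded_integrable g -> 0 < nu ->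
    (\int[mu]_x (normc (g x) `^ r)%:E <= (nu `^ r)%:E)%E ->
    (\int[mu]_xi (normc (fourier g xi) `^ (r / (r - 1)))%:E <=
      ((H * nu) `^ (r / (r - 1)))%:E)%E.
Proof.
move=> r1 r2; have r0 : 0 < r by exact: lt_trans r1.
have r10 : 0 < r - 1 by rewrite subr_gt0.
have [rn0 r1n0] : r != 0 /\ r - 1 != 0 by split; rewrite gt_eqF.
set k := (2 - r) / (r - 1).
have kr : r / (r - 1) = k + 2 by rewrite /k; field.
exists ((4 * 2 `^ k) `^ (r / (r - 1))^-1) => [|g nu bg nu0 gnu].
  by rewrite powR_gt0// mulr_gt0// powR_gt0.
have N0 : 0 < nu `^ r by exact: powR_gt0.
apply: le_trans (le_trans (hausdorff_young bg r1 r2 N0 gnu) _).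
  by rewrite -/k kr.
have en0 : r / (r - 1) != 0 by rewrite mulf_neq0// invr_neq0.
have hE (c : R) : 0 <= c -> (c `^ (r / (r - 1))^-1 * nu) `^ (r / (r - 1)) = c * nu `^ (r / (r - 1)).
  by move=> c0; rewrite powRM ?powR_ge0 ?(ltW nu0)// -powRrM mulVf// powRr1.
rewrite hE ?mulr_ge0 ?powR_ge0// lee_fin -/k powRM ?powR_ge0// -!mulrA.
rewrite -powRrM -powRD; last by rewrite (gt_eqF nu0) implybT.
apply: eqW; congr (_ * (_ * _ `^ _)).
by rewrite /k; field.
Qed.

End localized_bounds.

(** * Sufficiency *)

Section uncertainty_core.
Context {R : realType} {n : nat}.
Local Notation V := 'rV[R]_n.
Local Notation mu := (@lebesgue_rV R n).
Local Notation normc := (@Normc.normc R).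
Implicit Types (f g : V -> R[i]).

Lemma ge0_integral_addEFin (u v : V -> R) : measurable_fun setT u -> measurable_fun setT v ->
  (forall x, 0 <= u x) -> (forall x, 0 <= v x) ->
  (\int[mu]_x (u x + v x)%:E = \int[mu]_x (u x)%:E + \int[mu]_x (v x)%:E)%E.
Proof.
move=> mu' mv u0 v0; have mu2 : measurable_fun setT (EFin \o u) by exact/measurable_EFinP.
have mv2 : measurable_fun setT (EFin \o v) by exact/measurable_EFinP.
have u02 x : setT x -> (0 <= (EFin \o u) x)%E by move=> _; rewrite lee_fin.
have v02 x : setT x -> (0 <= (EFin \o v) x)%E by move=> _; rewrite lee_fin.
by rewrite -(ge0_integralD mu measurableT u02 mu2 v02 mv2).
Qed.

Lemma ge0_le_integral_EFin (u v : V -> R) : measurable_fun setT u -> measurable_fun setT v ->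
  (forall x, 0 <= u x) -> (forall x, u x <= v x) ->
  (\int[mu]_x (u x)%:E <= \int[mu]_x (v x)%:E)%E.
Proof.
move=> mu' mv u0 uv; apply: ge0_le_integral => //.
- by move=> x _; rewrite lee_fin.
- exact/measurable_EFinP.
- exact/measurable_EFinP.
- by move=> x _; rewrite lee_fin.
Qed.

(** By Plancherel m^2 is at most the integral of F^2. One factor F is cut at radius S into D1 + D2,
    the other is bounded by F1 + F2, the transforms of the inner and outer parts of f. The
    inner-inner term uses the sup of F1 and the L^1 norm of D1; the three others pair L^r with L^r'.
    Hausdorff-Young enters as a hypothesis with an explicit H, so that H is fixed before f. *)
Lemma split_bound f (r H m nu b T S : R) : bounded_integrable f ->
  continuous (@complex.Re R \o f : V -> R) -> continuous (@complex.Im R \o f : V -> R) ->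
  1 < r -> r < 2 -> 0 < H -> 0 < m -> 0 < nu -> 0 < b -> 0 < T -> 0 < S ->
  (forall g (c : R), bounded_integrable g -> 0 < c ->
    (\int[mu]_x (normc (g x) `^ r)%:E <= (c `^ r)%:E)%E ->
    (\int[mu]_xi (normc (fourier g xi) `^ (r / (r - 1)))%:E <=
      ((H * c) `^ (r / (r - 1)))%:E)%E) ->
  (\int[mu]_x (normc (f x) ^+ 2)%:E = (m ^+ 2)%:E)%E ->
  (\int[mu]_x ((\1_(~` eball T) x * normc (f x)) `^ r)%:E <= (nu `^ r)%:E)%E ->
  (\int[mu]_xi ((\1_(~` eball S) xi * normc (fourier f xi)) `^ r)%:E <= (b `^ r)%:E)%E ->
  m ^+ 2 <= m ^+ 2 * (4 * (T * S)) `^ (n%:R / 2)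
   + m * (2 * S) `^ (n%:R * (r^-1 - 2^-1)) * (H * nu)
   + b * (H * (m * (2 * T) `^ (n%:R * (r^-1 - 2^-1)))) + b * (H * nu).
Proof.
move=> bf cR cI r1 r2 H0 m0 nu0 b0 T0 S0 HY fm fnu fb.
have [mr mi _ _] := bf.
have r0 : 0 < r by exact: lt_trans r1.
have r10 : 0 < r - 1 by rewrite subr_gt0.
have rr : r^-1 + (r / (r - 1))^-1 = 1 by field; rewrite !gt_eqF.
have rp0 : 0 < r / (r - 1) by rewrite divr_gt0.
have mW : measurable_fun setT (fun x => normc (f x)) by exact: measurable_normc.
have mET := @measurable_eball R n T; have mDS := @measurable_eball R n S.
set g1 := cutoff (eball T) f; set g2 := cutoff (~` eball T) f.
have b1 : bounded_integrable g1 by exact: bounded_integrable_cutoff.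
have b2 : bounded_integrable g2 by apply: bounded_integrable_cutoff => //; exact: measurableC.
set F := fun xi => normc (fourier f xi).
set F1 := fun xi => normc (fourier g1 xi); set F2 := fun xi => normc (fourier g2 xi).
have mF : measurable_fun setT F := measurable_normc_fourier bf.
have mF1 : measurable_fun setT F1 := measurable_normc_fourier b1.
have mF2 : measurable_fun setT F2 := measurable_normc_fourier b2.
have F0 xi : 0 <= F xi by exact: normc_ge0.
have F10 xi : 0 <= F1 xi by exact: normc_ge0.
have F20 xi : 0 <= F2 xi by exact: normc_ge0.
have FF xi : F xi <= F1 xi + F2 xi.
  by rewrite /F (fourier_cutoffD xi mET bf); exact: le_normcD.
have Fm : (\int[mu]_xi (F xi ^+ 2)%:E <= (m ^+ 2)%:E)%E by rewrite -fm; exact: bessel.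
have mF' : ((m ^+ 2)%:E <= \int[mu]_xi (F xi ^+ 2)%:E)%E by rewrite -fm; exact: plancherel_ge.
set kap := n%:R * (r^-1 - 2^-1).
have T20 : 0 < 2 * T by rewrite mulr_gt0.
have S20 : 0 < 2 * S by rewrite mulr_gt0.
have nu1 : 0 < m * (2 * T) `^ kap by rewrite mulr_gt0 ?powR_gt0.
have f1r : (\int[mu]_x (normc (g1 x) `^ r)%:E <= ((m * (2 * T) `^ kap) `^ r)%:E)%E.
  under eq_integral do rewrite normc_cutoff.
  by apply: ball_bound; rewrite ?fm ?(ltW m0).
have f2r : (\int[mu]_x (normc (g2 x) `^ r)%:E <= (nu `^ r)%:E)%E.
  by under eq_integral do rewrite normc_cutoff.
have hF1 := HY _ _ b1 nu1 f1r; have hF2 := HY _ _ b2 nu0 f2r.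
pose D1 xi := \1_(eball S) xi * F xi; pose D2 xi := \1_(~` eball S) xi * F xi.
have mD1 : measurable_fun setT D1.
  by apply: measurable_funM => //; exact: measurable_indic.
have mD2 : measurable_fun setT D2.
  by apply: measurable_funM => //; apply: measurable_indic; exact: measurableC.
have D10 xi : 0 <= D1 xi by rewrite mulr_ge0.
have D20 xi : 0 <= D2 xi by rewrite mulr_ge0.
have D1r : (\int[mu]_xi (D1 xi `^ r)%:E <= ((m * (2 * S) `^ kap) `^ r)%:E)%E.
  by apply: ball_bound; rewrite ?(ltW m0).
have ball1 (W : V -> R) (U : R) : measurable_fun setT W -> (forall x, 0 <= W x) -> 0 < U ->
    (\int[mu]_x (W x ^+ 2)%:E <= (m ^+ 2)%:E)%E ->
    (\int[mu]_x (\1_(eball U) x * W x)%:E <= (m * (2 * U) `^ (n%:R / 2))%:E)%E.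
  move=> mW' W0 U0 Wm.
  have := @ball_bound R n 1 W m U ltr01 (ltr1n R 2) mW' W0 (ltW m0) U0 Wm.
  rewrite powRr1 ?mulr_ge0 ?powR_ge0 ?(ltW m0)//.
  have -> : n%:R * (1^-1 - 2^-1) = n%:R / 2 :> R by field.
  by under eq_integral do rewrite powRr1 ?mulr_ge0//.
have F1_le xi : F1 xi <= m * (2 * T) `^ (n%:R / 2).
  apply: le_trans (normc_fourier_le xi b1) _.
  have [_ _ i1 _] := b1.
  rewrite -lee_fin /Rintegral fineK ?(integrable_fin_num _ i1)//.
  under eq_integral do rewrite normc_cutoff.
  by apply: ball1; rewrite ?fm.
have D1_int : (\int[mu]_xi (D1 xi)%:E <= (m * (2 * S) `^ (n%:R / 2))%:E)%E by exact: ball1.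
(* The only pointwise inequality; its four terms are integrated separately as [J1] to [J4]. *)
have pw xi : F xi ^+ 2 <= m * (2 * T) `^ (n%:R / 2) * D1 xi + D1 xi * F2 xi + D2 xi * F1 xi + D2 xi * F2 xi.
  have -> : F xi ^+ 2 = D1 xi * F xi + D2 xi * F xi.
    rewrite /D1 /D2 -mulrDl -mulrDl !indicE in_setC.
    by case: (xi \in _); rewrite /= ?addr0 ?add0r mul1r expr2.
  have h1 : D1 xi * F xi <= m * (2 * T) `^ (n%:R / 2) * D1 xi + D1 xi * F2 xi.
    rewrite [X in _ <= X + _]mulrC -mulrDr ler_wpM2l//.
    by apply: le_trans (FF xi) _; rewrite lerD2r.
  have h2 : D2 xi * F xi <= D2 xi * F1 xi + D2 xi * F2 xi by rewrite -mulrDr ler_wpM2l.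
  by rewrite -[leRHS]addrA lerD.
have hp0 (c : R) : 0 < c -> 0 <= H * c by move=> c0; rewrite mulr_ge0// ltW.
have J2 : (\int[mu]_xi (D1 xi * F2 xi)%:E <= (m * (2 * S) `^ kap * (H * nu))%:E)%E.
  by apply: (holder_le mD1 mF2 D10 F20 r0 rp0 rr _ _ D1r hF2);
    rewrite ?hp0// mulr_ge0 ?powR_ge0 ?(ltW m0).
have J3 : (\int[mu]_xi (D2 xi * F1 xi)%:E <= (b * (H * (m * (2 * T) `^ kap)))%:E)%E.
  by apply: (holder_le mD2 mF1 D20 F10 r0 rp0 rr _ _ fb hF1); rewrite ?hp0 ?(ltW b0).
have J4 : (\int[mu]_xi (D2 xi * F2 xi)%:E <= (b * (H * nu))%:E)%E.
  by apply: (holder_le mD2 mF2 D20 F20 r0 rp0 rr _ _ fb hF2); rewrite ?hp0 ?(ltW b0).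
set c1 := m * (2 * T) `^ (n%:R / 2).
have c10 : 0 <= c1 by rewrite mulr_ge0 ?powR_ge0 ?(ltW m0).
have J1 : (\int[mu]_xi (c1 * D1 xi)%:E <= (c1 * (m * (2 * S) `^ (n%:R / 2)))%:E)%E.
  under eq_integral do rewrite EFinM.
  rewrite ge0_integralZl//; last 2 first.
  - exact/measurable_EFinP.
  - by move=> x _; rewrite lee_fin.
  by rewrite [leRHS]EFinM lee_wpmul2l.
have c1E : c1 * (m * (2 * S) `^ (n%:R / 2)) = m ^+ 2 * (4 * (T * S)) `^ (n%:R / 2).
  have -> : 4 * (T * S) = (2 * T) * (2 * S) by ring.
  rewrite /c1 (@powRM _ (2 * T) (2 * S)) ?(ltW T20) ?(ltW S20)//.
  by move: ((2 * T) `^ _) ((2 * S) `^ _) => P Q; ring.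
rewrite -c1E -lee_fin; apply: le_trans mF' _.
have mD12 : measurable_fun setT (fun xi => c1 * D1 xi) by exact: measurable_funM.
have m12 : measurable_fun setT (fun xi => D1 xi * F2 xi) by exact: measurable_funM.
have m21 : measurable_fun setT (fun xi => D2 xi * F1 xi) by exact: measurable_funM.
have m22 : measurable_fun setT (fun xi => D2 xi * F2 xi) by exact: measurable_funM.
have m2 := measurable_funD mD12 m12; have m3 := measurable_funD m2 m21.
have p12 xi : 0 <= D1 xi * F2 xi by exact: mulr_ge0.
have p21 xi : 0 <= D2 xi * F1 xi by exact: mulr_ge0.
have p22 xi : 0 <= D2 xi * F2 xi by exact: mulr_ge0.
have p1 xi : 0 <= c1 * D1 xi by exact: mulr_ge0.
have p2 xi : 0 <= c1 * D1 xi + D1 xi * F2 xi by exact: addr_ge0.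
have p3 xi : 0 <= c1 * D1 xi + D1 xi * F2 xi + D2 xi * F1 xi by exact: addr_ge0.
apply: le_trans (ge0_le_integral_EFin (measurable_funX 2 mF) (measurable_funD m3 m22)
  (fun xi => sqr_ge0 (F xi)) pw) _.
rewrite (ge0_integral_addEFin m3 m22 p3 p22) (ge0_integral_addEFin m2 m21 p2 p21).
rewrite (ge0_integral_addEFin mD12 m12 p1 p12) !EFinD.
exact: (leeD (leeD (leeD J1 J2) J3) J4).
Qed.

Lemma exists_exponent (p q s : R) : 1 < p -> 1 < q -> p^-1 < s -> q^-1 < s -> 2^-1 < s ->
  exists r, [/\ 1 < r, r < 2, r < p, r < q & r^-1 < s].
Proof.
move=> p1 q1 ps qs s2.
have p0 : 0 < p by exact: lt_trans p1.
have q0 : 0 < q by exact: lt_trans q1.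
have s0 : 0 < s by apply: lt_trans s2; rewrite invr_gt0.
have sV (x : R) : 0 < x -> x^-1 < s -> s^-1 < x by move=> x0; rewrite invf_plt.
set lo := Num.max 1 s^-1; set hi := Num.min p (Num.min q 2).
have lohi : lo < hi.
  by rewrite gt_max !lt_min !sV// p1 q1 ltr1n.
have [l1 l2] := midf_lt lohi.
have lo1 : 1 <= lo by rewrite le_max lexx.
have los : s^-1 <= lo by rewrite le_max lexx orbT.
have hi1 : hi <= p by rewrite ge_min lexx.
have hi2 : hi <= q by rewrite !ge_min lexx orbT.
have hi3 : hi <= 2 by rewrite !ge_min lexx !orbT.
exists ((lo + hi) / 2); split.
- exact: le_lt_trans l1.
- exact: lt_le_trans hi3.
- exact: lt_le_trans hi1.
- exact: lt_le_trans hi2.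
- have r0 : 0 < (lo + hi) / 2 by apply: lt_le_trans (ltW l1); exact: lt_le_trans lo1.
  by rewrite invf_plt//; exact: le_lt_trans l1.
Qed.

(** The cross term K1 m y is at most m^2 / 4 + K1^2 y^2, which leaves m^2 / 4 on the left. *)
Lemma absorb_quadratic (m y K1 K2 : R) :
  m ^+ 2 <= m ^+ 2 / 2 + K1 * m * y + K2 * y ^+ 2 ->
  m ^+ 2 <= (4 * (K1 ^+ 2 + K2)) * y ^+ 2.
Proof.
move=> h; have := sqr_ge0 (m / 2 - K1 * y).
have -> : (m / 2 - K1 * y) ^+ 2 = m ^+ 2 / 4 - K1 * m * y + K1 ^+ 2 * y ^+ 2 by field.
lra.
Qed.

(** The bounds A and B are required to be positive because T is built from their ratio; vanishing
    and infinite norms are dealt with in [sufficiency]. *)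
Theorem uncertainty_core (p q th ph : R) : (0 < n)%N -> 1 < p -> 1 < q -> 0 < th -> 0 < ph ->
  2^-1 < p^-1 + th / n%:R -> q^-1 + ph / n%:R = p^-1 + th / n%:R ->
  exists2 K : R, 0 < K & forall f (A B : R), bounded_integrable f ->
    continuous (@complex.Re R \o f : V -> R) -> continuous (@complex.Im R \o f : V -> R) ->
    0 < A -> 0 < B ->
    (\int[mu]_x ((euclid_norm x `^ th * normc (f x)) `^ p)%:E <= (A `^ p)%:E)%E ->
    (\int[mu]_xi ((euclid_norm xi `^ ph * normc (fourier f xi)) `^ q)%:E <= (B `^ q)%:E)%E ->
    (\int[mu]_x (normc (f x) ^+ 2)%:E <= (K * (A * B))%:E)%E.
Proof.
move=> n0 p1 q1 th0 ph0; set s := p^-1 + th / n%:R => s2 qs.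
have n0' : 0 < n%:R :> R by rewrite ltr0n.
have nn0 : n%:R != 0 :> R by rewrite gt_eqF.
have [r [r1 r2 rp rq rs]] : exists r, [/\ 1 < r, r < 2, r < p, r < q & r^-1 < s].
  apply: exists_exponent => //; first by rewrite /s ltrDl divr_gt0.
  by rewrite -qs ltrDl divr_gt0.
have r0 : 0 < r by exact: lt_trans r1.
have rs' : r^-1 < q^-1 + ph / n%:R by rewrite qs.
have [cA cA0 tA] := tail_bound n0 r0 rp th0 rs.
have [cB cB0 tB] := tail_bound n0 r0 rq ph0 rs'.
have [H H0 HY] := hausdorff_young_norm (n := n) r1 r2.
rewrite -/s in tA; rewrite qs -/s in tB.
set sig := n%:R * (s - r^-1) in tA tB *.
set kap := n%:R * (r^-1 - 2^-1).
have kap0 : 0 < kap.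
  by rewrite mulr_gt0// subr_gt0 ltf_pV2 ?posrE.
have sig0 : 0 < sig by rewrite mulr_gt0// subr_gt0.
(* Equal to n (s - 1/2): the tail exponent and the ball exponent add up to a quantity free of r. *)
set al := sig + kap; have al0 : 0 < al by rewrite addr_gt0.
(* The value of T S, chosen so that the inner-inner term of [split_bound] is exactly m^2 / 2. *)
pose de : R := 2^-1 `^ (2 / n%:R) / 4.
have de0 : 0 < de by rewrite divr_gt0// powR_gt0.
have deE : (4 * de) `^ (n%:R / 2) = 2^-1.
  have -> : 4 * de = 2^-1 `^ (2 / n%:R) by rewrite /de; field.
  rewrite -powRrM (_ : 2 / n%:R * (n%:R / 2) = 1) ?powRr1 ?invr_ge0//.
  by field; rewrite nn0.
move: de de0 deE => de de0 deE.
(* [K1] collects the two mixed terms, which are linear in m, and [K2] the outer-outer term. *)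
set K1 := H * 2 `^ kap * (de `^ kap * cA + cB * de `^ (- sig)).
set K2 := H * cA * cB * de `^ (- sig).
have K20 : 0 < K2 by rewrite !mulr_gt0 ?powR_gt0.
exists (4 * (K1 ^+ 2 + K2)) => [|f A B bf cR cI A0 B0 fA fB].
  by rewrite mulr_gt0// ltr_wpDl ?sqr_ge0.
have [mr mi _ _] := bf.
have i2 := integrable_bounded_sqr bf.
have ff : (\int[mu]_x (normc (f x) ^+ 2)%:E)%E \is a fin_num := integrable_fin_num measurableT i2.
set m2 := fine (\int[mu]_x (normc (f x) ^+ 2)%:E)%E.
have m20 : 0 <= m2 by rewrite fine_ge0// integral_ge0// => x _; rewrite lee_fin sqr_ge0.
set m := Num.sqrt m2.
have mE : m ^+ 2 = m2 by rewrite sqr_sqrtr.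
have fm : (\int[mu]_x (normc (f x) ^+ 2)%:E)%E = (m ^+ 2)%:E by rewrite mE fineK.
set y := Num.sqrt (A * B).
have AB0 : 0 < A * B by exact: mulr_gt0.
have y0 : 0 < y by rewrite sqrtr_gt0.
have y2 : y ^+ 2 = A * B by rewrite sqr_sqrtr// ltW.
rewrite fm lee_fin -y2.
have [m0|mpos] := leP m 0.
  have -> : m = 0 by apply/eqP; rewrite eq_le m0 sqrtr_ge0.
  rewrite expr0n/=; apply: mulr_ge0 (sqr_ge0 y); apply: mulr_ge0 => //.
  exact: addr_ge0 (sqr_ge0 K1) (ltW K20).
apply: absorb_quadratic.
(* With y^2 = A B this makes A T^(-al) and B T^al both equal to y, so the two mixed terms have the
   same size. *)
set T := (A / y) `^ al^-1.
have Ay0 : 0 < A / y by exact: divr_gt0.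
have T0 : 0 < T by exact: powR_gt0.
have Tal : T `^ al = A / y by rewrite /T -powRrM mulVf ?gt_eqF// powRr1// ltW.
have TalN : T `^ (- al) = y / A by rewrite powRN Tal invf_div.
set S := de / T; have S0 : 0 < S by exact: divr_gt0.
set nu := cA * A * T `^ (- sig); set b := cB * B * S `^ (- sig).
have nu0 : 0 < nu by rewrite !mulr_gt0 ?powR_gt0.
have b0 : 0 < b by rewrite !mulr_gt0 ?powR_gt0.
have fnu := tA _ A T (measurable_normc mr mi) (fun x => normc_ge0 _) A0 T0 fA.
have fb := tB _ B S (measurable_normc_fourier bf) (fun x => normc_ge0 _) B0 S0 fB.
have := split_bound bf cR cI r1 r2 H0 mpos nu0 b0 T0 S0 HY fm fnu fb.
have -> : T * S = de by rewrite /S mulrC divfK// gt_eqF.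
rewrite deE -/kap.
have SE (e : R) : S `^ e = de `^ e * T `^ (- e).
  by rewrite /S powRM ?invr_ge0 ?(ltW de0) ?(ltW T0)// powRN -[T^-1]powR_inv1 ?(ltW T0)// -powRrM mulN1r powRN.
have bE : b = cB * B * de `^ (- sig) * T `^ sig by rewrite /b SE opprK !mulrA.
have e1 : (2 * S) `^ kap * nu = 2 `^ kap * de `^ kap * cA * y.
  rewrite powRM ?(ltW S0)// SE /nu.
  have -> : 2 `^ kap * (de `^ kap * T `^ (- kap)) * (cA * A * T `^ (- sig)) =
     2 `^ kap * de `^ kap * cA * (A * (T `^ (- sig) * T `^ (- kap))).
    by move: (T `^ (- kap)) (T `^ (- sig)) (de `^ kap) (2 `^ kap) => u1 u2 u3 u4; ring.
  rewrite -powRD ?(gt_eqF T0) ?implybT// -opprD -/al TalN.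
  by rewrite (_ : A * (y / A) = y)// mulrC divfK// gt_eqF.
have e2 : b * (2 * T) `^ kap = 2 `^ kap * cB * de `^ (- sig) * y.
  rewrite powRM ?(ltW T0)// bE.
  have -> : cB * B * de `^ (- sig) * T `^ sig * (2 `^ kap * T `^ kap) =
     2 `^ kap * cB * de `^ (- sig) * (B * (T `^ sig * T `^ kap)).
    by move: (T `^ kap) (T `^ sig) (de `^ (- sig)) (2 `^ kap) => u1 u2 u3 u4; ring.
  rewrite -powRD ?(gt_eqF T0) ?implybT// -/al Tal.
  by rewrite (_ : B * (A / y) = y)// mulrA (mulrC B) -y2 expr2 mulfK// gt_eqF.
have e3 : b * nu = cA * cB * de `^ (- sig) * y ^+ 2.
  rewrite bE /nu y2.
  have -> : cB * B * de `^ (- sig) * T `^ sig * (cA * A * T `^ (- sig)) =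
     cA * cB * de `^ (- sig) * (A * B) * (T `^ sig * T `^ (- sig)).
    by move: (T `^ (- sig)) (T `^ sig) (de `^ (- sig)) => u1 u2 u3; ring.
  by rewrite -powRD ?subrr ?powRr0 ?mulr1// (gt_eqF T0) implybT.
have -> : m * (2 * S) `^ kap * (H * nu) = m * H * ((2 * S) `^ kap * nu).
  by move: (_ `^ _) => u; ring.
have -> : b * (H * (m * (2 * T) `^ kap)) = m * H * (b * (2 * T) `^ kap).
  by move: (_ `^ _) => u; ring.
have -> : b * (H * nu) = H * (b * nu) by ring.
rewrite e1 e2 e3 => h; apply: le_trans h _.
apply: eqW; rewrite /K1 /K2.
move: (2 `^ kap) (de `^ kap) (de `^ (- sig)) => u1 u2 u3; ring.
Qed.

End uncertainty_core.

(** * Schwartz functions, extended-real norms and degenerate cases *)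

Section sufficiency.
Context {R : realType} {n : nat}.
Local Notation V := 'rV[R]_n.
Local Notation mu := (@lebesgue_rV R n).
Local Notation leb := (@lebesgue_measure R).
Local Notation normc := (@Normc.normc R).
Implicit Types (f g : V -> R[i]).

Lemma schwartz_continuous f : schwartz f ->
  continuous (@complex.Re R \o f : V -> R) /\ continuous (@complex.Im R \o f : V -> R).
Proof. by case=> /(_ [::])[]. Qed.

(** Expanding the product over subsets J of the coordinates gives the monomials with exponent 2 on J
    and 0 elsewhere, each controlled by one Schwartz seminorm of order zero. *)
Lemma schwartz_decay f : schwartz f ->
  exists C : R, forall x : V, normc (f x) * \prod_i (1 + x ord0 i ^+ 2) <= C.
Proof.
move=> [_ /(_ _ [::]) df].
have /choice[M HM] : forall J : {set 'I_n}, exists M : R, forall x : V,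
    `|\prod_(i < n) x ord0 i ^+ (if i \in J then 2 else 0)| * normc (f x) <= M.
  by move=> J; exact: df (fun i => if i \in J then 2 else 0)%N.
exists (\sum_(J : {set 'I_n}) M J) => x.
under eq_bigr do rewrite addrC.
rewrite bigA_distr mulr_sumr; apply: ler_sum => J _.
apply: le_trans (HM J x); rewrite mulrC ler_wpM2r//.
apply: le_trans (ler_norm _); apply: eqW.
by apply: eq_bigr => i _; case: ifP.
Qed.

Lemma integrable_prod_powR (e : R) : 1 < e ->
  mu.-integrable setT (EFin \o (fun x : V => \prod_i (1 + `|x ord0 i|) `^ (- e))).
Proof.
move=> e1; have mh : measurable_fun setT (fun t : R => (1 + `|t|) `^ (- e)).
  by apply: measurable_powR_fun; apply: measurable_funD => //; exact: measurable_normr.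
have p0 (x : V) : 0 <= \prod_i (1 + `|x ord0 i|) `^ (- e).
  by apply: prodr_ge0 => i _; exact: powR_ge0.
apply/integrableP; split.
  apply/measurable_EFinP.
  by apply: (@measurable_prod_coord R n (fun=> fun t : R => (1 + `|t|) `^ (- e))).
under eq_integral do rewrite /= ger0_norm//.
rewrite (ge0_integral_prod (g := fun=> fun t : R => (1 + `|t|) `^ (- e)))//.
rewrite (eq_bigr (fun=> (2 * (1 `^ (1 - e) / (e - 1)))%:E)); last first.
  by move=> i _; rewrite integral_shift_powR.
by rewrite -(big_morph EFin (@EFinM R) erefl) ltry.
Qed.

Lemma schwartz_bounded_integrable f : schwartz f -> bounded_integrable f.
Proof.
move=> sf; have [cR cI] := schwartz_continuous sf.
have mR : measurable_fun setT (@complex.Re R \o f) by exact: continuous_measurable_rV.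
have mI : measurable_fun setT (@complex.Im R \o f) by exact: continuous_measurable_rV.
have [C HC] := schwartz_decay sf.
split => //.
(* The factor 2^n comes from (1 + |t|)^2 <= 2 (1 + t^2) in each coordinate. *)
- apply: (@integrable_le _ _ _ mu _ (fun x : V => C * 2 ^+ n * \prod_i (1 + `|x ord0 i|) `^ (- 2))).
  + exact: measurable_normc.
  + move=> x; rewrite /= ger0_norm//.
    have P0 : 0 < \prod_i (1 + x ord0 i ^+ 2).
      by apply: prodr_gt0 => i _; rewrite ltr_pwDl// sqr_ge0.
    have C0 : 0 <= C by apply: le_trans (HC x); rewrite mulr_ge0// ltW.
    apply: (@le_trans _ _ (C * (\prod_i (1 + x ord0 i ^+ 2))^-1)).
      by rewrite ler_pdivlMr.
    rewrite -mulrA ler_wpM2l// -prodfV.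
    rewrite -[X in _ ^+ X]card_ord -prodr_const -big_split/=.
    apply: ler_prod => i _; rewrite invr_ge0 addr_ge0 ?sqr_ge0//=.
    rewrite powRN powR_mulrn ?addr_ge0//.
    have t0 : 0 < 1 + `|x ord0 i| by rewrite ltr_pwDl.
    rewrite -[leRHS]invf_div lef_pV2 ?posrE ?divr_gt0 ?exprn_gt0//; last by rewrite ltr_pwDl// sqr_ge0.
    rewrite ler_pdivrMr//.
    have := sqr_ge0 (1 - `|x ord0 i|); rewrite -[x ord0 i ^+ 2]real_normK ?num_real//.
    by move: (`|x ord0 i|) => t; rewrite !expr2; lra.
  + by apply: integrable_scalel; apply: integrable_prod_powR; rewrite ltr1n.
- exists C => x; apply: le_trans (HC x); rewrite ler_peMr//.
  apply: (big_ind (fun z : R => 1 <= z)) => // [y z y1 z1|i _].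
    exact: mulr_ege1.
  by rewrite lerDl sqr_ge0.
Qed.

Lemma normc_weighted (th : R) f x : normc (weighted th f x) = euclid_norm x `^ th * normc (f x).
Proof. by rewrite Normc.normcM normc_real ger0_norm// powR_ge0. Qed.

Lemma Lp_norm_poweR (p : R) f : 0 < p ->
  (Lp_norm p f `^ p)%E = (\int[mu]_x (normc (f x) `^ p)%:E)%E.
Proof.
move=> p0; rewrite /Lp_norm poweR_Lnorm ?gt_eqF//; apply: eq_integral => x _ /=.
by rewrite ger0_norm.
Qed.

Lemma Lp_norm2 f : bounded_integrable f ->
  (Lp_norm 2 f ^+ 2)%E = (\int[mu]_x (normc (f x) ^+ 2)%:E)%E.
Proof.
move=> bf; have ff := integrable_fin_num measurableT (integrable_bounded_sqr bf).
rewrite /Lp_norm unlock.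
have -> : (\int[mu]_x (`|(EFin \o (normc \o f)) x| `^ 2) =
    (fine (\int[mu]_x (normc (f x) ^+ 2)%:E))%:E)%E.
  rewrite fineK//; apply: eq_integral => x _ /=.
  by rewrite ger0_norm// powR_mulrn.
rewrite poweR_EFin powR12_sqrt; last first.
  by rewrite fine_ge0// integral_ge0// => x _; rewrite lee_fin sqr_ge0.
rewrite -EFin_expe sqr_sqrtr ?fineK//.
by rewrite fine_ge0// integral_ge0// => x _; rewrite lee_fin sqr_ge0.
Qed.

Lemma rV_set0E : [set 0] = [set x : V | forall i : 'I_n, [set (0 : R)] (x ord0 i)].
Proof.
apply/seteqP; split => [x /= -> i|x /= h]; first by rewrite mxE.
by apply/rowP => i; rewrite mxE h.
Qed.

Lemma measurable_rV_set0 : measurable [set (0 : V)].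
Proof.
rewrite rV_set0E.
rewrite (_ : [set _ | _] = \bigcap_(i in [set: 'I_n]) ((fun x : V => x ord0 i) @^-1` [set 0])).
  apply: fin_bigcap_measurable => // i _; rewrite -[X in measurable X]setTI.
  by apply: measurable_coord.
by apply/seteqP; split => x /= h i; [move=> _|]; exact: h.
Qed.

(** Here the dimension must be positive: in dimension 0 the measure is the Dirac mass at this
    point. *)
Lemma lebesgue_rV_set0 : (0 < n)%N -> mu [set 0] = 0%E.
Proof.
move=> n0; rewrite rV_set0E.
rewrite (lebesgue_rV_box (A := fun=> [set 0]))//.
rewrite (bigD1 (Ordinal n0))//=.
by rewrite lebesgue_measure_set1 mul0e.
Qed.

(** The weight can vanish only at the origin, a null set, so f is zero almost everywhere. *)
Lemma Lp_norm_weighted_eq0 (p th : R) f : (0 < n)%N -> 0 < p ->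
  measurable_fun setT (fun x => normc (f x)) -> Lp_norm p (weighted th f) = 0%E ->
  (\int[mu]_x (normc (f x) ^+ 2)%:E)%E = 0%E.
Proof.
move=> n0 p0 mf; rewrite /Lp_norm => h.
have mw : measurable_fun setT (fun x => euclid_norm x `^ th * normc (f x)).
  by apply: measurable_funM => //; apply: measurable_powR_fun; exact: measurable_euclid_norm.
have wE : (normc \o weighted th f) = (fun x => euclid_norm x `^ th * normc (f x)).
  by apply/funext => x; rewrite /= normc_weighted.
rewrite wE in h.
have p0E : (0 < p%:E)%E by rewrite lte_fin.
have := Lnorm_eq0_eq0 (proj2 (measurable_EFinP _ _) mw) p0E h.
rewrite -(integral0 mu setT) => ae0; apply: ae_eq_integral => //.
  by apply/measurable_EFinP; exact: measurable_funX.
have n0x : \forall x \ae mu, x != 0.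
  exists [set 0]; split; [exact: measurable_rV_set0|exact: lebesgue_rV_set0|].
  by move=> x /= /negP; rewrite negbK => /eqP.
apply: filterS2 n0x ae0 => x xn0 /(_ I) /= [] /eqP; rewrite mulf_eq0 => /orP[|/eqP -> _].
  move=> /eqP/powR_eq0_eq0 x0; case/eqP: xn0; apply/rowP => i; rewrite mxE.
  by apply/normr0_eq0/eqP; rewrite eq_le normr_ge0 andbT -x0 coord_le_euclid_norm.
by rewrite expr0n.
Qed.

Theorem sufficiency (p q th ph : R) : (0 < n)%N -> 1 < p -> 1 < q -> 0 < th -> 0 < ph ->
  1 / 2 - 1 / p < th / n%:R -> 1 / q + ph / n%:R = 1 / p + th / n%:R ->
  exists C : R, 0 < C /\ forall f, schwartz f ->
    (C%:E * Lp_norm 2 f ^+ 2 <=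
      Lp_norm p (weighted th f) * Lp_norm q (weighted ph (fourier f)))%E.
Proof.
move=> n0 p1 q1 th0 ph0; rewrite !div1r => h1 h2.
have p0 : 0 < p by exact: lt_trans p1.
have q0 : 0 < q by exact: lt_trans q1.
have s2 : 2^-1 < p^-1 + th / n%:R by rewrite addrC -ltrBlDr.
have [K K0 HK] := uncertainty_core n0 p1 q1 th0 ph0 s2 h2.
exists K^-1; split; first by rewrite invr_gt0.
move=> f sf; have bf := schwartz_bounded_integrable sf.
have [cR cI] := schwartz_continuous sf.
have [mr mi _ _] := bf.
set X := Lp_norm p _; set Y := Lp_norm q _.
have X0 : (0 <= X)%E by exact: Lnorm_ge0.
have Y0 : (0 <= Y)%E by exact: Lnorm_ge0.
rewrite Lp_norm2//.
have XY0 : (0 <= X * Y)%E by exact: mule_ge0.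
(* Zero factors come before infinite ones, because 0 times +oo is 0 in the extended reals and the
   product then gives no trivial bound. *)
have [XE|Xn0] := eqVneq X 0%E.
  by rewrite (Lp_norm_weighted_eq0 n0 p0 (measurable_normc mr mi) XE) mule0.
(* A transform that vanishes almost everywhere forces ||f||_2 = 0 by Plancherel. *)
have [YE|Yn0] := eqVneq Y 0%E.
  have F0 := Lp_norm_weighted_eq0 n0 q0 (measurable_normc_fourier bf) YE.
  have := plancherel_ge bf cR cI; rewrite F0 => h.
  by apply: le_trans (lee_wpmul2l _ h) _; rewrite ?mule0// lee_fin invr_ge0 ltW.
have Xp : (0 < X)%E by rewrite lt_neqAle eq_sym Xn0.
have Yp : (0 < Y)%E by rewrite lt_neqAle eq_sym Yn0.
have [->|Xy] := eqVneq X +oo%E; first by rewrite gt0_mulye// leey.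
have [->|Yy] := eqVneq Y +oo%E; first by rewrite gt0_muley// leey.
have fX : X \is a fin_num by rewrite ge0_fin_numE// lt_neqAle Xy leey.
have fY : Y \is a fin_num by rewrite ge0_fin_numE// lt_neqAle Yy leey.
have A0 : 0 < fine X by rewrite fine_gt0// Xp lt_neqAle Xy leey.
have B0 : 0 < fine Y by rewrite fine_gt0// Yp lt_neqAle Yy leey.
have /(_ _ _) := HK f (fine X) (fine Y) bf cR cI A0 B0.
have hX : (\int[mu]_x ((euclid_norm x `^ th * normc (f x)) `^ p)%:E <= (fine X `^ p)%:E)%E.
  rewrite -poweR_EFin fineK// /X Lp_norm_poweR//.
  by under [leRHS]eq_integral do rewrite normc_weighted.
have hY : (\int[mu]_x ((euclid_norm x `^ ph * normc (fourier f x)) `^ q)%:E <= (fine Y `^ q)%:E)%E.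
  rewrite -poweR_EFin fineK// /Y Lp_norm_poweR//.
  by under [leRHS]eq_integral do rewrite normc_weighted.
move=> /(_ hX hY) h.
have K0' : (0 <= K^-1%:E)%E by rewrite lee_fin invr_ge0 ltW.
apply: le_trans (lee_wpmul2l K0' h) _.
by rewrite -EFinM mulKf ?gt_eqF// EFinM !fineK.
Qed.

End sufficiency.

(** * Gaussian Schwartz functions and chirps *)

Section gaussian_class.
Context {R : realType} {n : nat}.
Local Notation V := 'rV[R]_n.
Implicit Types (f g : V -> R) (x : V).

Definition sqnorm x : R := \sum_i x ord0 i ^+ 2.

(* Stable under partial derivatives, and all its members decay like Gaussians. *)
Inductive gaussian_class : (V -> R) -> Prop :=
| gaussian_class_cos a b : 0 < a ->
    gaussian_class (fun x => expR (- (a * sqnorm x)) * cos (b * sqnorm x))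
| gaussian_class_sin a b : 0 < a ->
    gaussian_class (fun x => expR (- (a * sqnorm x)) * sin (b * sqnorm x))
| gaussian_class_coord i f : gaussian_class f -> gaussian_class (fun x => x ord0 i * f x)
| gaussian_class_scale c f : gaussian_class f -> gaussian_class (fun x => c * f x)
| gaussian_class_add f g : gaussian_class f -> gaussian_class g ->
    gaussian_class (fun x => f x + g x).

(** Both derivatives are limits of the same difference quotient, so directional derivatives reduce
    to one-variable calculus. *)
Lemma is_derive_line f x (v : V) (d : R) :
  is_derive (0 : R) 1 (fun h : R => f (h *: v + x)) d -> is_derive x v f d.
Proof.
have E : (fun h : R => h^-1 *: ((f \o shift x) (h *: v) - f x)) =
    (fun h : R => h^-1 *: (((fun k : R => f (k *: v + x)) \o shift 0) (h *: (1 : R)) - f (0 *: v + x))).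
  apply/funext => h; have h1 : h *: (1 : R) = h by rewrite /GRing.scale/= mulr1.
  by rewrite /= addr0 scale0r add0r h1.
move=> [dh hd]; apply: DeriveDef; first by rewrite /derivable E.
by rewrite /derive E.
Qed.

Lemma sqnorm_line x (i : 'I_n) (h : R) :
  sqnorm (h *: delta_mx ord0 i + x) = sqnorm x + (2 * x ord0 i * h + h ^+ 2).
Proof.
rewrite /sqnorm (bigD1 i)//= [in RHS](bigD1 i)//= !mxE !eqxx/= mulr1.
rewrite (eq_bigr (fun j => x ord0 j ^+ 2)); first by ring.
by move=> j ji; rewrite !mxE (negbTE ji) andbF mulr0 add0r.
Qed.

(** The function c |x|^2 along the line through x in the i-th direction, with q = |x|^2 and r =
    x_i. *)
Let ph (c q r : R) (h : R) : R := c * (q + (2 * r * h + h ^+ 2)).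

Let dph (c q r : R) : is_derive (0 : R) 1 (ph c q r) (c * (2 * r)).
Proof. by apply: is_derive_eq; rewrite /GRing.scale/=; ring. Qed.

Let ph0 (c q r : R) : ph c q r 0 = c * q.
Proof. by rewrite /ph; ring. Qed.

Lemma is_derive_gauss_cos a b x (i : 'I_n) :
  is_derive x (delta_mx ord0 i) (fun x => expR (- (a * sqnorm x)) * cos (b * sqnorm x))
   (- (2 * a) * (x ord0 i * (expR (- (a * sqnorm x)) * cos (b * sqnorm x))) +
    - (2 * b) * (x ord0 i * (expR (- (a * sqnorm x)) * sin (b * sqnorm x)))).
Proof.
apply: is_derive_line.
have -> : (fun h : R => expR (- (a * sqnorm (h *: delta_mx ord0 i + x))) *
    cos (b * sqnorm (h *: delta_mx ord0 i + x))) =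
    (expR \o ph (- a) (sqnorm x) (x ord0 i)) * (cos \o ph b (sqnorm x) (x ord0 i)).
  by apply/funext => h; rewrite sqnorm_line -mulNr.
have d1 := dph (- a) (sqnorm x) (x ord0 i); have d2 := dph b (sqnorm x) (x ord0 i).
apply: is_derive_eq; rewrite /GRing.scale/= !ph0 mulNr.
by move: (expR _) (cos _) (sin _) => u1 u2 u3; ring.
Qed.

Lemma is_derive_gauss_sin a b x (i : 'I_n) :
  is_derive x (delta_mx ord0 i) (fun x => expR (- (a * sqnorm x)) * sin (b * sqnorm x))
   (- (2 * a) * (x ord0 i * (expR (- (a * sqnorm x)) * sin (b * sqnorm x))) +
    (2 * b) * (x ord0 i * (expR (- (a * sqnorm x)) * cos (b * sqnorm x)))).
Proof.
apply: is_derive_line.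
have -> : (fun h : R => expR (- (a * sqnorm (h *: delta_mx ord0 i + x))) *
    sin (b * sqnorm (h *: delta_mx ord0 i + x))) =
    (expR \o ph (- a) (sqnorm x) (x ord0 i)) * (sin \o ph b (sqnorm x) (x ord0 i)).
  by apply/funext => h; rewrite sqnorm_line -mulNr.
have d1 := dph (- a) (sqnorm x) (x ord0 i); have d2 := dph b (sqnorm x) (x ord0 i).
apply: is_derive_eq; rewrite /GRing.scale/= !ph0 mulNr.
by move: (expR _) (cos _) (sin _) => u1 u2 u3; ring.
Qed.

Lemma is_derive_coord x (i j : 'I_n) :
  is_derive x (delta_mx ord0 i) (fun y : V => y ord0 j) (i == j)%:R.
Proof.
apply: is_derive_line.
have -> : (fun h : R => (h *: delta_mx ord0 i + x : V) ord0 j) =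
    (fun h : R => (i == j)%:R * h + x ord0 j).
  by apply/funext => h; rewrite !mxE eqxx/= mulrC eq_sym.
by apply: is_derive_eq; rewrite /GRing.scale/=; ring.
Qed.

Lemma gaussian_class_derive f : gaussian_class f -> forall i : 'I_n,
  exists g, gaussian_class g /\ forall x, is_derive x (delta_mx ord0 i) f (g x).
Proof.
elim=> [a b a0 i|a b a0 i|j {}f Gf IH i|c {}f Gf IH i|{}f g Gf IHf Gg IHg i].
- eexists; split; last by move=> x; exact: is_derive_gauss_cos.
  by apply: gaussian_class_add; apply/gaussian_class_scale/gaussian_class_coord;
    [exact: gaussian_class_cos|exact: gaussian_class_sin].
- eexists; split; last by move=> x; exact: is_derive_gauss_sin.
  by apply: gaussian_class_add; apply/gaussian_class_scale/gaussian_class_coord;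
    [exact: gaussian_class_sin|exact: gaussian_class_cos].
- have [g [Gg dg]] := IH i.
  exists (fun x => x ord0 j * g x + (i == j)%:R * f x); split.
    by apply: gaussian_class_add; [exact: gaussian_class_coord|exact: gaussian_class_scale].
  move=> x; have d1 := is_derive_coord x i j; have d2 := dg x.
  have -> : (fun x => x ord0 j * f x) = (fun y : V => y ord0 j) * f by [].
  by apply: is_derive_eq; rewrite /GRing.scale/= [f x * _]mulrC.
- have [g [Gg dg]] := IH i; exists (fun x => c * g x); split; first exact: gaussian_class_scale.
  move=> x; have d2 := dg x.
  have -> : (fun x => c * f x) = cst c * f by [].
  by apply: is_derive_eq; rewrite /GRing.scale/= mulr0 addr0.
have [f' [Gf' df]] := IHf i; have [g' [Gg' dg]] := IHg i.
exists (fun x => f' x + g' x); split; first exact: gaussian_class_add.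
by move=> x; have d1 := df x; have d2 := dg x; exact: is_deriveD.
Qed.

Lemma continuous_sqnorm : continuous sqnorm.
Proof.
have cs (l : seq 'I_n) : continuous (fun x : V => \sum_(i <- l) x ord0 i ^+ 2 : R).
  elim: l => [|i l IH].
    rewrite (_ : (fun x : V => _) = cst 0); first exact: cst_continuous.
    by apply/funext => y; rewrite big_nil.
  rewrite (_ : (fun x : V => _) = (fun y : V => y ord0 i * y ord0 i + \sum_(i <- l) y ord0 i ^+ 2)).
    by move=> x; apply: cvgD (IH x); apply: cvgM; exact: coord_continuous.
  by apply/funext => y; rewrite big_cons expr2.
exact: cs.
Qed.

Lemma gaussian_class_continuous f : gaussian_class f -> continuous f.
Proof.
have cq (h : R -> R) (c : R) : continuous h -> continuous (fun x => h (c * sqnorm x)).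
  move=> ch x; apply: (@continuous_comp _ _ _ (fun x => c * sqnorm x) h); last exact: ch.
  by apply: continuousM; [exact: cst_continuous|exact: continuous_sqnorm].
have ce (c : R) : continuous (fun x => expR (- (c * sqnorm x))).
  rewrite (_ : (fun x => _) = (fun x => expR (- c * sqnorm x))); last by apply/funext => x; rewrite mulNr.
  by apply: cq; exact: continuous_expR.
have cc i : continuous (fun x : V => x ord0 i) by exact: coord_continuous.
have M (h k : V -> R) : continuous h -> continuous k -> continuous (fun x => h x * k x).
  by move=> ch ck x; exact: (@cvgM _ _ _ _ h k _ _ (ch x) (ck x)).
elim=> [a b a0|a b a0|i {}f Gf IH|c {}f Gf IH|{}f g Gf IHf Gg IHg].
- by apply: (M (fun x => expR (- (a * sqnorm x)))); [exact: ce|apply: (cq cos); exact: continuous_cos].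
- by apply: (M (fun x => expR (- (a * sqnorm x)))); [exact: ce|apply: (cq sin); exact: continuous_sin].
- exact: M.
- by apply: (M (cst c)) => //; exact: cst_continuous.
- by move=> x; exact: (@cvgD _ _ _ _ _ f g _ _ (IHf x) (IHg x)).
Qed.

Lemma sqnorm_ge0 x : 0 <= sqnorm x.
Proof. by apply: sumr_ge0 => i _; exact: sqr_ge0. Qed.

(** The rate is not uniform over the class: each factor x_i costs half of the exponent, as in
    [norm_mul_gauss], and a sum keeps the smaller of the two rates. *)
Lemma gaussian_class_decay f : gaussian_class f ->
  exists a C : R, [/\ 0 < a, 0 <= C & forall x, `|f x| <= C * expR (- (a * sqnorm x))].
Proof.
elim=> [a b a0|a b a0|i {}f Gf [a [C [a0 C0 fC]]]|c {}f Gf [a [C [a0 C0 fC]]]|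
    {}f g Gf [a [C [a0 C0 fC]]] Gg [b [D [b0 D0 gD]]]].
- exists a, 1; split=> // x; rewrite normrM mul1r (ger0_norm (expR_ge0 _)).
  by rewrite ler_piMr ?expR_ge0// ler_norml cos_geN1 cos_le1.
- exists a, 1; split=> // x; rewrite normrM mul1r (ger0_norm (expR_ge0 _)).
  by rewrite ler_piMr ?expR_ge0// ler_norml sin_geN1 sin_le1.
- exists (a / 2), ((1 + a^-1) * C); split.
  + by rewrite divr_gt0.
  + by rewrite mulr_ge0// addr_ge0// invr_ge0 ltW.
  move=> x; rewrite normrM.
  have h : `|x ord0 i| <= (1 + a^-1) * expR (a / 2 * sqnorm x).
    have := norm_mul_gauss (x ord0 i) a0; rewrite /gauss.
    rewrite -(ler_pM2r (expR_gt0 (a * x ord0 i ^+ 2))) -!mulrA -!expRD addNr expR0 mulr1 => h.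
    apply: le_trans h _; rewrite ler_wpM2l ?addr_ge0 ?invr_ge0 ?(ltW a0)//.
    rewrite [in X in _ <= expR X]mulrA ler_expR (_ : _ + _ = a / 2 * x ord0 i ^+ 2); last by field.
    rewrite ler_wpM2l ?divr_ge0 ?(ltW a0)// /sqnorm (bigD1 i)//= lerDl.
    by apply: sumr_ge0 => j _; exact: sqr_ge0.
  apply: le_trans (ler_pM _ _ h (fC x)) _ => //.
  have -> : expR (- (a / 2 * sqnorm x)) = expR (a / 2 * sqnorm x) * expR (- (a * sqnorm x)).
    by rewrite -expRD; congr expR; field.
  by apply: eqW; ring.
- exists a, (`|c| * C); split=> [//||x]; first exact: mulr_ge0.
  by rewrite normrM -mulrA ler_wpM2l.
exists (Num.min a b), (C + D); split; [by rewrite lt_min a0 b0|exact: addr_ge0|move=> x].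
apply: le_trans (ler_normD _ _) _; rewrite mulrDl; apply: lerD.
  apply: le_trans (fC x) _; rewrite ler_wpM2l// ler_expR lerN2 ler_wpM2r ?sqnorm_ge0//.
  by rewrite ge_min lexx.
apply: le_trans (gD x) _; rewrite ler_wpM2l// ler_expR lerN2 ler_wpM2r ?sqnorm_ge0//.
by rewrite ge_min lexx orbT.
Qed.

Lemma power_gauss_bounded (k : nat) (a : R) : 0 < a ->
  exists M : R, forall t, `|t| ^+ k * gauss a t <= M.
Proof.
elim: k a => [|k IH] a a0.
  exists 1 => t; rewrite expr0 mul1r /gauss -expR0 ler_expR oppr_le0.
  by rewrite mulr_ge0 ?sqr_ge0// ltW.
have [M HM] := IH (a / 2) (divr_gt0 a0 (ltr0n R 2)).
exists ((1 + a^-1) * M) => t; rewrite exprSr -mulrA.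
apply: le_trans (ler_wpM2l _ (norm_mul_gauss t a0)) _; first exact: exprn_ge0.
rewrite mulrCA ler_wpM2l//.
by rewrite addr_ge0// invr_ge0 ltW.
Qed.

Lemma gaussian_class_monomial f (k : 'I_n -> nat) : gaussian_class f ->
  exists M : R, forall x, `|\prod_(i < n) x ord0 i ^+ k i| * `|f x| <= M.
Proof.
move=> /gaussian_class_decay[a [C [a0 C0 fC]]].
have /choice[M HM] := fun i => power_gauss_bounded (k i) a0.
exists (C * \prod_i M i) => x.
apply: le_trans (ler_wpM2l _ (fC x)) _ => //.
rewrite mulrCA ler_wpM2l// -gaussVE /gaussV normr_prod -big_split/=.
apply: ler_prod => i _; rewrite mulr_ge0 ?gauss_ge0//=.
by rewrite normrX.
Qed.

Lemma gaussian_class_schwartz (f : V -> R[i]) :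
  gaussian_class (@complex.Re R \o f) -> gaussian_class (@complex.Im R \o f) -> schwartz f.
Proof.
move=> GR GI.
have Gp (s : seq 'I_n) : gaussian_class (@complex.Re R \o partials s f) /\
    gaussian_class (@complex.Im R \o partials s f).
  elim: s => [//|i s [IHR IHI]].
  have [gR [GgR dR]] := gaussian_class_derive IHR i.
  have [gI [GgI dI]] := gaussian_class_derive IHI i.
  split.
    rewrite (_ : _ \o _ = gR)//; apply/funext => x; by case: (dR x).
  rewrite (_ : _ \o _ = gI)//; apply/funext => x; by case: (dI x).
split=> [s|k s].
  have [GRs GIs] := Gp s.
  split; [exact: gaussian_class_continuous|exact: gaussian_class_continuous|].
  move=> i x.
  have [gR [_ dR]] := gaussian_class_derive GRs i.
  have [gI [_ dI]] := gaussian_class_derive GIs i.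
  by split; [have [] := dR x|have [] := dI x].
have [GRs GIs] := Gp s.
have [M1 H1] := gaussian_class_monomial k GRs.
have [M2 H2] := gaussian_class_monomial k GIs.
exists (M1 + M2) => x; apply: le_trans (lerD (H1 x) (H2 x)).
by rewrite -mulrDr ler_wpM2l// ler_normc_ReIm.
Qed.

End gaussian_class.

(** * Transforms of chirps and of sums of chirps *)

Section chirp.
Context {R : realType} {n : nat}.
Local Notation V := 'rV[R]_n.
Local Notation mu := (@lebesgue_rV R n).
Local Notation leb := (@lebesgue_measure R).
Local Notation Re := (@complex.Re R).
Local Notation Im := (@complex.Im R).
Local Notation normc := (@Normc.normc R).
Implicit Types (g h : V -> R[i]) (a b c : R) (x xi : V).

Definition gchirp a b x : R[i] := (gaussV a x)%:C%C * cexpi (b * sqnorm x).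

(** One phase is common to all the terms, so for nonnegative c the modulus is exactly the sum of the
    Gaussians. *)
Definition gchirp_sum (J : nat) (c a : nat -> R) b x : R[i] :=
  (\sum_(j < J) c j * gaussV (a j) x)%:C%C * cexpi (b * sqnorm x).

Lemma gchirp_schwartz a b : 0 < a -> schwartz (gchirp a b).
Proof.
move=> a0; apply: gaussian_class_schwartz.
  rewrite (_ : _ \o _ = (fun x => expR (- (a * sqnorm x)) * cos (b * sqnorm x))).
    exact: gaussian_class_cos.
  by apply/funext => x; rewrite -gaussVE; exact: Re_realc.
rewrite (_ : _ \o _ = (fun x => expR (- (a * sqnorm x)) * sin (b * sqnorm x))).
  exact: gaussian_class_sin.
by apply/funext => x; rewrite -gaussVE; exact: Im_realc.
Qed.

Lemma gchirp_sumS J (c a : nat -> R) b x :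
  gchirp_sum J.+1 c a b x = gchirp_sum J c a b x + (c J)%:C%C * gchirp (a J) b x.
Proof. by rewrite /gchirp_sum big_ord_recr/= rmorphD rmorphM/= mulrDl mulrA. Qed.

Lemma gchirp_sum_schwartz J (c a : nat -> R) b : (forall j, 0 < a j) ->
  schwartz (gchirp_sum J c a b).
Proof.
move=> a0.
have sum0 x : gchirp_sum 0 c a b x = 0 by rewrite /gchirp_sum big_ord0 rmorph0 mul0r.
apply: gaussian_class_schwartz; elim: J => [|J IH].
- rewrite (_ : _ \o _ = (fun x => 0 * (expR (- (a 0%N * sqnorm x)) * cos (b * sqnorm x)))).
    by apply: gaussian_class_scale; exact: gaussian_class_cos.
  by apply/funext => x; rewrite [LHS]/comp sum0 mul0r.
- rewrite (_ : _ \o _ = (fun x => (Re \o gchirp_sum J c a b) x +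
      c J * (expR (- (a J * sqnorm x)) * cos (b * sqnorm x)))).
    by apply: gaussian_class_add => //; apply: gaussian_class_scale; exact: gaussian_class_cos.
  apply/funext => x; rewrite -gaussVE /comp /gchirp_sum !Re_realc big_ord_recr/=.
  by rewrite mulrDl !mulrA.
- rewrite (_ : _ \o _ = (fun x => 0 * (expR (- (a 0%N * sqnorm x)) * sin (b * sqnorm x)))).
    by apply: gaussian_class_scale; exact: gaussian_class_sin.
  by apply/funext => x; rewrite [LHS]/comp sum0 mul0r.
rewrite (_ : _ \o _ = (fun x => (Im \o gchirp_sum J c a b) x +
    c J * (expR (- (a J * sqnorm x)) * sin (b * sqnorm x)))).
  by apply: gaussian_class_add => //; apply: gaussian_class_scale; exact: gaussian_class_sin.
apply/funext => x; rewrite -gaussVE /comp /gchirp_sum !Im_realc big_ord_recr/=.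
by rewrite mulrDl !mulrA.
Qed.

Lemma normc_fourier_gchirp_sum J (c a : nat -> R) b xi :
  (forall j, 0 < a j) -> (forall j, 0 <= c j) ->
  normc (fourier (gchirp_sum J c a b) xi) <=
    \sum_(j < J) c j * normc (fourier (gchirp (a j) b) xi).
Proof.
move=> a0 c0; elim: J => [|J IH].
  rewrite big_ord0 /fourier (_ : (fun x => _) = (fun x => 0)).
    by rewrite /cintegral !Rintegral_cst//= mul0r expr0n/= addr0 sqrtr0.
  by apply/funext => x; rewrite /gchirp_sum big_ord0 rmorph0 !mul0r.
have -> : gchirp_sum J.+1 c a b = fun x => gchirp_sum J c a b x + (c J)%:C%C * gchirp (a J) b x.
  by apply/funext => x; rewrite gchirp_sumS.
rewrite fourierDZ.
- apply: le_trans (le_normcD _ _) _; rewrite Normc.normcM normc_real ger0_norm//.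
  by rewrite big_ord_recr; exact: lerD IH (lexx _).
- exact/schwartz_bounded_integrable/gchirp_sum_schwartz.
- exact/schwartz_bounded_integrable/gchirp_schwartz.
Qed.

(** The square root of [chirp_fourier_sqr] at w = 2 pi xi_i, multiplied over the coordinates. The
    modulus at frequency 0 stays unevaluated; [chirp_fourier0_le] bounds it. *)
Lemma normc_fourier_gchirp a b xi : 0 < a ->
  normc (fourier (gchirp a b) xi) =
  Num.sqrt (chirp_cos a b 0 ^+ 2 + chirp_sin a b 0 ^+ 2) ^+ n *
  gaussV (pi ^+ 2 * a / (a ^+ 2 + b ^+ 2)) xi.
Proof.
move=> a0.
pose G (i : 'I_n) (s : R) : R[i] :=
  (gauss a s)%:C%C * cexpi (b * s ^+ 2 - (2 * pi * xi ord0 i) * s).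
have GE x : \prod_i G i (x ord0 i) = gchirp a b x * cexpi (- (2 * pi * dotprod x xi)).
  rewrite big_split/= -rmorph_prod/= /gchirp -mulrA -cexpiD; congr (_ * _).
  rewrite -cexpi_sum; congr cexpi; rewrite /sqnorm /dotprod !mulr_sumr -sumrN -big_split/=.
  by apply: eq_bigr => i _; congr (_ - _); ring.
have iG i : cintegrable leb (G i) by exact: cintegrable_chirp.
have cG i : normc (cint leb (G i)) = Num.sqrt (chirp_cos a b 0 ^+ 2 + chirp_sin a b 0 ^+ 2) *
    gauss (pi ^+ 2 * a / (a ^+ 2 + b ^+ 2)) (xi ord0 i).
  have -> : cint leb (G i) = (chirp_cos a b (2 * pi * xi ord0 i) +i* chirp_sin a b (2 * pi * xi ord0 i))%C.
    by apply/eqP; rewrite eq_complex; apply/andP; split; apply/eqP; apply: eq_Rintegral => t _;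
      rewrite /G ?Re_realc ?Im_realc.
  rewrite /= [in LHS]chirp_fourier_sqr// sqrtrM ?addr_ge0 ?sqr_ge0//; congr (_ * _).
  have d0 : a ^+ 2 + b ^+ 2 != 0 by rewrite gt_eqF// ltr_wpDr ?sqr_ge0// exprn_gt0.
  rewrite -[RHS](ger0_norm (gauss_ge0 _ _)) -sqrtr_sqr /gauss -expRM_natl; congr (Num.sqrt (expR _)).
  by move: (pi : R) => P; field.
have [_ cE] := cintegral_prod iG.
have -> : fourier (gchirp a b) xi = \prod_i cint leb (G i).
  by rewrite -cE /fourier; congr cintegral; apply/funext => x; rewrite GE.
have -> (F : 'I_n -> R[i]) : normc (\prod_i F i) = \prod_i normc (F i).
  elim/big_ind2 : _ => //; first by rewrite /= expr1n expr0n/= addr0 sqrtr1.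
  by move=> u v w z <- <-; rewrite Normc.normcM.
by under eq_bigr do rewrite cG; rewrite big_split/= prodr_const card_ord.
Qed.

End chirp.

Section chirp_bound.
Context {R : realType}.

(** The modulus at frequency 0 is bounded without evaluating any oscillatory integral: in dimension
    1 both sides of Bessel's inequality for the chirp are explicit Gaussian integrals, up to the
    unknown factor K. *)
Lemma chirp_fourier0_le (a b : R) : 0 < a ->
  (chirp_cos a b 0 ^+ 2 + chirp_sin a b 0 ^+ 2) ^+ 2 * (a ^+ 2 + b ^+ 2) <= pi ^+ 2.
Proof.
move=> a0; set K := chirp_cos a b 0 ^+ 2 + chirp_sin a b 0 ^+ 2.
have K0 : 0 <= K by rewrite addr_ge0 ?sqr_ge0.
have d0 : 0 < a ^+ 2 + b ^+ 2 by rewrite ltr_wpDr ?sqr_ge0// exprn_gt0.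
have p0 : 0 < pi :> R by exact: pi_gt0.
have bi := schwartz_bounded_integrable (@gchirp_schwartz R 1 a b a0).
have g2 (t : R) x : gaussV t x ^+ 2 = gaussV (2 * t) x :> R.
  by rewrite !gaussVE -expRM_natl; congr expR; ring.
have c0 : 0 < 2 * (pi ^+ 2 * a / (a ^+ 2 + b ^+ 2)).
  by rewrite mulr_gt0// divr_gt0// mulr_gt0// exprn_gt0.
have := bessel bi.
under eq_integral => x _ do
  rewrite normc_fourier_gchirp// -/K expr1 exprMn sqr_sqrtr// g2 EFinM.
under [in X in (_ <= X)%E]eq_integral => x _ do
  rewrite Normc.normcM normc_cexpi mulr1 normc_real ger0_norm ?gaussV_ge0// g2.
rewrite ge0_integralZl//; last 2 first.
- by apply/measurable_EFinP; exact: measurable_gaussV.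
- by move=> x _; rewrite lee_fin gaussV_ge0.
rewrite (integral_gaussV c0) integral_gaussV ?mulr_gt0// !expr1 -EFinM lee_fin.
rewrite -(ler_pXn2r (ltn0Sn 1)) ?nnegrE ?mulr_ge0// exprMn sqr_sqrtr; last by rewrite divr_ge0// ltW.
rewrite sqr_sqrtr; last by apply/ltW/divr_gt0 => //; rewrite mulr_gt0.
move: (pi : R) p0 c0 => P P0 c0.
rewrite ler_pdivlMr ?mulr_gt0//.
have -> : K ^+ 2 * (P / (2 * (P ^+ 2 * a / (a ^+ 2 + b ^+ 2)))) * (2 * a) =
  K ^+ 2 * (a ^+ 2 + b ^+ 2) / P.
  by field; rewrite !gt_eqF.
by rewrite ler_pdivrMr// -expr2.
Qed.

End chirp_bound.

(** * The dyadic profile *)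

Section profile_1d.
Context {R : realType}.
Local Notation leb := (@lebesgue_measure R).

Lemma powRV (a u : R) : 0 <= a -> a^-1 `^ u = a `^ (- u).
Proof. by move=> a0; rewrite -powR_inv1// -powRrM mulN1r. Qed.

Lemma powR_le_exp (k y : R) : 0 < k -> 0 <= y -> y `^ k <= k `^ k * expR y.
Proof.
move=> k0 y0.
have yk : y / k <= expR (y / k).
  by apply: le_trans (expR_ge1Dx _); rewrite lerDr.
have yE : y = k * (y / k) by rewrite mulrC divfK// gt_eqF.
rewrite [in leLHS]yE powRM ?divr_ge0 ?(ltW k0)// ler_wpM2l ?powR_ge0//.
rewrite -[in leRHS](divfK (lt0r_neq0 k0) y) expRM.
by apply: ge0_ler_powR; rewrite ?nnegrE ?expR_ge0 ?divr_ge0 ?(ltW k0).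
Qed.

(* The integrand is the derivative of [e^-1 * (A / (A + c)) `^ e], [A = 1 + t]. *)
Lemma integral_profile_1d (e c : R) : 0 < e -> 0 < c ->
  (\int[leb]_t (c * (1 + `|t|) `^ (e - 1) * (1 + `|t| + c) `^ (- (e + 1)))%:E <= (2 / e)%:E)%E.
Proof.
move=> e0 c0.
pose F (t : R) : R := e^-1 * ((1 + t) `^ e * (1 + c + t) `^ (- e)).
apply: (@le_trans _ _ (2 * (e^-1 - F 0))%:E); last first.
  by rewrite lee_fin ler_pM2l// lerBlDr lerDl !mulr_ge0 ?powR_ge0// invr_ge0 ltW.
apply: eqW.
apply: (@integral_even_FTC R
  (fun t => c * (1 + `|t|) `^ (e - 1) * (1 + `|t| + c) `^ (- (e + 1))) F e^-1).
- by move=> t; rewrite !mulr_ge0 ?powR_ge0// ltW.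
- apply: (@continuous_comp_norm R (fun A => c * A `^ (e - 1) * (A + c) `^ (- (e + 1))) 1) => //.
  move=> x x0.
  have c1 : {for x, continuous (fun A : R => A `^ (e - 1))}.
    exact: is_derive_continuous (is_derive1_powR _ x0).
  have c2 : {for x, continuous (fun A : R => (A + c) `^ (- (e + 1)))}.
    apply: (@continuous_comp _ _ _ (fun A : R => A + c) (fun A : R => A `^ (- (e + 1)))).
      by apply: cvgD; [exact: cvg_id|exact: cvg_cst].
    by apply: is_derive_continuous (is_derive1_powR _ _); rewrite addr_gt0.
  have c3 : {for x, continuous (fun A : R => c * A `^ (e - 1))}.
    by apply: (@cvgM _ _ _ _ (cst c) (fun A : R => A `^ (e - 1))); [exact: cvg_cst|exact: c1].
  exact: (@cvgM _ _ _ _ _ _ _ _ c3 c2).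
- by move=> t; rewrite normrN.
- move=> t t0; rewrite ger0_norm//.
  have At : 0 < 1 + t by rewrite ltr_pwDl.
  have Bt : 0 < 1 + c + t by rewrite addrAC addr_gt0.
  have d1 : is_derive (1 + t) 1 (fun x : R => x `^ e) (e * (1 + t) `^ (e - 1)).
    exact: is_derive1_powR.
  have d2 : is_derive (1 + c + t) 1 (fun x : R => x `^ (- e)) (- e * (1 + c + t) `^ (- e - 1)).
    exact: is_derive1_powR.
  have dT (T : R) : is_derive t 1 (fun x : R => T + x) 1.
    by apply: is_derive_eq; rewrite add0r mulr1.
  have d3 := @is_derive1_comp _ (fun x : R => x `^ e) (fun x : R => 1 + x) _ _ _ d1 (dT 1).
  have d4 := @is_derive1_comp _ (fun x : R => x `^ (- e)) (fun x : R => 1 + c + x) _ _ _ d2 (dT (1 + c)).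
  have -> : F = cst e^-1 * (((fun x : R => x `^ e) \o (fun x : R => 1 + x)) *
     ((fun x : R => x `^ (- e)) \o (fun x : R => 1 + c + x))) by [].
  apply: is_derive_eq; rewrite /GRing.scale/= mulr0 addr0 !mulr1.
  have -> : (1 + t) `^ e = (1 + t) * (1 + t) `^ (e - 1).
    rewrite -[in X in X * _](powRr1 (ltW At)) -powRD; first by congr (_ `^ _); ring.
    by rewrite (gt_eqF At) implybT.
  have -> : (1 + c + t) `^ (- e) = (1 + c + t) * (1 + c + t) `^ (- e - 1).
    rewrite -[in X in X * _](powRr1 (ltW Bt)) -powRD; first by congr (_ `^ _); ring.
    by rewrite (gt_eqF Bt) implybT.
  rewrite opprD [1 + t + c]addrAC; move: (_ `^ (e - 1)) (_ `^ (- e - 1)) => u v.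
  by field; rewrite gt_eqF.
have p1 : (1 - c * (1 + c + t) `^ (- 1)) @[t --> +oo] --> (1 - c * 0 : R).
  apply: cvgB; first exact: cvg_cst.
  apply: cvgM; first exact: cvg_cst.
  apply: (@cvg_comp _ _ _ (fun t : R => 1 + c + t) (fun t : R => t `^ (- 1)) _ (pinfty_nbhs R)).
    apply/cvgryPge => A; near=> t; rewrite -lerBlDl.
    by near: t; apply: nbhs_pinfty_ge; rewrite num_real.
  exact: powR_cvgy0.
rewrite -[X in _ --> X]mulr1 /F; apply: cvgM; first exact: cvg_cst.
have p2 : (1 - c * (1 + c + t) `^ (- 1)) `^ e @[t --> +oo] --> (1 : R).
  have e1 : (1 : R) `^ e = 1 by rewrite powR1.
  rewrite -[X in _ --> X]e1.
  apply: (@cvg_comp _ _ _ (fun t : R => 1 - c * (1 + c + t) `^ (- 1)) (fun x : R => x `^ e) _ (nbhs (1 : R))).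
    by move: p1; rewrite mulr0 subr0.
  exact: is_derive_continuous (is_derive1_powR e ltr01).
apply: cvg_trans p2; apply: near_eq_cvg; near=> t.
have t0 : 0 < t by near: t; exact: nbhs_pinfty_gt.
have Bt : 0 < 1 + c + t by rewrite !addr_gt0.
rewrite powR_inv1 ?(ltW Bt)// (_ : 1 - c / (1 + c + t) = (1 + t) / (1 + c + t)); last first.
  by field; rewrite gt_eqF.
rewrite powRM ?invr_ge0 ?(ltW Bt) ?addr_ge0 ?(ltW t0)//; congr (_ * _).
by rewrite powRV ?ltW.
Unshelve. all: by end_near. Qed.

End profile_1d.

Section dyadic_profile.
Context {R : realType} {n : nat}.
Local Notation V := 'rV[R]_n.
Local Notation mu := (@lebesgue_rV R n).
Local Notation N := (n%:R : R).
Local Notation E := (@euclid_norm R n).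
Implicit Types (x : V).

Lemma sqr_euclid_norm x : E x ^+ 2 = sqnorm x.
Proof. by rewrite sqr_sqrtr// sqnorm_ge0. Qed.

(** With y = a |x|^2 / 2, half of the exponent absorbs the power of y by [powR_le_exp]. *)
Lemma powR_weighted_gauss_le (th a : R) x : 0 < th -> 0 < a ->
  E x `^ th * gaussV a x <= (th / a) `^ (th / 2) * gaussV (a / 2) x.
Proof.
move=> th0 a0; have th2 : 0 < th / 2 by rewrite divr_gt0.
have -> : gaussV a x = expR (- (a / 2 * sqnorm x)) * gaussV (a / 2) x.
  by rewrite !gaussVE -expRD /sqnorm; congr expR; field.
rewrite mulrA ler_wpM2r ?gaussV_ge0//.
set y := a / 2 * sqnorm x; have ey z : z = z * expR y * expR (- y) by rewrite -mulrA -expRD subrr expR0 mulr1.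
rewrite [leRHS]ey ler_wpM2r ?expR_ge0// /y.
have -> : E x `^ th = (2 / a) `^ (th / 2) * (a / 2 * sqnorm x) `^ (th / 2).
  rewrite -powRM ?mulr_ge0 ?invr_ge0 ?sqnorm_ge0 ?(ltW a0)//.
  rewrite mulrA (_ : 2 / a * (a / 2) = 1); last by field; rewrite gt_eqF.
  rewrite mul1r -sqr_euclid_norm -powR_mulrn ?euclid_norm_ge0// -powRrM.
  by congr (_ `^ _); field.
have -> : (th / a) `^ (th / 2) = (2 / a) `^ (th / 2) * (th / 2) `^ (th / 2).
  rewrite -powRM ?divr_ge0 ?(ltW th0) ?(ltW a0)//; congr (_ `^ _).
  by field; rewrite gt_eqF.
rewrite -[leRHS]mulrA ler_wpM2l ?powR_ge0//; apply: powR_le_exp => //.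
by rewrite mulr_ge0 ?sqnorm_ge0// divr_ge0// ltW.
Qed.

(** Only the constant is lossy: the power of a is the one dictated by scaling, which is all that the
    comparison of exponents needs. *)
Lemma integral_weighted_gauss (th p : R) : 0 < th -> 0 < p ->
  exists M : R, 0 < M /\ forall a, 0 < a ->
    (\int[mu]_x ((E x `^ th * gaussV a x) `^ p)%:E <=
      (M * a `^ (- ((th * p + N) / 2)))%:E)%E.
Proof.
move=> th0 p0; have p_ge0 : (0 : R) <= pi by exact: pi_ge0.
exists (th `^ (th / 2 * p) * (2 * pi / p) `^ (N / 2)).
split; first by rewrite mulr_gt0// powR_gt0// divr_gt0// mulr_gt0// pi_gt0.
move=> a a0; have ap0 : 0 < p * (a / 2) by rewrite mulr_gt0// divr_gt0.
have mE : measurable_fun setT (fun x => E x `^ th).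
  by apply: measurable_powR_fun; exact: measurable_euclid_norm.
apply: (@le_trans _ _ (\int[mu]_x ((th / a) `^ (th / 2 * p) * gaussV (p * (a / 2)) x)%:E)%E).
  apply: ge0_le_integral_EFin => [|||x].
  - by apply: measurable_powR_fun; apply: measurable_funM => //; exact: measurable_gaussV.
  - by apply: measurable_funM => //; exact: measurable_gaussV.
  - by move=> x; exact: powR_ge0.
  have -> : (th / a) `^ (th / 2 * p) * gaussV (p * (a / 2)) x =
     ((th / a) `^ (th / 2) * gaussV (a / 2) x) `^ p.
    rewrite [in RHS]powRM ?powR_ge0 ?gaussV_ge0// [in LHS]powRrM; congr (_ * _).
    by rewrite !gaussVE -expRM; congr expR; ring.
  apply: ge0_ler_powR; rewrite ?nnegrE ?(ltW p0) ?mulr_ge0 ?powR_ge0 ?gaussV_ge0//.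
  exact: powR_weighted_gauss_le.
under eq_integral do rewrite EFinM.
rewrite ge0_integralZl//; last 3 first.
- by apply/measurable_EFinP; exact: measurable_gaussV.
- by move=> x _; rewrite lee_fin gaussV_ge0.
- by rewrite lee_fin powR_ge0.
rewrite integral_gaussV// -EFinM lee_fin; apply: eqW.
have -> : pi / (p * (a / 2)) = 2 * pi / p * a^-1.
  by move: (pi : R) => P; field; rewrite !gt_eqF.
have b0 : 0 <= 2 * pi / p * a^-1 by rewrite !mulr_ge0 ?invr_ge0// ltW.
rewrite -(powR12_sqrt b0) -powR_mulrn ?powR_ge0// -powRrM [2^-1 * _]mulrC.
rewrite !powRM ?invr_ge0 ?(ltW th0) ?(ltW a0) ?(ltW p0)//; last by rewrite !mulr_ge0 ?invr_ge0// ltW.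
rewrite !(powRV _ (ltW a0)) (_ : - ((th * p + N) / 2) = - (th / 2 * p) + - (N / 2)); last by field.
rewrite powRD ?(gt_eqF a0) ?implybT//.
by move: (th `^ _) (a `^ _) (a `^ _) (_ `^ (N / 2)) => u1 u2 u3 u4; ring.
by rewrite mulr_ge0.
Qed.

(** The factor 2^(-jN/2) gives every term the same L^2 norm. *)
Definition dyadic_profile (J : nat) x : R :=
  \sum_(j < J) (2 ^+ j) `^ (- (N / 2)) * gaussV ((2 ^+ j) ^- 2) x.

Lemma dyadic_profile_ge0 J x : 0 <= dyadic_profile J x.
Proof. by apply: sumr_ge0 => j _; rewrite mulr_ge0 ?powR_ge0 ?gaussV_ge0. Qed.

Lemma measurable_dyadic_profile J : measurable_fun setT (dyadic_profile J).
Proof.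
apply: measurable_sum => j; apply: measurable_funM => //; exact: measurable_gaussV.
Qed.

Variables (p th : R).
Hypotheses (n0 : (0 < n)%N) (p1 : 1 < p) (th0 : 0 < th) (pth : N / p + th <= N / 2).

(** The power |x|^(-beta) just fails to lie in L^p, and the weighted profile will be at most M S (1
    + |x|)^(-beta). In [K] the part th absorbs the weight and 2N is spare decay; [q] is the ratio of
    v^beta between consecutive scales, and [S] bounds the sums over scales. *)
Let beta := N / p.
Let K := th + 2 * N.
Let M := K `^ K * expR 3.
Let q := 2 `^ (- beta) : R.
Let S := 4 / (1 - q).

Let N0 : 0 < N. Proof. by rewrite ltr0n. Qed.
Let p0 : 0 < p. Proof. exact: lt_trans p1. Qed.
Let beta0 : 0 < beta. Proof. by rewrite divr_gt0. Qed.
Let betaN : beta <= N. Proof. by rewrite ler_pdivrMr// ler_peMr ?ltW. Qed.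
Let K0 : 0 < K. Proof. by rewrite addr_gt0// mulr_gt0. Qed.
Let M0 : 0 < M. Proof. by rewrite mulr_gt0 ?expR_gt0// powR_gt0. Qed.
Let q0 : 0 < q. Proof. exact: powR_gt0. Qed.
Let q1 : q < 1.
Proof.
rewrite /q powRN invf_lt1 ?powR_gt0//.
by have := gt0_ltr_powR beta0 ler01 (ler0n _ 2) (ltr1n _ 2); rewrite powR1; apply.
Qed.
Let S0 : 0 < S. Proof. by rewrite divr_gt0// subr_gt0. Qed.

(** The Gaussian is traded for a power of 1 + (1 + |x|)/c, for which sums over scales and integrals
    are explicit. The threshold hypothesis enters as c^(th - N/2) <= c^(-beta), valid because c >=
    1. *)
Lemma profile_term_le (c : R) x : 1 <= c ->
  E x `^ th * (c `^ (- (N / 2)) * gaussV (c ^- 2) x) <=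
  M * (c `^ (- beta) * (1 + (1 + E x) / c) `^ (- (2 * N))).
Proof.
move=> c1; have c0 : 0 < c by exact: lt_le_trans c1.
have Ex0 := euclid_norm_ge0 x.
have A0 : 0 < 1 + E x by rewrite ltr_pwDl.
set v := (1 + E x) / c; have v0 : 0 < v by rewrite divr_gt0.
have h1 : E x `^ th <= (1 + v) `^ th * c `^ th.
  rewrite -powRM ?addr_ge0 ?(ltW v0) ?(ltW c0)//; apply: ge0_ler_powR.
  - exact: ltW.
  - by rewrite nnegrE.
  - by rewrite nnegrE mulr_ge0 ?addr_ge0 ?(ltW v0) ?(ltW c0).
  by rewrite mulrDl mul1r /v divfK ?gt_eqF// addrA lerDr addr_ge0// ltW.
have h2 : c `^ th * c `^ (- (N / 2)) <= c `^ (- beta).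
  by rewrite -powRD ?(gt_eqF c0) ?implybT//; apply: ler_powR => //; move: pth; rewrite -/beta; lra.
(* With y = |x|/c and c >= 1, the exponent is at most 2 + y - y^2 <= 3, whence the constant exp(3)
   in [M]. *)
have h3 : (1 + v) `^ K * gaussV (c ^- 2) x <= M.
  apply: le_trans (ler_wpM2r (gaussV_ge0 _ _) (powR_le_exp K0 _)) _.
    by rewrite addr_ge0// ltW.
  rewrite -mulrA /M ler_wpM2l ?powR_ge0// gaussVE -expRD ler_expR -/(sqnorm x) -sqr_euclid_norm.
  have -> : c ^- 2 * E x ^+ 2 = (E x / c) ^+ 2 by rewrite exprMn exprVn mulrC.
  have c' : c^-1 <= 1 by rewrite invf_le1.
  rewrite /v mulrDl mul1r; set y := E x / c.
  have := sqr_ge0 (y - 1/2); move: (c^-1) c' => c'; rewrite expr2; nra.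
have w0 : 0 < 1 + v by rewrite addr_gt0.
have h4 : (1 + v) `^ th = (1 + v) `^ K * (1 + v) `^ (- (2 * N)).
  by rewrite -powRD ?(gt_eqF w0) ?implybT// /K addrK.
apply: le_trans (ler_wpM2r _ h1) _; first by rewrite mulr_ge0 ?powR_ge0 ?gaussV_ge0.
rewrite h4.
have -> : (1 + v) `^ K * (1 + v) `^ (- (2 * N)) * c `^ th * (c `^ (- (N / 2)) * gaussV (c ^- 2) x) =
  ((1 + v) `^ K * gaussV (c ^- 2) x) * (c `^ th * c `^ (- (N / 2)) * (1 + v) `^ (- (2 * N))) by ring.
apply: ler_pM; rewrite ?mulr_ge0 ?powR_ge0 ?gaussV_ge0//.
by rewrite ler_wpM2r ?powR_ge0.
Qed.

(* psi increases from 0 to 1, so its increments over dyadic scales sum to at most 1. *)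
Let psi (v : R) := v `^ beta / (1 + v `^ beta).

(** With z = v^beta the increment of psi is (1 - q) z / ((1 + z)(1 + q z)), and both factors of the
    denominator are at most 2 (1 + v)^N; hence [S] = 4 / (1 - q). *)
Let psi_step v : 0 < v -> v `^ beta * (1 + v) `^ (- (2 * N)) <= S * (psi v - psi (v / 2)).
Proof.
move=> v0; rewrite /psi powRM ?invr_ge0 ?(ltW v0)//.
have -> : 2^-1 `^ beta = q by rewrite powRV.
have w1 : 1 <= 1 + v by rewrite lerDl ltW.
have zw : 1 + v `^ beta <= 2 * (1 + v) `^ N.
  rewrite mulr_natl mulr2n; apply: lerD.
    by rewrite -[leLHS](powRr0 (1 + v)); apply: ler_powR => //; exact: ltW.
  apply: le_trans (ler_powR w1 betaN).
  by apply: ge0_ler_powR; rewrite ?nnegrE ?(ltW beta0) ?(ltW v0) ?addr_ge0 ?(ltW v0)// lerDr.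
have -> : (1 + v) `^ (- (2 * N)) = ((1 + v) `^ N) ^- 2.
  by rewrite powRN mulrC powRrM powR_mulrn ?powR_ge0.
have W0 : 0 < (1 + v) `^ N by rewrite powR_gt0// addr_gt0.
have z0 : 0 < v `^ beta by exact: powR_gt0.
move: (v `^ beta) ((1 + v) `^ N) z0 W0 zw => z W z0 W0 zw.
have a0 : 0 < 1 + z by rewrite addr_gt0.
have b0 : 0 < 1 + z * q by rewrite addr_gt0// mulr_gt0.
have -> : S * (z / (1 + z) - z * q / (1 + z * q)) = z * (4 / ((1 + z) * (1 + z * q))).
  by rewrite /S; field; rewrite !gt_eqF// subr_gt0.
rewrite ler_wpM2l ?(ltW z0)// ler_pdivlMr ?mulr_gt0// mulrC ler_pdivrMr ?exprn_gt0//.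
apply: (@le_trans _ _ ((2 * W) * (2 * W))); last by apply: eqW; ring.
apply: ler_pM => //; try exact: ltW.
by apply: le_trans zw; rewrite lerD2l ler_piMr ?ltW.
Qed.

Lemma dyadic_sum_le (v : R) J : 0 < v ->
  \sum_(j < J) (v / 2 ^+ j) `^ beta * (1 + v / 2 ^+ j) `^ (- (2 * N)) <= S.
Proof.
move=> v0; have vj (j : nat) : 0 < v / 2 ^+ j by rewrite divr_gt0// exprn_gt0.
have p01 (w : R) : 0 <= psi w <= 1.
  rewrite /psi divr_ge0 ?addr_ge0 ?powR_ge0//= ler_pdivrMr ?mul1r ?lerDr//.
  by rewrite ltr_pwDl ?powR_ge0.
apply: (@le_trans _ _ (\sum_(j < J) S * (psi (v / 2 ^+ j) - psi (v / 2 ^+ j.+1)))).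
  apply: ler_sum => j _; apply: le_trans (psi_step (vj j)) _.
  by rewrite exprSr invfM mulrA.
have -> : \sum_(j < J) S * (psi (v / 2 ^+ j) - psi (v / 2 ^+ j.+1)) =
    S * (psi v - psi (v / 2 ^+ J)).
  elim: J => [|J IH]; first by rewrite big_ord0 expr0 divr1 subrr mulr0.
  by rewrite big_ord_recr/= IH -mulrDr; congr (_ * _); ring.
rewrite -[leRHS]mulr1 ler_wpM2l ?(ltW S0)//.
have /andP[_ h1] := p01 v; have /andP[h2 _] := p01 (v / 2 ^+ J).
by rewrite lerBlDr; apply: le_trans h1 _; rewrite lerDl.
Qed.

Let e := p^-1.
(** The integrand of [integral_profile_1d]: its integral is at most 2 p, whatever the scale c. *)
Let f (c t : R) : R := c * (1 + `|t|) `^ (e - 1) * (1 + `|t| + c) `^ (- (e + 1)).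

Let f_ge0 c t : 0 < c -> 0 <= f c t.
Proof. by move=> c0; rewrite !mulr_ge0 ?powR_ge0// ltW. Qed.

(** After 2N is lowered to (e + 1) N, the left side is at most the n-th power of a single expression
    in 1 + |x|. Its exponents e - 1 and -(e + 1) are negative, so replacing |x| by |x_i| in the i-th
    factor only increases it. *)
Lemma profile_prod_le (c : R) x : 0 < c ->
  c `^ (- beta) * (1 + (1 + E x) / c) `^ (- (2 * N)) * (1 + E x) `^ (- beta * (p - 1)) <=
  \prod_i f c (x ord0 i).
Proof.
move=> c0; have Ex0 := euclid_norm_ge0 x.
set A := 1 + E x; have A0 : 0 < A by rewrite ltr_pwDl.
have Ac0 : 0 < A + c by rewrite addr_gt0.
have e0 : 0 < e by rewrite invr_gt0.
have e1 : e < 1 by rewrite invf_lt1.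
have bE : beta = e * N by rewrite /beta mulrC.
have -> : - beta * (p - 1) = (e - 1) * N.
  by rewrite bE /e; field; rewrite gt_eqF.
apply: (@le_trans _ _ ((c * A `^ (e - 1) * (A + c) `^ (- (e + 1))) ^+ n)); last first.
  rewrite -[X in _ ^+ X]card_ord -prodr_const; apply: ler_prod => i _.
  rewrite !mulr_ge0 ?powR_ge0 ?(ltW c0)//= /f -!mulrA ler_wpM2l ?(ltW c0)//.
  have B0 : 0 < 1 + `|x ord0 i| by rewrite ltr_pwDl.
  have BA : 1 + `|x ord0 i| <= A by rewrite lerD2l coord_le_euclid_norm.
  have anti (r s t : R) : 0 < r -> r <= s -> 0 <= t -> s `^ (- t) <= r `^ (- t).
    move=> r0 rs t0; rewrite !powRN lef_pV2 ?posrE ?powR_gt0//; last exact: lt_le_trans rs.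
    by apply: ge0_ler_powR; rewrite ?nnegrE ?(ltW r0)// (le_trans (ltW r0)).
  apply: ler_pM; rewrite ?powR_ge0//.
    by rewrite -opprB; apply: anti => //; rewrite subr_ge0 ltW.
  by apply: anti; [exact: addr_gt0|rewrite lerD2r|rewrite addr_ge0// ltW].
rewrite !exprMn -!powR_mulrn ?powR_ge0 ?(ltW c0)// -!powRrM.
have h : (1 + A / c) `^ (- (2 * N)) <= (1 + A / c) `^ (- (e + 1) * N).
  apply: ler_powR; first by rewrite lerDl divr_ge0 ?ltW.
  by rewrite mulNr lerN2 ler_wpM2r ?(ltW N0)//; lra.
have AcE : 1 + A / c = (A + c) * c^-1 by field; rewrite gt_eqF.
have -> : c `^ N = c `^ (- beta) * c^-1 `^ (- (e + 1) * N).
  by rewrite (powRV _ (ltW c0)) -powRD ?(gt_eqF c0) ?implybT// bE; congr (_ `^ _); ring.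
apply: (@le_trans _ _ (c `^ (- beta) * (1 + A / c) `^ (- (e + 1) * N) * A `^ ((e - 1) * N))).
  by rewrite ler_wpM2r ?powR_ge0// ler_wpM2l ?powR_ge0.
rewrite AcE powRM ?invr_ge0 ?(ltW Ac0) ?(ltW c0)//; apply: eqW.
by move: (c `^ _) (A `^ _) (c^-1 `^ _) ((A + c) `^ _) => u1 u2 u3 u4; ring.
Qed.

(** The power p is split as 1 + (p - 1): the factor G^(p-1) is bounded uniformly in J through
    [dyadic_sum_le], while the remaining G is kept as a sum over scales. The integral then grows
    like J and not like J^p. *)
Lemma dyadic_profile_powR_le J x :
  (E x `^ th * dyadic_profile J x) `^ p <=
  (M * S) `^ (p - 1) * M * \sum_(j < J) \prod_i f (2 ^+ j) (x ord0 i).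
Proof.
have Ex0 := euclid_norm_ge0 x.
have A0 : 0 < 1 + E x by rewrite ltr_pwDl.
have cj (j : nat) : 0 < 2 ^+ j :> R by rewrite exprn_gt0.
set G := E x `^ th * dyadic_profile J x.
have G0 : 0 <= G by rewrite mulr_ge0 ?powR_ge0 ?dyadic_profile_ge0.
pose t (j : nat) : R := (2 ^+ j) `^ (- beta) * (1 + (1 + E x) / 2 ^+ j) `^ (- (2 * N)).
have Gt : G <= M * \sum_(j < J) t j.
  rewrite /G /dyadic_profile !mulr_sumr; apply: ler_sum => j _.
  by apply: profile_term_le; rewrite -[leLHS](expr1n _ j) lerXn2r ?nnegrE// ler1n.
have GS : G <= M * S * (1 + E x) `^ (- beta).
  apply: le_trans Gt _; rewrite -mulrA ler_wpM2l ?(ltW M0)//.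
  apply: le_trans (ler_wpM2r _ (dyadic_sum_le J A0)); last exact: powR_ge0.
  rewrite mulr_suml; apply: eqW; apply: eq_bigr => j _.
  rewrite /t powRM ?invr_ge0 ?(ltW A0) ?(ltW (cj j))//.
  have -> : (2 ^+ j)^-1 `^ beta = (2 ^+ j) `^ (- beta) :> R.
    by rewrite powRV ?ltW.
  have -> : (1 + E x) `^ (- beta) = ((1 + E x) `^ beta)^-1 by rewrite powRN.
  have : (1 + E x) `^ beta != 0 by rewrite gt_eqF// powR_gt0.
  move: ((1 + E x) `^ beta) ((2 ^+ j) `^ _) ((1 + _) `^ _) => u1 u2 u3 h.
  by field.
have -> : G `^ p = G * G `^ (p - 1).
  rewrite -[in RHS](powRr1 G0) -powRrM mul1r -powRD; first by congr (_ `^ _); ring.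
  by rewrite addrC subrK gt_eqF.
have G1 : G `^ (p - 1) <= (M * S) `^ (p - 1) * (1 + E x) `^ (- beta * (p - 1)).
  have MS0 : 0 <= M * S by rewrite mulr_ge0 ?ltW.
  rewrite powRrM -powRM ?powR_ge0//; apply: ge0_ler_powR => //.
  - by rewrite subr_ge0 ltW.
  - by rewrite nnegrE mulr_ge0 ?powR_ge0.
apply: le_trans (ler_pM _ _ Gt G1) _ => //; first exact: powR_ge0.
have -> : M * (\sum_(j < J) t j) * ((M * S) `^ (p - 1) * (1 + E x) `^ (- beta * (p - 1))) =
   (M * S) `^ (p - 1) * M * (\sum_(j < J) t j * (1 + E x) `^ (- beta * (p - 1))).
  by rewrite -mulr_suml; ring.
rewrite ler_wpM2l ?mulr_ge0 ?powR_ge0 ?(ltW M0)//.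
by apply: ler_sum => j _; exact: profile_prod_le.
Qed.

Lemma integral_dyadic_profile : exists C : R, 0 < C /\ forall J,
  (\int[mu]_x ((E x `^ th * dyadic_profile J x) `^ p)%:E <= (C * J%:R)%:E)%E.
Proof.
have e0 : 0 < e by rewrite invr_gt0.
have MS0 : 0 < (M * S) `^ (p - 1) * M by rewrite mulr_gt0// powR_gt0// mulr_gt0.
exists ((M * S) `^ (p - 1) * M * (2 / e) ^+ n); split.
  by rewrite mulr_gt0// exprn_gt0// divr_gt0.
move=> J; have cj (j : nat) : 0 < 2 ^+ j :> R by rewrite exprn_gt0.
have mf (c : R) : measurable_fun setT (f c).
  apply: measurable_funM; [apply: measurable_funM => //|]; apply: measurable_powR_fun;
    repeat apply: measurable_funD => //; exact: measurable_normr.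
have mP (c : R) : measurable_fun setT (fun x : V => \prod_i f c (x ord0 i)).
  by apply: (measurable_prod_coord (h := fun=> f c)).
have mPE (c : R) : measurable_fun setT (fun x : V => (\prod_i f c (x ord0 i))%:E).
  by apply/measurable_EFinP; exact: mP.
have P0 (j : nat) x : 0 <= \prod_i f (2 ^+ j) (x ord0 i).
  by apply: prodr_ge0 => i _; exact: f_ge0.
apply: le_trans (ge0_le_integral_EFin _ _ _ (dyadic_profile_powR_le J)) _.
- apply: measurable_powR_fun; apply: measurable_funM; last exact: measurable_dyadic_profile.
  by apply: measurable_powR_fun; exact: measurable_euclid_norm.
- by apply: measurable_funM => //; apply: measurable_sum.
- by move=> x; exact: powR_ge0.
under eq_integral do rewrite EFinM -sumEFin.
rewrite ge0_integralZl//; last 3 first.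
- by apply: emeasurable_sum => j; exact/measurable_EFinP.
- by move=> x _; apply: sume_ge0 => j _; rewrite lee_fin.
- by rewrite lee_fin ltW.
rewrite ge0_integral_sum//; last by move=> j x _; rewrite lee_fin.
rewrite -[X in (_ <= X%:E)%E]mulrA [X in (_ <= X)%E]EFinM lee_wpmul2l ?lee_fin ?(ltW MS0)//.
apply: (@le_trans _ _ (\sum_(j < J) ((2 / e) ^+ n)%:E)%E); last first.
  by rewrite sumEFin sumr_const card_ord lee_fin mulr_natr.
apply: lee_sum => j _.
rewrite (ge0_integral_prod (g := fun=> f (2 ^+ j)))//; last by move=> i t; exact: f_ge0.
have -> : ((2 / e) ^+ n)%:E = (\prod_(i < n) (2 / e)%:E)%E.
  by rewrite -(big_morph EFin (@EFinM R) erefl) prodr_const card_ord.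
suff /andP[] : (0 <= \prod_(i < n) \int[lebesgue_measure]_t (f (2 ^+ j) t)%:E <=
    \prod_(i < n) (2 / e)%:E)%E by [].
elim/big_rec2 : _ => [|i u w _ /andP[u0 uw]]; first by rewrite lee01 lexx.
have I0 : (0 <= \int[lebesgue_measure]_t (f (2 ^+ j) t)%:E)%E.
  by apply: integral_ge0 => t _; rewrite lee_fin f_ge0.
by rewrite mule_ge0//= lee_pmul// integral_profile_1d.
Qed.

End dyadic_profile.

(** * Necessity *)

Section necessity.
Context {R : realType} {n : nat}.
Local Notation V := 'rV[R]_n.
Local Notation mu := (@lebesgue_rV R n).
Local Notation N := (n%:R : R).
Local Notation E := (@euclid_norm R n).
Local Notation normc := (@Normc.normc R).
Implicit Types (f g : V -> R[i]) (u w : V -> R) (x xi : V).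

Lemma Lp_norm_le (p B : R) g : 0 < p -> 0 <= B ->
  (\int[mu]_x (normc (g x) `^ p)%:E <= B%:E)%E -> (Lp_norm p g <= (B `^ p^-1)%:E)%E.
Proof.
move=> p0 B0; rewrite -(Lp_norm_poweR g p0) => h.
have L0 : (0 <= Lp_norm p g)%E by exact: Lnorm_ge0.
have -> : Lp_norm p g = ((Lp_norm p g `^ p) `^ p^-1)%E.
  by rewrite -poweRrM divff ?gt_eqF// poweRe1.
rewrite -poweR_EFin; apply: gt0_ler_poweR => //.
- by rewrite invr_ge0 ltW.
- by rewrite in_itv/= poweR_ge0 leey.
- by rewrite in_itv/= lee_fin B0 leey.
Qed.

Lemma Lp_norm_weighted_le (p th B c : R) g w : 0 < p -> 0 <= c -> 0 <= B ->
  measurable_fun setT (fun x => normc (g x)) -> measurable_fun setT w -> (forall x, 0 <= w x) ->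
  (forall x, normc (g x) <= c * w x) ->
  (\int[mu]_x ((E x `^ th * w x) `^ p)%:E <= B%:E)%E ->
  (Lp_norm p (weighted th g) <= (c * B `^ p^-1)%:E)%E.
Proof.
move=> p0 c0 B0 mg mw w0 gw wB.
have mE : measurable_fun setT (fun x => E x `^ th).
  by apply: measurable_powR_fun; exact: measurable_euclid_norm.
have mEw : measurable_fun setT (fun x => (E x `^ th * w x) `^ p).
  by apply: measurable_powR_fun; exact: measurable_funM.
have -> : c * B `^ p^-1 = (c `^ p * B) `^ p^-1.
  by rewrite powRM ?powR_ge0// -powRrM divff ?gt_eqF// powRr1.
apply: Lp_norm_le; rewrite ?mulr_ge0 ?powR_ge0//.
apply: (@le_trans _ _ (\int[mu]_x (c `^ p * (E x `^ th * w x) `^ p)%:E)%E).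
  apply: ge0_le_integral_EFin => [|||x].
  - apply: measurable_powR_fun; under eq_fun do rewrite normc_weighted.
    exact: measurable_funM.
  - exact: measurable_funM.
  - by move=> x; exact: powR_ge0.
  rewrite -powRM ?mulr_ge0 ?powR_ge0// normc_weighted.
  apply: ge0_ler_powR; rewrite ?nnegrE ?(ltW p0) ?mulr_ge0 ?powR_ge0 ?normc_ge0//.
  by rewrite mulrCA ler_wpM2l ?powR_ge0.
under eq_integral do rewrite EFinM.
rewrite ge0_integralZl//; last 3 first.
- exact/measurable_EFinP.
- by move=> x _; rewrite lee_fin powR_ge0.
- by rewrite lee_fin powR_ge0.
by rewrite EFinM lee_wpmul2l// lee_fin powR_ge0.
Qed.

Variables (p q th ph C : R).
Hypotheses (n0 : (0 < n)%N) (p1 : 1 < p) (q1 : 1 < q) (th0 : 0 < th) (ph0 : 0 < ph) (C0 : 0 < C).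
Hypothesis HC : forall f, schwartz f -> (C%:E * Lp_norm 2 f ^+ 2 <=
  Lp_norm p (weighted th f) * Lp_norm q (weighted ph (fourier f)))%E.

Let p0 : 0 < p. Proof. exact: lt_trans p1. Qed.
Let q0 : 0 < q. Proof. exact: lt_trans q1. Qed.

(** Turns the assumed inequality into one between real numbers, from the modulus u of f, a majorant
    c w of the modulus of its transform, and three integral bounds. *)
Lemma test_function f u w (c L A B : R) : schwartz f -> 0 <= c -> 0 <= A -> 0 <= B ->
  measurable_fun setT u -> measurable_fun setT w ->
  (forall x, 0 <= w x) ->
  (forall x, normc (f x) = u x) -> (forall xi, normc (fourier f xi) <= c * w xi) ->
  (L%:E <= \int[mu]_x (u x ^+ 2)%:E)%E ->
  (\int[mu]_x ((E x `^ th * u x) `^ p)%:E <= A%:E)%E ->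
  (\int[mu]_x ((E x `^ ph * w x) `^ q)%:E <= B%:E)%E ->
  C * L <= A `^ p^-1 * (c * B `^ q^-1).
Proof.
move=> sf c0 A0 B0 mu' mw w0 fu fw uL uA wB.
have bf := schwartz_bounded_integrable sf; have [mR mI _ _] := bf.
rewrite -lee_fin !EFinM; apply: (@le_trans _ _ (C%:E * Lp_norm 2 f ^+ 2)%E).
  rewrite lee_wpmul2l ?lee_fin ?(ltW C0)// Lp_norm2//.
  by under eq_integral do rewrite fu.
apply: le_trans (HC sf) _.
apply: lee_pmul; rewrite ?Lnorm_ge0//.
  rewrite -[A `^ _]mul1r; apply: (@Lp_norm_weighted_le _ _ _ _ _ u) => //.
  - exact: (measurable_normc mR mI).
  - by move=> x; rewrite -fu normc_ge0.
  - by move=> x; rewrite mul1r fu.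
rewrite -EFinM; apply: (@Lp_norm_weighted_le _ _ _ _ _ w) => //.
exact: measurable_normc_fourier.
Qed.

Let N0 : 0 < N. Proof. by rewrite ltr0n. Qed.

(** For exp(-a |x|^2) the inequality becomes a positive constant <= D a^d for all a > 0, with d half
    the difference of the two sides of the claim. *)
Lemma scaling_necessary : ph + N / q = th + N / p.
Proof.
have [M1 [M10 H1]] := @integral_weighted_gauss R n th p th0 p0.
have [M2 [M20 H2]] := @integral_weighted_gauss R n ph q ph0 q0.
have P0 : 0 < pi :> R by exact: pi_gt0.
pose d := (ph + N / q) / 2 - (th + N / p) / 2.
pose D := M1 `^ p^-1 * (Num.sqrt pi ^+ n * (M2 `^ q^-1 * (pi ^+ 2) `^ (- ((ph + N / q) / 2)))).
have D0 : 0 < D by rewrite !mulr_gt0 ?powR_gt0 ?exprn_gt0 ?sqrtr_gt0.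
have key a : 0 < a -> C * Num.sqrt (pi / 2) ^+ n <= D * a `^ d.
  (* The power a^(-n/2) occurs both in ||f||_2^2 and in the bound for the transform, and cancels. *)
  move=> a0; pose r := Num.sqrt a^-1 ^+ n; have r0 : 0 < r by rewrite exprn_gt0// sqrtr_gt0 invr_gt0.
  have b0 : 0 < pi ^+ 2 / a by rewrite divr_gt0// exprn_gt0.
  have sf : schwartz (@gchirp R n a 0) by exact: gchirp_schwartz.
  have := @test_function _ (gaussV a) (gaussV (pi ^+ 2 / a)) (Num.sqrt (pi / a) ^+ n)
    (Num.sqrt (pi / (2 * a)) ^+ n) (M1 * a `^ (- ((th * p + N) / 2)))
    (M2 * (pi ^+ 2 / a) `^ (- ((ph * q + N) / 2))) sf.
  have -> : Num.sqrt (pi / a) ^+ n = Num.sqrt pi ^+ n * r.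
    by rewrite sqrtrM ?pi_ge0// exprMn.
  have -> : Num.sqrt (pi / (2 * a)) ^+ n = Num.sqrt (pi / 2) ^+ n * r.
    by rewrite invfM mulrA sqrtrM ?divr_ge0 ?pi_ge0// exprMn.
  have -> : (M1 * a `^ (- ((th * p + N) / 2))) `^ p^-1 = M1 `^ p^-1 * a `^ (- ((th + N / p) / 2)).
    rewrite powRM ?powR_ge0 ?(ltW M10)// -powRrM; congr (_ * _ `^ _).
    by field; rewrite gt_eqF.
  have -> : (M2 * (pi ^+ 2 / a) `^ (- ((ph * q + N) / 2))) `^ q^-1 =
      M2 `^ q^-1 * ((pi ^+ 2) `^ (- ((ph + N / q) / 2)) * a `^ ((ph + N / q) / 2)).
    rewrite powRM ?powR_ge0 ?(ltW M20)// -powRrM; congr (_ * _).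
    rewrite powRM ?invr_ge0 ?exprn_ge0 ?(ltW a0) ?pi_ge0// (powRV _ (ltW a0)).
    by congr (_ `^ _ * _ `^ _); field; rewrite gt_eqF.
  move=> h; rewrite -(ler_pM2r r0).
  have -> : D * a `^ d * r = M1 `^ p^-1 * a `^ (- ((th + N / p) / 2)) *
    (Num.sqrt pi ^+ n * r * (M2 `^ q^-1 * ((pi ^+ 2) `^ (- ((ph + N / q) / 2)) * a `^ ((ph + N / q) / 2)))).
    rewrite /d powRD ?(gt_eqF a0) ?implybT// /D.
    by move: (_ `^ _) (a `^ _) (a `^ _) (M2 `^ _) (M1 `^ _) (Num.sqrt pi ^+ n) (r)
      => u1 u2 u3 u4 u5 u6 u7; ring.
  rewrite -[leLHS]mulrA; apply: h.
  - by rewrite mulr_ge0 ?exprn_ge0// ltW.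
  - by rewrite mulr_ge0 ?powR_ge0// ltW.
  - by rewrite mulr_ge0 ?powR_ge0// ltW.
  - exact: measurable_gaussV.
  - exact: measurable_gaussV.
  - by move=> x; exact: gaussV_ge0.
  - by move=> x; rewrite Normc.normcM normc_cexpi mulr1 normc_real ger0_norm// gaussV_ge0.
  - move=> xi; rewrite normc_fourier_gchirp//.
    have -> : pi ^+ 2 * a / (a ^+ 2 + 0 ^+ 2) = pi ^+ 2 / a.
      by move: (pi : R) => P; field; rewrite gt_eqF.
    rewrite ler_wpM2r ?gaussV_ge0// /r -exprMn -sqrtrM ?pi_ge0//.
    rewrite lerXn2r ?nnegrE ?sqrtr_ge0// ler_sqrt ?divr_ge0 ?pi_ge0 ?(ltW a0)//.
    rewrite -(ler_pXn2r (ltn0Sn 1)) ?nnegrE ?divr_ge0 ?pi_ge0 ?addr_ge0 ?sqr_ge0 ?(ltW a0)//.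
    rewrite expr_div_n ler_pdivlMr ?exprn_gt0//.
    by have := chirp_fourier0_le 0 a0; rewrite expr0n/= addr0.
  - have g2 x : gaussV a x ^+ 2 = gaussV (2 * a) x.
      by rewrite !gaussVE -expRM_natl; congr expR; ring.
    under eq_integral do rewrite g2.
    rewrite integral_gaussV ?mulr_gt0// lee_fin /r -exprMn -sqrtrM ?divr_ge0 ?pi_ge0//.
    by rewrite invfM mulrA.
  - exact: H1.
  - exact: H2.
have S0 : 0 < C * Num.sqrt (pi / 2) ^+ n by rewrite mulr_gt0// exprn_gt0// sqrtr_gt0 divr_gt0.
suff : d = 0 by rewrite /d => dd; lra.
apply/eqP/negP => /negP d0.
(* For a = z^(1/d), which exists when d is nonzero, D a^d is half of the constant it should
   dominate. *)
pose z := C * Num.sqrt (pi / 2) ^+ n / (2 * D).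
have z0 : 0 < z by rewrite divr_gt0// mulr_gt0.
have := key (z `^ d^-1) (powR_gt0 _ z0).
rewrite -powRrM mulVf// powRr1 ?(ltW z0)// leNgt => /negP; apply.
have -> : D * z = C * Num.sqrt (pi / 2) ^+ n / 2.
  by rewrite /z; field; rewrite gt_eqF.
by rewrite ltr_pdivrMr// ltr_pMr// ltr1n.
Qed.

Lemma sum_sqr_le_sqr_sum (v : nat -> R) J : (forall j, 0 <= v j) ->
  \sum_(j < J) v j ^+ 2 <= (\sum_(j < J) v j) ^+ 2.
Proof.
move=> v0; elim: J => [|J IH]; first by rewrite !big_ord0 expr0n.
rewrite !big_ord_recr/=; have : 0 <= \sum_(j < J) v j by exact: sumr_ge0.
move: IH (v0 J); move: (\sum_(j < J) v j) (\sum_(j < J) v j ^+ 2) (v J) => a b c.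
by move=> ab c0 a0; rewrite sqrrD lerD2r (le_trans ab)// lerDl mulrn_wge0// mulr_ge0.
Qed.

(** As th and ph are positive, the hypotheses force 1/p and 1/q below 1/2, and the sum of J chirps
    gives J <= const J^(1/p + 1/q). *)
Lemma threshold_necessary : N / p + th <= N / 2 -> N / q + ph <= N / 2 -> False.
Proof.
move=> hp hq.
have [C1 [C10 H1]] := integral_dyadic_profile n0 p1 th0 hp.
have [C2 [C20 H2]] := integral_dyadic_profile n0 q1 ph0 hq.
have P0 : 0 < pi :> R by exact: pi_gt0.
have P2 : 2 <= pi :> R by exact: pi_ge2.
pose d := 1 - p^-1 - q^-1.
have d0 : 0 < d.
  have hp' : p^-1 < 2^-1.
    by rewrite -(ltr_pM2l N0); apply: lt_le_trans hp; rewrite ltrDl.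
  have hq' : q^-1 < 2^-1.
    by rewrite -(ltr_pM2l N0); apply: lt_le_trans hq; rewrite ltrDl.
  by rewrite /d; lra.
have e0 : 0 < C * Num.sqrt (pi / 2) ^+ n by rewrite mulr_gt0// exprn_gt0// sqrtr_gt0 divr_gt0.
pose D := C1 `^ p^-1 * (Num.sqrt pi ^+ n * C2 `^ q^-1).
have cj (j : nat) : 0 < 2 ^+ j :> R by rewrite exprn_gt0.
pose c (j : nat) : R := (2 ^+ j) `^ (- (N / 2)).
pose a (j : nat) : R := (2 ^+ j) ^- 2.
have a0 j : 0 < a j by rewrite invr_gt0 exprn_gt0.
have c0 j : 0 <= c j by exact: powR_ge0.
have a1 j : a j <= 1.
  by rewrite invf_le1 ?exprn_gt0// -exprM -[leLHS](expr1n _ (j * 2)) lerXn2r ?nnegrE// ler1n.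
have key (J : nat) : (0 < J)%N -> C * Num.sqrt (pi / 2) ^+ n * J%:R `^ d <= D.
  move=> J0; have J0' : 0 < J%:R :> R by rewrite ltr0n.
  have sf : schwartz (@gchirp_sum R n J c a 1) by exact: gchirp_sum_schwartz.
  have := @test_function _ (@dyadic_profile R n J) (@dyadic_profile R n J) (Num.sqrt pi ^+ n)
    (Num.sqrt (pi / 2) ^+ n * J%:R) (C1 * J%:R) (C2 * J%:R) sf.
  move=> h; have {h} : C * (Num.sqrt (pi / 2) ^+ n * J%:R) <=
      (C1 * J%:R) `^ p^-1 * (Num.sqrt pi ^+ n * (C2 * J%:R) `^ q^-1).
    apply: h.
    - by rewrite exprn_ge0.
    - by rewrite mulr_ge0 ?ltW.
    - by rewrite mulr_ge0 ?ltW.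
    - exact: measurable_dyadic_profile.
    - exact: measurable_dyadic_profile.
    - by move=> x; exact: dyadic_profile_ge0.
    - move=> x; rewrite Normc.normcM normc_cexpi mulr1 normc_real ger0_norm//.
      exact: dyadic_profile_ge0.
    - move=> xi; apply: le_trans (normc_fourier_gchirp_sum _ _ _ _ _) _ => //.
      rewrite /dyadic_profile mulr_sumr; apply: ler_sum => j _.
      rewrite mulrCA ler_wpM2l// normc_fourier_gchirp//; apply: ler_pM.
      + by rewrite exprn_ge0.
      + exact: gaussV_ge0.
      (* With b = 1 one has a^2 + b^2 >= 1, so [chirp_fourier0_le] bounds the squared modulus at
         frequency 0 by pi, uniformly in the scale. *)
      + rewrite lerXn2r ?nnegrE ?sqrtr_ge0// ler_sqrt ?pi_ge0//.
        rewrite -(ler_pXn2r (ltn0Sn 1)) ?nnegrE ?pi_ge0 ?addr_ge0 ?sqr_ge0//.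
        apply: le_trans (chirp_fourier0_le 1 (a0 j)).
        by rewrite ler_peMr ?sqr_ge0// expr1n lerDr sqr_ge0.
      (* Since a <= 1, a^2 + 1 <= 2 <= pi^2, so the transformed Gaussian decays at least as fast as
         the original one at the same scale. *)
      + rewrite !gaussVE ler_expR lerN2 -/(a j) ler_wpM2r ?sqnorm_ge0// expr1n.
        rewrite ler_pdivlMr; last by rewrite addr_gt0// exprn_gt0.
        rewrite mulrC ler_wpM2r ?(ltW (a0 j))//.
        apply: (@le_trans _ _ (1 + 1)).
          by rewrite lerD2r expr_le1// ltW.
        apply: (@le_trans _ _ (2 ^+ 2)); first by rewrite expr2; lra.
        by rewrite lerXn2r ?nnegrE ?pi_ge0.
    (* The cross terms of the square are nonnegative and dropped; each of the J diagonal terms has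
       integral (pi/2)^(n/2). *)
    - apply: (@le_trans _ _ (\int[mu]_x (\sum_(j < J) c j ^+ 2 * gaussV (2 * a j) x)%:E)%E); last first.
        apply: ge0_le_integral_EFin.
        - by apply: measurable_sum => j; apply: measurable_funM => //; exact: measurable_gaussV.
        - by apply: measurable_funX; exact: measurable_dyadic_profile.
        - by move=> x; apply: sumr_ge0 => j _; rewrite mulr_ge0 ?sqr_ge0 ?gaussV_ge0.
        move=> x; apply: le_trans (sum_sqr_le_sqr_sum (v := fun j => c j * gaussV (a j) x) J _).
          apply: eqW; apply: eq_bigr => j _.
          rewrite exprMn; congr (_ * _); rewrite !gaussVE -expRM_natl; congr expR; ring.
        by move=> j; rewrite mulr_ge0 ?gaussV_ge0.
      under eq_integral do rewrite -sumEFin.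
      rewrite ge0_integral_sum//; last 2 first.
      - move=> j; apply/measurable_EFinP; apply: measurable_funM => //; exact: measurable_gaussV.
      - by move=> j x _; rewrite lee_fin mulr_ge0 ?sqr_ge0 ?gaussV_ge0.
      have ij (j : 'I_J) : (\int[mu]_x (c j ^+ 2 * gaussV (2 * a j) x)%:E)%E =
          (Num.sqrt (pi / 2) ^+ n)%:E.
        under eq_integral do rewrite EFinM.
        rewrite ge0_integralZl//; last 3 first.
        - by apply/measurable_EFinP; exact: measurable_gaussV.
        - by move=> x _; rewrite lee_fin gaussV_ge0.
        - by rewrite lee_fin sqr_ge0.
        rewrite integral_gaussV ?mulr_gt0// -EFinM; congr EFin.
        have -> : pi / (2 * a j) = pi / 2 * (2 ^+ j) ^+ 2.
          by rewrite /a invfM invrK mulrA.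
        rewrite sqrtrM ?divr_ge0 ?pi_ge0// sqrtr_sqr ger0_norm ?ltW// exprMn mulrCA.
        have -> : c j ^+ 2 = (2 ^+ j) `^ (- N).
          by rewrite -(powR_mulrn 2 (c0 j)) /c -powRrM; congr (_ `^ _); field.
        rewrite -(powR_mulrn n (ltW (cj j))) -powRD ?(gt_eqF (cj j)) ?implybT//.
        by rewrite addNr powRr0 mulr1.
      under eq_bigr do rewrite ij.
      by rewrite sumEFin sumr_const card_ord mulr_natr.
    - exact: H1.
    - exact: H2.
  rewrite !powRM ?(ltW C10) ?(ltW C20)//.
  have JE : J%:R `^ p^-1 * J%:R `^ q^-1 * J%:R `^ d = J%:R :> R.
    rewrite -!powRD ?(gt_eqF J0') ?implybT//.
    by rewrite (_ : p^-1 + q^-1 + d = 1) ?powRr1//; rewrite /d; ring.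
  have y0 : 0 < J%:R `^ p^-1 * J%:R `^ q^-1 :> R by rewrite mulr_gt0 ?powR_gt0.
  rewrite -[X in C * (_ * X)]JE => h; rewrite -(ler_pM2r y0).
  apply: le_trans (le_trans _ h) _; apply: eqW.
    by move: (_ `^ d) (_ `^ p^-1) (_ `^ q^-1) (Num.sqrt _ ^+ n) => u1 u2 u3 u4; ring.
  by rewrite /D; move: (J%:R `^ p^-1) (J%:R `^ q^-1) (C1 `^ _) (C2 `^ _) (Num.sqrt _ ^+ n)
     => u1 u2 u3 u4 u5; ring.
pose z := D / (C * Num.sqrt (pi / 2) ^+ n).
have z0 : 0 <= z by rewrite divr_ge0 ?(ltW e0)// !mulr_ge0 ?powR_ge0 ?exprn_ge0.
(* The first integer above z^(1/d) makes J^d exceed z. *)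
have zJ : z `^ d^-1 < (Num.truncn (z `^ d^-1)).+1%:R.
  by have /andP[] := truncn_itv (powR_ge0 z d^-1).
have := key (Num.truncn (z `^ d^-1)).+1 erefl.
rewrite mulrC -ler_pdivlMr// -/z leNgt => /negP; apply.
rewrite [ltLHS](_ : _ = (z `^ d^-1) `^ d); last by rewrite -powRrM mulVf ?gt_eqF// powRr1.
by apply: gt0_ltr_powR => //; rewrite ?nnegrE ?powR_ge0.
Qed.

End necessity.

Local Open Scope complex_scope.

Theorem theorem3 (R : realType) (d : nat) (p q theta phi : R)
    (hd : (1 <= d)%N) (hp : 1 < p) (hq : 1 < q)
    (htheta : 0 < theta) (hphi : 0 < phi) :
  (exists C : R, 0 < C /\
     forall f : 'rV[R]_d -> R[i], schwartz f ->
       (C%:E * Lp_norm 2 f ^+ 2 <=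
        Lp_norm p (weighted theta f) * Lp_norm q (weighted phi (fourier f)))%E)
  <->
  [/\ theta / d%:R > 1 / 2 - 1 / p,
      phi / d%:R > 1 / 2 - 1 / q &
      1 / q + phi / d%:R = 1 / p + theta / d%:R].
Proof.
have d0 : 0 < d%:R :> R by rewrite ltr0n.
split=> [[C [C0 HC]]|[h1 _ h3]]; last exact: sufficiency.
have e (r s : R) : d%:R * (1 / r + s / d%:R) = s + d%:R / r.
  by rewrite mulrDr mul1r mulrCA divff ?mulr1 ?gt_eqF// addrC.
have eqE : 1 / q + phi / d%:R = 1 / p + theta / d%:R.
  by apply: (mulfI (lt0r_neq0 d0)); rewrite !e; exact: (scaling_necessary hp hq htheta hphi C0 HC).
(* The equality already proved makes the two threshold conditions one and the same; its negation
   supplies both hypotheses of [threshold_necessary]. *)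
have thr : 1 / 2 < 1 / p + theta / d%:R.
  rewrite ltNge; apply/negP => h.
  apply: (threshold_necessary hd hp hq htheta hphi C0 HC).
    by rewrite addrC -e -[2^-1]mul1r ler_wpM2l ?(ltW d0)//.
  by rewrite addrC -e -[2^-1]mul1r ler_wpM2l ?(ltW d0)// eqE.
by split=> //; rewrite ltrBlDl // eqE.
Qed.
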